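(* Let $\mathcal{M}\subset\mathbb{R}^D$, $\tau$, $\sigma$, $M=\tau/\sigma$ and the samples $r_1,\dots,r_n$ satisfy the sampling assumptions in the context (in particular $M$ is large enough), and let $r\in\mathcal{M}_\sigma$. Let $(q^*,H^* )=(q^*(r),H^*(r))$ be the output of Step 1 (see context) and let $p=\mathrm{Proj}_{\mathcal{M}}(q^* )$. Denote $\alpha=\sqrt{C_M/M}$ for some constant $C_M$ (independent of $\alpha$ and $M$). Then for any $\delta>0$ arbitrarily small there exists $N_\delta$ such that for all $n>N_\delta$, $$\angle_{\max}(H^*,T_p\mathcal{M})\le\alpha$$ with probability at least $1-\delta$. Furthermore, $$\|p-q^*\|\le 3\sigma.$$
   Context: Sampling assumptions. (1) $\mathcal{M}$ is a compact $d$-dimensional $C^k$ submanifold of $\mathbb{R}^D$ without boundary, with reach $\tau$ (the largest number such that every $x$ with $\mathrm{dist}(x,\mathcal{M})\le\tau$ has a unique nearest point $\mathrm{Proj}_{\mathcal{M}}(x)\in\mathcal{M}$). (2) $\sigma>0$ is the noise level and $M=\tau/\sigma$ is large enough (at least some threshold). (3) $r_1,\dots,r_n$ are independent and uniformly distributed (normalized Lebesgue measure) on $\mathcal{M}_\sigma=\{q\in\mathbb{R}^D:\mathrm{dist}(q,\mathcal{M})<\sigma\}$. $Gr(d,D)$ is the set of $d$-dimensional linear subspaces of $\mathbb{R}^D$; $\angle_{\max}(U,W)$ is the largest principal angle between two subspaces of the same dimension; $T_p\mathcal{M}$ is viewed as an element of $Gr(d,D)$. Step 1. Let $U_{\mathrm{ROI}}=\{r_i:\|r_i-r\|<\sqrt{\sigma\tau}\}$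 and let $N$ be the number of samples in $U_{\mathrm{ROI}}$. Put $J_1(r;q,H)=\frac1N\sum_{r_i\in U_{\mathrm{ROI}}}\mathrm{dist}^2(r_i-q,H)$. The output $(q^*,H^* )\in\mathbb{R}^D\times Gr(d,D)$ minimizes $J_1(r;q,H)$ subject to $r-q\perp H$ and $\|r-q\|<2\sigma$. *)

(* Defs.v *)
From HB Require Import structures.
From mathcomp Require Import all_boot all_order all_algebra.
From mathcomp Require Import all_classical all_reals all_analysis.

Set Implicit Arguments.
Unset Strict Implicit.
Unset Printing Implicit Defensive.

Import Order.TTheory GRing.Theory Num.Theory.
Import numFieldNormedType.Exports.

Local Open Scope classical_set_scope.
Local Open Scope ring_scope.

(* The library norm on 'rV_D is the sup norm, hence the explicit Euclidean
   structure below.  Both norms induce the same topology, so the library's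
   open, compact, derivable and 'D_v are used as they are. *)
Definition dotv (R : realType) (D : nat) (u v : 'rV[R]_D) : R :=
  \sum_(i < D) u 0 i * v 0 i.

Definition enorm (R : realType) (D : nat) (u : 'rV[R]_D) : R :=
  Num.sqrt (dotv u u).

(* Only meaningful for nonempty A: inf set0 = 0. *)
Definition edist (R : realType) (D : nat) (x : 'rV[R]_D)
    (A : set 'rV[R]_D) : R :=
  inf [set enorm (x - a) | a in A].

Definition nearest (R : realType) (D : nat) (A : set 'rV[R]_D)
    (x p : 'rV[R]_D) : Prop :=
  A p /\ forall a, A a -> enorm (x - p) <= enorm (x - a).

(* A supremum: for a circle of radius rho the admissible t form [0, rho[. *)
Definition reach (R : realType) (D : nat) (A : set 'rV[R]_D) : \bar R :=
  ereal_sup [set t%:E | t in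
    [set t : R | 0 <= t /\
       forall x, edist x A <= t -> exists! p, nearest A x p]].

Definition tube (R : realType) (D : nat) (A : set 'rV[R]_D) (sigma : R) :
    set 'rV[R]_D :=
  [set q | edist q A < sigma].

(* Equivalent to the definition by iterated partial derivatives; it is applied
   to open sets U only. *)
Fixpoint Ck (R : realType) (D E : nat) (m : nat) (U : set 'rV[R]_D)
    (f : 'rV[R]_D -> 'rV[R]_E) : Prop :=
  (forall x, U x -> {for x, continuous f}) /\
  if m is m'.+1 then
    forall v : 'rV[R]_D,
      (forall x, U x -> derivable f x v) /\ Ck m' U (fun x => 'D_v f x)
  else True.

Definition Ck_diffeo (R : realType) (D : nat) (k : nat)
    (U V : set 'rV[R]_D) (phi psi : 'rV[R]_D -> 'rV[R]_D) : Prop :=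
  [/\ open U /\ open V,
      forall x, U x -> V (phi x) /\ psi (phi x) = x,
      forall y, V y -> U (psi y) /\ phi (psi y) = y,
      Ck k U phi & Ck k V psi].

(* Slice charts onto open subsets of R^d x {0}: there is no boundary. *)
Definition is_submanifold (R : realType) (D : nat) (k d : nat)
    (A : set 'rV[R]_D) : Prop :=
  (d <= D)%N /\
  forall p, A p -> exists U V phi psi,
    [/\ U p, Ck_diffeo k U V phi psi &
        forall x, U x ->
          (A x <-> forall i : 'I_D, (d <= i)%N -> phi x 0 i = 0)].

Definition tangent_space (R : realType) (D : nat) (A : set 'rV[R]_D)
    (p : 'rV[R]_D) : set 'rV[R]_D :=
  [set v | exists gamma : R^o -> 'rV[R]_D,
     [/\ gamma 0 = p,
         \forall t \near (0 : R^o), A (gamma t) /\ derivable gamma t 1 &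
         is_derive (0 : R^o) 1 gamma v]].

(* u, w are principal vectors of U and W: (u j, w j) maximizes the inner
   product over pairs of unit vectors of U and W orthogonal to the previously
   chosen ones, and the j-th principal angle is acos (dotv (u j) (w j)). *)
Definition principal_vectors (R : realType) (D d : nat)
    (U W : set 'rV[R]_D) (u w : 'I_d -> 'rV[R]_D) : Prop :=
  let F (A : set 'rV[R]_D) (a : 'I_d -> 'rV[R]_D) (j : 'I_d) :=
    [set x | [/\ A x, enorm x = 1 &
                 forall i : 'I_d, (i < j)%N -> dotv x (a i) = 0]] in
  forall j : 'I_d,
    [/\ F U u j (u j), F W w j (w j) &
        forall x y, F U u j x -> F W w j y -> dotv x y <= dotv (u j) (w j)].

(* The principal angles do not depend on the choice of principal vectors, so
   this is the maximum of d numbers (and 0 if d = 0). *)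
Definition angle_max (R : realType) (D d : nat) (U W : set 'rV[R]_D) : R :=
  sup [set a | exists u w : 'I_d -> 'rV[R]_D, exists j : 'I_d,
         principal_vectors U W u w /\ a = acos (dotv (u j) (w j))].

Definition Gr (R : realType) (d D : nat) : set {vspace 'rV[R]_D} :=
  [set H | \dim H = d].

Definition borel_rV (R : realType) (D : nat) :=
  g_sigma_algebraType (@open 'rV[R]_D).

(* D-dimensional Lebesgue measure of a Borel set, by iterated integration. *)
Fixpoint lebesgue_rV (R : realType) (D : nat) : set 'rV[R]_D -> \bar R :=
  match D with
  | 0 => fun A => (\1_A 0)%:E
  | D'.+1 => fun A =>
      (\int[@lebesgue_measure R]_x
         lebesgue_rV [set v : 'rV[R]_D' | A (row_mx x%:M v)])%E
  end.

Definition iid_uniform (R : realType) (D n : nat) (disp : measure_display)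
    (T : measurableType disp) (P : probability T R) (B : set 'rV[R]_D)
    (X : 'I_n -> {RV P >-> borel_rV R D}) : Prop :=
  (forall (J : {set 'I_n}) (Q : 'I_n -> set (borel_rV R D)),
     (forall i, measurable (Q i)) ->
     P [set w | forall i, i \in J -> Q i (X i w)] =
     (\prod_(i in J) P (X i @^-1` Q i))%E) /\
  (forall (i : 'I_n) (Q : set (borel_rV R D)), measurable Q ->
     P (X i @^-1` Q) =
     (fine (lebesgue_rV (Q `&` B)) / fine (lebesgue_rV B))%:E).

Definition J1 (R : realType) (D n : nat) (sigma tau : R)
    (x : 'I_n -> 'rV[R]_D) (r q : 'rV[R]_D) (H : {vspace 'rV[R]_D}) : R :=
  (#|[pred i | enorm (x i - r) < Num.sqrt (sigma * tau)]|%:R)^-1 *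
  \sum_(i < n | enorm (x i - r) < Num.sqrt (sigma * tau))
     edist (x i - q) [set` H] ^+ 2.

Definition step1_feasible (R : realType) (D d : nat) (sigma : R)
    (r q : 'rV[R]_D) (H : {vspace 'rV[R]_D}) : Prop :=
  [/\ Gr d H, forall h, h \in H -> dotv (r - q) h = 0 &
      enorm (r - q) < 2 * sigma].

Definition step1_output (R : realType) (D d n : nat) (sigma tau : R)
    (x : 'I_n -> 'rV[R]_D) (r q : 'rV[R]_D) (H : {vspace 'rV[R]_D}) : Prop :=
  step1_feasible d sigma r q H /\
  forall q' H', step1_feasible d sigma r q' H' ->
    J1 sigma tau x r q H <= J1 sigma tau x r q' H'.

(* Main.v *)
Require Import Defs.
From HB Require Import structures.
From mathcomp Require Import all_boot all_order all_algebra.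
From mathcomp Require Import all_classical all_reals all_analysis.
From mathcomp Require Import measurable_realfun ring lra.

(* The sampled points near [r] lie within [O(sigma)] of the affine tangent plane
   [p0 + T] at the nearest point [p0] of [r], so [(p0, T)] makes [J1] at most
   [O(sigma^2)], and so does the minimizer [(q, H)].  By the law of large numbers
   a fixed fraction of these points falls in each of [d + 1] small balls centred
   at [p0] and at [p0 + s *: e_j], with [e] an orthonormal basis of [T] and [s] of
   order [sqrt (sigma * tau)]; in each ball some sample is then [O(sigma)]-close
   to [q + H].  Differences of these samples are almost [s *: e_j], hence [T] is
   within [O(sigma / s) = O(1 / sqrt M)] of [H].  The tangent spaces at [p0] and at
   [p] differ by as little, because the reach controls the curvature.  The fraction
   is bounded below by counting: the tube inside the ball is covered by, and each
   small ball contains, a number of cubes of side [~ sigma] of order [M^(d/2)],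
   since the plane [p0 + T] stays close to the manifold. *)

Set Implicit Arguments.
Unset Strict Implicit.
Unset Printing Implicit Defensive.

Import Order.TTheory GRing.Theory Num.Theory.
Import numFieldNormedType.Exports.
(* MathComp-Analysis has another [edist]. *)
Import Defs.
Local Open Scope classical_set_scope.
Local Open Scope ring_scope.

(** * Euclidean geometry of row vectors *)

(** The constants must depend on [d] and [D] alone, uniformly over the manifold, [sigma] and [r],
    although the volume of the tube is unknown. Volumes are therefore only compared: the upper bound
    for the ball and the lower bound for a cell are both numbers of cubes times the volume of a cube
    over that of the tube, and in the quotient the tube and all powers of [rho / sigma] cancel. The
    radius [rho = sqrt (sigma * tau)] is the scale at which the deviation [rho ^+ 2 / tau] of the
    manifold from its tangent plane equals the noise [sigma]. Minimality controls only a mean of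
    squared distances, so an individual sample may be far from [q + H]; and the offset [q] is
    unknown. This is why cells with many samples are used, and why there is one more of them than
    directions. As [k] may be 1, there is no second fundamental form to work with. Curvature enters
    only through inequalities derived from uniqueness of nearest points, for a metric notion of
    tangent plane that does not mention charts. *)

Section inner_product.
Context {R : realType} {D : nat}.
Implicit Types (u v w x y : 'rV[R]_D) (a b c : R).

Lemma dotvC u v : dotv u v = dotv v u.
Proof. by apply: eq_bigr => i _; rewrite mulrC. Qed.

Lemma dotvDl u v w : dotv (u + v) w = dotv u w + dotv v w.
Proof. by rewrite -big_split; apply: eq_bigr => i _; rewrite mxE mulrDl. Qed.

Lemma dotvZl a u v : dotv (a *: u) v = a * dotv u v.
Proof. by rewrite mulr_sumr; apply: eq_bigr => i _; rewrite mxE mulrA. Qed.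

Lemma dotvNl u v : dotv (- u) v = - dotv u v.
Proof. by rewrite -scaleN1r dotvZl mulN1r. Qed.

Lemma dotvDr u v w : dotv u (v + w) = dotv u v + dotv u w.
Proof. by rewrite dotvC dotvDl !(dotvC _ u). Qed.

Lemma dotvZr a u v : dotv u (a *: v) = a * dotv u v.
Proof. by rewrite dotvC dotvZl dotvC. Qed.

Lemma dotvNr u v : dotv u (- v) = - dotv u v.
Proof. by rewrite dotvC dotvNl dotvC. Qed.

Lemma dotv0l u : dotv 0 u = 0.
Proof. by rewrite -(scale0r u) dotvZl mul0r. Qed.

Lemma dotv0r u : dotv u 0 = 0.
Proof. by rewrite dotvC dotv0l. Qed.

Definition dotvE := (dotvDl, dotvDr, dotvNl, dotvNr, dotvZl, dotvZr).

Lemma dotv_addZ u a v : dotv (u + a *: v) (u + a *: v) =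
  dotv u u + 2 * a * dotv u v + a ^+ 2 * dotv v v.
Proof. by rewrite !dotvE (dotvC v u); ring. Qed.

Lemma dotv_sub u v :
  dotv (u - v) (u - v) = dotv u u - 2 * dotv u v + dotv v v.
Proof. by rewrite !dotvE (dotvC v u); ring. Qed.

Lemma dotv_add u v :
  dotv (u + v) (u + v) = dotv u u + 2 * dotv u v + dotv v v.
Proof. by rewrite !dotvE (dotvC v u); ring. Qed.

Lemma dotv_suml (I : Type) (s : seq I) (P : pred I) (F : I -> 'rV[R]_D) v :
  dotv (\sum_(i <- s | P i) F i) v = \sum_(i <- s | P i) dotv (F i) v.
Proof.
apply: (big_morph (fun u => dotv u v)) => [x y|]; first exact: dotvDl.
exact: dotv0l.
Qed.

Lemma dotvv_ge0 u : 0 <= dotv u u.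
Proof. by apply: sumr_ge0 => i _; rewrite -expr2 sqr_ge0. Qed.

Lemma dotvv_eq0 u : (dotv u u == 0) = (u == 0).
Proof.
apply/eqP/eqP => [/eqP|->]; last exact: dotv0l.
rewrite psumr_eq0 => [/allP u0|i _]; last by rewrite -expr2 sqr_ge0.
apply/rowP => i; rewrite mxE; apply/eqP.
by have := u0 i (mem_index_enum i); rewrite /= mulf_eq0 orbb.
Qed.

Lemma sqr_enorm u : enorm u ^+ 2 = dotv u u.
Proof. by rewrite sqr_sqrtr ?dotvv_ge0. Qed.

Lemma enorm_ge0 u : 0 <= enorm u. Proof. exact: sqrtr_ge0. Qed.

Lemma enorm0 : enorm (0 : 'rV[R]_D) = 0.
Proof. by rewrite /enorm dotv0l sqrtr0. Qed.

Lemma enorm_eq0 u : (enorm u == 0) = (u == 0).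
Proof. by rewrite -sqrf_eq0 sqr_enorm dotvv_eq0. Qed.

Lemma enorm_gt0 u : (0 < enorm u) = (u != 0).
Proof. by rewrite lt_def enorm_eq0 enorm_ge0 andbT. Qed.

Lemma enormZ a u : enorm (a *: u) = `|a| * enorm u.
Proof.
by rewrite /enorm !dotvE mulrA -expr2 sqrtrM ?sqr_ge0// sqrtr_sqr.
Qed.

Lemma enormZ_ge0 a u : 0 <= a -> enorm (a *: u) = a * enorm u.
Proof. by move=> a0; rewrite enormZ ger0_norm. Qed.

Lemma enormN u : enorm (- u) = enorm u.
Proof. by rewrite -scaleN1r enormZ normrN normr1 mul1r. Qed.

Lemma enorm_distC u v : enorm (u - v) = enorm (v - u).
Proof. by rewrite -enormN opprB. Qed.

Lemma enorm_le u c : 0 <= c -> (enorm u <= c) = (dotv u u <= c ^+ 2).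
Proof. by move=> c0; rewrite -sqr_enorm ler_sqr ?nnegrE ?enorm_ge0. Qed.

Lemma enorm_ge u c : 0 <= c -> (c <= enorm u) = (c ^+ 2 <= dotv u u).
Proof. by move=> c0; rewrite -sqr_enorm ler_sqr ?nnegrE ?enorm_ge0. Qed.

Lemma dotv_le u v : dotv u v <= enorm u * enorm v.
Proof.
have [->|u0] := eqVneq u 0; first by rewrite dotv0l enorm0 mul0r.
have [->|v0] := eqVneq v 0; first by rewrite dotv0r enorm0 mulr0.
have nu : 0 < enorm u by rewrite enorm_gt0.
have nv : 0 < enorm v by rewrite enorm_gt0.
have := dotvv_ge0 (enorm v *: u - enorm u *: v).
rewrite !dotvE -!sqr_enorm (dotvC v u) => h.
have : 0 <= 2 * (enorm u * enorm v) * (enorm u * enorm v - dotv u v) by lra.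
by rewrite pmulr_rge0 ?subr_ge0// ?mulr_gt0.
Qed.

Lemma dotv_ge u v : - (enorm u * enorm v) <= dotv u v.
Proof. by rewrite lerNl -dotvNl -(enormN u) dotv_le. Qed.

Lemma enormD u v : enorm (u + v) <= enorm u + enorm v.
Proof.
rewrite enorm_le ?addr_ge0 ?enorm_ge0// !dotvE -!sqr_enorm (dotvC v u).
by have := dotv_le u v; lra.
Qed.

Lemma enormB u v : enorm (u - v) <= enorm u + enorm v.
Proof. by rewrite -(enormN v) enormD. Qed.

Lemma enorm_dist x y z : enorm (x - z) <= enorm (x - y) + enorm (y - z).
Proof. by rewrite -[x - z](subrKA y) enormD. Qed.

Lemma enorm_sum (I : Type) (s : seq I) (P : pred I) (F : I -> 'rV[R]_D) :
  enorm (\sum_(i <- s | P i) F i) <= \sum_(i <- s | P i) enorm (F i).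
Proof.
elim/big_ind2: _ => [||//]; first by rewrite enorm0.
by move=> x1 x2 y1 y2 h1 h2; apply: le_trans (enormD _ _) _; exact: lerD.
Qed.

Lemma coord_le_enorm u i : `|u 0 i| <= enorm u.
Proof.
rewrite -sqrtr_sqr ler_wsqrtr// /dotv (bigD1 i)//= -expr2 lerDl.
by apply: sumr_ge0 => j _; rewrite -expr2 sqr_ge0.
Qed.

Lemma norm_le_enorm u : `|u| <= enorm u.
Proof.
rewrite [leLHS]/Num.Def.normr/= mx_normrE; apply: bigmax_le => [|[i j] _ /=].
  exact: enorm_ge0.
by rewrite ord1; exact: coord_le_enorm.
Qed.

Lemma coord_le_norm u i : `|u 0 i| <= `|u|.
Proof.
rewrite [leRHS]/Num.Def.normr/= mx_normrE.
exact: (le_bigmax _ (fun ij : 'I_1 * 'I_D => `|u ij.1 ij.2|) (0, i)).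
Qed.

Lemma enorm_delta (i : 'I_D) : enorm (delta_mx 0 i : 'rV[R]_D) = 1.
Proof.
rewrite /enorm /dotv (bigD1 i)//= big1 => [|j /negPf ji].
  by rewrite mxE !eqxx mulr1 addr0 sqrtr1.
by rewrite mxE ji andbF mul0r.
Qed.

Lemma enorm_le_sum u : enorm u <= \sum_(i < D) `|u 0 i|.
Proof.
have {1}-> : u = \sum_(i < D) u 0 i *: delta_mx 0 i by exact: row_sum_delta.
apply: le_trans (enorm_sum _ _ _) _.
by apply: ler_sum => i _; rewrite enormZ enorm_delta mulr1.
Qed.

Lemma enorm_le_coord u c : (forall i, `|u 0 i| <= c) -> enorm u <= D%:R * c.
Proof.
move=> uc; apply: (le_trans (enorm_le_sum u)).
rewrite mulr_natl -[D in leRHS]card_ord -sumr_const.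
by apply: ler_sum => i _.
Qed.

Lemma enorm_le_norm u : enorm u <= D%:R * `|u|.
Proof. by apply: enorm_le_coord => i; exact: coord_le_norm. Qed.

Lemma nbhs_enormP x (A : set 'rV[R]_D) :
  nbhs x A <-> exists2 e, 0 < e & forall y, enorm (y - x) < e -> A y.
Proof.
split=> [/nbhs_ballP[e /= e0 xA]|[e e0 xA]].
  exists e => // y yx; apply: xA; rewrite -ball_normE /ball_/=.
  by rewrite distrC (le_lt_trans (norm_le_enorm _)).
apply/nbhs_ballP; exists (e / D.+1%:R) => /=; first by rewrite divr_gt0.
move=> y; rewrite -ball_normE /ball_/= distrC ltr_pdivlMr// => yx.
apply: xA; apply: le_lt_trans (enorm_le_norm _) (le_lt_trans _ yx).
by rewrite mulrC ler_wpM2l// ler_nat.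
Qed.

Lemma open_enormP (A : set 'rV[R]_D) : open A <->
  forall x, A x -> exists2 e, 0 < e & forall y, enorm (y - x) < e -> A y.
Proof.
rewrite openE; split=> h x /h; first by move/nbhs_enormP.
by move=> xA; apply/nbhs_enormP.
Qed.

Lemma lipschitz_continuous_cst (f : 'rV[R]_D -> R) c : 0 < c ->
  (forall x y, f y <= f x + c * enorm (y - x)) -> continuous f.
Proof.
move=> c0 fl x A /nbhs_ballP[e /= e0 eA].
apply/nbhs_enormP; exists (e / c) => [|y]; first by rewrite divr_gt0.
rewrite ltr_pdivlMr// mulrC => yx; apply: eA.
rewrite -ball_normE /ball_/= ltr_norml; apply/andP; split.
  by have := fl x y; lra.
by have := fl y x; rewrite enorm_distC; lra.
Qed.

Lemma lipschitz_continuous (f : 'rV[R]_D -> R) :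
  (forall x y, f y <= f x + enorm (y - x)) -> continuous f.
Proof.
by move=> fl; apply: (@lipschitz_continuous_cst f 1) => // x y; rewrite mul1r.
Qed.

Lemma closed_lipschitz_le (f : 'rV[R]_D -> R) c :
  (forall x y, f y <= f x + enorm (y - x)) -> closed [set x | f x <= c].
Proof.
move=> fl; rewrite -[X in closed X]/(f @^-1` [set t | t <= c]).
apply: (preimage_closed _ (@closed_le _ _)) => x _.
exact: lipschitz_continuous.
Qed.

Lemma compact_closed_ball x c : compact [set y | enorm (y - x) <= c].
Proof.
apply: bounded_closed_compact.
  exists (c + enorm x); split=> [|M cM y /= yx]; first exact: num_real.
  apply: le_trans (norm_le_enorm _) (le_trans _ (ltW cM)).
  by rewrite -[y](subrK x); apply: le_trans (enormD _ _) _; rewrite lerD2r.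
apply: closed_lipschitz_le => y z.
by have := enorm_dist z y x; lra.
Qed.

End inner_product.

(** * Orthonormal families and orthogonal projections *)

Section orthonormal.
Context {R : realType} {D : nat}.
Implicit Types (V : {vspace 'rV[R]_D}) (e : nat -> 'rV[R]_D).

(** The family is a function on [nat] of which the first [k] values count, so that it can be
    extended without casts between ordinal types. *)
Definition orthonormal (k : nat) e :=
  forall i j, (i < k)%N -> (j < k)%N -> dotv (e i) (e j) = (i == j)%:R.

Lemma dotv_ortho_sum k e (a : 'I_k -> R) (j : 'I_k) : orthonormal k e ->
  dotv (\sum_(i < k) a i *: e i) (e j) = a j.
Proof.
move=> oe; rewrite dotv_suml (bigD1 j)//= dotvZl oe// eqxx mulr1 big1 ?addr0//.
by move=> i /negPf ij; rewrite dotvZl oe// -[_ == _]/(i == j) ij mulr0.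
Qed.

(** Gram-Schmidt step: [k < \dim V] vectors cannot span [V], and a vector of [V] outside their span,
    minus its projection, is nonzero and can be normalized. *)
Lemma orthonormal_extend V k e : orthonormal k e -> (k < \dim V)%N ->
  (forall i, (i < k)%N -> e i \in V) ->
  exists v, [/\ v \in V, enorm v = 1 &
               forall i, (i < k)%N -> dotv v (e i) = 0].
Proof.
move=> oe kV eV.
pose es := [seq e i | i <- iota 0 k].
have : ~~ (V <= <<es>>)%VS.
  apply: contraL kV => /dimvS Ves; rewrite -leqNgt; apply: leq_trans Ves _.
  by rewrite (leq_trans (dim_span _))// size_map size_iota.
move=> /subvPn[x xV xes].
pose y := x - \sum_(i < k) dotv x (e i) *: e i.
have yE i : (i < k)%N -> dotv y (e i) = 0.
  move=> ik; rewrite /y dotvDl dotvNl.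
  by rewrite (dotv_ortho_sum (fun i => dotv x (e i)) (Ordinal ik))// subrr.
have y0 : 0 < enorm y.
  rewrite enorm_gt0; apply: contraNneq xes => /eqP; rewrite subr_eq0 => /eqP->.
  apply: memv_suml => i _; apply: memvZ; apply: memv_span.
  by apply/mapP; exists (i : nat) => //; rewrite mem_iota /=.
exists ((enorm y)^-1 *: y); split.
- apply: memvZ; rewrite memvB//; apply: memv_suml => i _.
  by apply: memvZ; exact: eV.
- by rewrite enormZ_ge0 ?invr_ge0 ?enorm_ge0// mulVf// gt_eqF.
- by move=> i ik; rewrite dotvZl yE// mulr0.
Qed.

Lemma orthonormal_dim V k e : orthonormal k e ->
  (forall i, (i < k)%N -> e i \in V) -> (k <= \dim V)%N.
Proof.
move=> oe eV; pose es := [tuple e i | i < k].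
have fe : free es.
  apply/freeP => a a0 i; rewrite -(dotv_ortho_sum a i oe).
  under eq_bigr => j _ do rewrite -(nth_mktuple (fun i : 'I_k => e i) 0 j).
  by rewrite a0 dotv0l.
have /eqP <- : \dim <<es>> == k by move: fe; rewrite /free size_tuple.
apply: dimvS; apply/span_subvP => x /mapP[i _ ->]; exact: eV.
Qed.

Lemma orthonormal_cons k e v : orthonormal k e -> enorm v = 1 ->
  (forall i, (i < k)%N -> dotv v (e i) = 0) ->
  orthonormal k.+1 (fun i => if i == k then v else e i).
Proof.
move=> oe v1 ve i j; rewrite !ltnS (leq_eqVlt i) (leq_eqVlt j).
case: (eqVneq i k) => [->|ik] /=.
  move=> _; case: (eqVneq j k) => [->|jk] /=.
    by move=> _; rewrite -sqr_enorm v1 expr1n ?eqxx.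
  by move=> jk'; rewrite ve// eq_sym (negPf jk).
move=> ik'; case: (eqVneq j k) => [->|jk] /=; last exact: oe.
by move=> _; rewrite dotvC ve// (negPf ik).
Qed.

Lemma orthonormal_basis V : exists e,
  [/\ orthonormal (\dim V) e, forall i, (i < \dim V)%N -> e i \in V &
      forall v, v \in V -> v = \sum_(i < \dim V) dotv v (e i) *: e i].
Proof.
have [e oe eV] : exists2 e, orthonormal (\dim V) e &
    forall i, (i < \dim V)%N -> e i \in V.
  have : forall k, (k <= \dim V)%N -> exists2 e, orthonormal k e &
      forall i, (i < k)%N -> e i \in V; last exact.
  elim=> [_|k IH kV]; first by exists (fun=> 0).
  have [e oe eV] := IH (ltnW kV).
  have [v [vV v1 ve]] := orthonormal_extend oe kV eV.
  exists (fun i => if i == k then v else e i) => [|i].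
    exact: orthonormal_cons.
  by rewrite ltnS leq_eqVlt; case: eqP => //= _; exact: eV.
exists e; split => // v vV.
apply/eqP; rewrite -subr_eq0; apply/negPn/negP => y0.
set y := v - _ in y0.
have yV : y \in V.
  by rewrite memvB//; apply: memv_suml => i _; apply: memvZ; exact: eV.
have yE i : (i < \dim V)%N -> dotv y (e i) = 0.
  move=> ik; rewrite /y dotvDl dotvNl.
  by rewrite (dotv_ortho_sum (fun i => dotv v (e i)) (Ordinal ik))// subrr.
have ny : enorm y != 0 by rewrite enorm_eq0.
(* A nonzero remainder [y], once normalized, would complete an orthonormal family of [\dim V + 1]
   vectors of [V]. *)
have := @orthonormal_dim V (\dim V).+1
  (fun i => if i == \dim V then (enorm y)^-1 *: y else e i).
rewrite ltnn => h; suff : false by [].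
apply: h => [|i].
  apply: orthonormal_cons => // [|i iV].
    by rewrite enormZ_ge0 ?invr_ge0 ?enorm_ge0// mulVf.
  by rewrite dotvZl yE// mulr0.
by rewrite ltnS leq_eqVlt; case: eqP => [_ _|_ /=]; [exact: memvZ|exact: eV].
Qed.

Lemma orthogonal_projection V v : exists2 y, y \in V &
  forall z, z \in V -> dotv (v - y) z = 0.
Proof.
have [e [oe eV Ve]] := orthonormal_basis V.
exists (\sum_(i < \dim V) dotv v (e i) *: e i).
  by apply: memv_suml => i _; apply: memvZ; exact: eV.
move=> z /Ve ->; rewrite dotvC dotv_suml big1// => i _.
rewrite dotvZl (dotvC (e i)) dotvDl dotvNl.
by rewrite (dotv_ortho_sum (fun i => dotv v (e i)))// subrr mulr0.
Qed.

End orthonormal.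

(** * Sets of positive reach *)

Section distance.
Context {R : realType} {D : nat}.
Implicit Types (A : set 'rV[R]_D) (x y z p : 'rV[R]_D).

Lemma edist_le A x a : A a -> edist x A <= enorm (x - a).
Proof.
move=> Aa; apply: ge_inf; last by exists a.
by exists 0 => _ [b _ <-]; exact: enorm_ge0.
Qed.

Lemma edist_ge A x c : A !=set0 -> (forall a, A a -> c <= enorm (x - a)) ->
  c <= edist x A.
Proof.
move=> [a Aa] h; apply: lb_le_inf; first by exists (enorm (x - a)), a.
by move=> _ [b /h ? <-].
Qed.

Lemma edist_lt A x c : A !=set0 -> edist x A < c ->
  exists2 a, A a & enorm (x - a) < c.
Proof.
move=> [a Aa] /inf_lt[|_ [b Ab <-] bc]; last by exists b.
by exists (enorm (x - a)), a.
Qed.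

Lemma edist_ge0 A x : A !=set0 -> 0 <= edist x A.
Proof. by move=> A0; apply: edist_ge => // a _; exact: enorm_ge0. Qed.

Lemma nearest_edist A x p : nearest A x p -> edist x A = enorm (x - p).
Proof.
move=> [Ap h]; apply/eqP; rewrite eq_le edist_le//=.
by apply: edist_ge => //; exists p.
Qed.

Lemma edist_lipschitz A x y : A !=set0 ->
  edist y A <= edist x A + enorm (y - x).
Proof.
move=> A0; rewrite -lerBlDr; apply: edist_ge => // a Aa.
by have := enorm_dist y x a; have := edist_le y Aa; lra.
Qed.

Lemma nearest_exists A x : A !=set0 -> compact A -> exists p, nearest A x p.
Proof.
move=> A0 cA; have [|p] := EVT_min_rV (f := fun a => enorm (x - a)) A0 cA.
  apply: continuous_subspaceT; apply: lipschitz_continuous => y z.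
  by rewrite (enorm_distC z y) enorm_dist.
rewrite inE => Ap h; exists p; split => // a Aa.
by apply: h; rewrite inE.
Qed.

(** The points of [A] at distance at least [eps] from [m] form a compact set, on which the distance
    to [z] exceeds [enorm (z - m)] by a positive gap; moving [z] by less than half the gap cannot
    bring the nearest point there. *)
Lemma nearest_continuous A z m eps : compact A -> nearest A z m ->
  (forall m', nearest A z m' -> m' = m) -> 0 < eps ->
  exists2 dl, 0 < dl & forall y p, enorm (y - z) < dl -> nearest A y p ->
    enorm (p - m) < eps.
Proof.
move=> cA [Am zm] mu eps0.
(* The signs are reversed because [closed_lipschitz_le] is about sublevel sets. *)
pose K := A `&` [set a | - enorm (a - m) <= - eps].
have cK : compact K.
  apply: compact_closedI => //; apply: closed_lipschitz_le => x y.
  by have := enorm_dist x y m; rewrite (enorm_distC x y); lra.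
have [K0|K0] := pselect (K !=set0); last first.
  exists 1 => // y p _ [Ap _]; rewrite ltNge; apply/negP => pm.
  by apply: K0; exists p; split => //=; rewrite lerN2.
have [|c] := EVT_min_rV (f := fun a => enorm (z - a)) K0 cK.
  apply: continuous_subspaceT; apply: lipschitz_continuous => x y.
  by rewrite (enorm_distC y x) enorm_dist.
rewrite inE => -[Ac /=]; rewrite lerN2 => cm cmin.
have mc : enorm (z - m) < enorm (z - c).
  rewrite ltNge; apply/negP => h.
  have : c = m by apply: mu; split => // a /zm; exact: le_trans.
  by move=> cE; move: cm; rewrite cE subrr enorm0; lra.
exists ((enorm (z - c) - enorm (z - m)) / 2); first lra.
move=> y p yz [Ap yp]; rewrite ltNge; apply/negP => pm.
have : enorm (z - c) <= enorm (z - p).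
  by apply: cmin; rewrite inE; split => //=; rewrite lerN2.
have := yp m Am; have := enorm_dist z y p; have := enorm_dist y z m.
by rewrite (enorm_distC z y); lra.
Qed.

(* Away from [A], moving in the direction of [z - m] increases the distance at
   unit rate, because the nearest point is continuous at [z]. *)
Lemma edist_slope A z m eps : A !=set0 -> compact A -> nearest A z m ->
  (forall m', nearest A z m' -> m' = m) -> z != m -> 0 < eps -> eps < 1 ->
  exists2 h0, 0 < h0 & forall h, 0 < h -> h < h0 ->
    edist z A + (1 - eps) * h <= edist (z + (h / enorm (z - m)) *: (z - m)) A.
Proof.
move=> A0 cA zm mu; rewrite -subr_eq0 -enorm_gt0 => d0 eps0 eps1.
have [dl dl0 hdl] := nearest_continuous cA zm mu (mulr_gt0 eps0 d0).
exists dl => // h h0 hdl'.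
set d := enorm (z - m) in d0 hdl *.
set y := z + _.
have yz : y - z = (h / d) *: (z - m) by rewrite /y addrC addKr.
have [p yp] := nearest_exists y A0 cA.
have hd0 : 0 <= h / d by rewrite divr_ge0// ltW.
have nyz : enorm (y - z) = h.
  by rewrite yz enormZ_ge0// -/d mulfVK// gt_eqF.
have pm : enorm (p - m) < eps * d by apply: hdl yp; rewrite nyz.
rewrite (nearest_edist zm) (nearest_edist yp) -/d.
have dd : dotv (z - m) (z - m) = d ^+ 2 by rewrite sqr_enorm.
have [Ap _] := yp.
have dp : d ^+ 2 <= dotv (z - p) (z - p).
  by rewrite -enorm_ge ?(ltW d0)//; exact: zm.2.
(* As [p] is within [eps * d] of [m], the directions [z - m] and [z - p] nearly agree, so the
   distance from [p] grows at a rate of at least [1 - eps]. *)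
have key : (1 - eps) * d ^+ 2 <= dotv (z - m) (z - p).
  have -> : dotv (z - m) (z - p) = dotv (z - m) (z - m) - dotv (z - m) (p - m).
    by rewrite -dotvNr -dotvDr opprB addrA subrK.
  have := dotv_le (z - m) (p - m); rewrite -/d dd => k1.
  have : d * enorm (p - m) <= d * (eps * d) by rewrite ler_wpM2l// ltW.
  lra.
rewrite enorm_ge; last by rewrite addr_ge0 ?mulr_ge0// ?ltW// subr_gt0.
have -> : y - p = (z - p) + (h / d) *: (z - m) by rewrite -yz (addrC (z - p)) subrKA.
rewrite dotv_addZ dd (dotvC (z - p)).
have e1 : (h / d) ^+ 2 * d ^+ 2 = h ^+ 2 by field; rewrite gt_eqF.
have e2 : h / d * ((1 - eps) * d ^+ 2) <= h / d * dotv (z - m) (z - p).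
  by rewrite ler_wpM2l.
have e3 : h / d * ((1 - eps) * d ^+ 2) = (1 - eps) * d * h.
  by field; rewrite gt_eqF.
have e4 : ((1 - eps) * h) ^+ 2 <= h ^+ 2.
  by rewrite exprMn ler_piMl ?sqr_ge0// expr_le1 ?subr_ge0 ?ltW//; lra.
lra.
Qed.

End distance.

(** * Consequences of unique nearest points within distance [tau] *)

Section positive_reach.
Context {R : realType} {D : nat} (A : set 'rV[R]_D) (tau : R).
Hypotheses (A0 : A !=set0) (cA : compact A).
Hypothesis unique_nearest : forall x, edist x A < tau -> exists! p, nearest A x p.

(* Maximizing [edist z A - (1 - eps) * enorm (z - x)] over the ball of radius [t]
   replaces the flow of the gradient of the distance function. *)
Lemma edist_ball_increase x t eps : 0 < edist x A -> 0 <= t ->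
  edist x A + t < tau -> 0 < eps -> eps < 1 ->
  exists2 z, enorm (z - x) <= t & edist x A + (1 - eps) * t <= edist z A.
Proof.
move=> x0 t0 xt eps0 eps1.
pose f z := edist z A - (1 - eps) * enorm (z - x).
have fc : continuous f.
  apply: (@lipschitz_continuous_cst _ _ _ 2) => // u v; rewrite /f.
  have := edist_lipschitz u v A0; have := enorm_dist u v x.
  rewrite (enorm_distC u v) => h1 h2.
  have : (1 - eps) * enorm (u - x) <= (1 - eps) * (enorm (v - u) + enorm (v - x)).
    by rewrite ler_wpM2l// subr_ge0 ltW.
  have : 0 <= eps * enorm (v - u) by rewrite mulr_ge0 ?enorm_ge0// ltW.
  lra.
have [|||z] := @EVT_max_rV R D f [set z | enorm (z - x) <= t].
- by exists x => /=; rewrite subrr enorm0.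
- exact: compact_closed_ball.
- exact: continuous_subspaceT.
rewrite inE /= => zt zmax.
have fz : edist x A <= f z.
  have := zmax x; rewrite inE /= subrr enorm0 => /(_ t0).
  by rewrite {1}/f subrr enorm0 mulr0 subr0.
(* It remains to see that the maximizer lies on the sphere. From an interior point, a small step
   along [z - m] stays in the ball and gains at rate [1 - eps / 2], more than the penalty [1 - eps]
   takes back. *)
exists z => //; suff -> : t = enorm (z - x) by move: fz; rewrite /f; lra.
apply/eqP; rewrite eq_le zt andbT leNgt; apply/negP => ztlt.
have z0 : 0 < edist z A.
  move: fz; rewrite /f; have := mulr_ge0 (ltW _ : 0 <= 1 - eps) (enorm_ge0 (z - x)).
  by rewrite subr_gt0 => /(_ eps1); lra.
have ztau : edist z A < tau.
  by have := edist_lipschitz x z A0; lra.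
have [m [zm mu]] := unique_nearest ztau.
have zNm : z != m.
  by rewrite -subr_eq0 -enorm_gt0 -(nearest_edist zm).
have e20 : 0 < eps / 2 by lra.
have e21 : eps / 2 < 1 by lra.
have mu' m' : nearest A z m' -> m' = m by move=> /mu.
have [h0 h00 hh] := edist_slope A0 cA zm mu' zNm e20 e21.
pose h := Num.min (h0 / 2) (t - enorm (z - x)).
have h_gt0 : 0 < h by rewrite lt_min; apply/andP; split; lra.
have hh0 : h < h0.
  by apply: le_lt_trans (_ : h0 / 2 < h0); [rewrite ge_min lexx|lra].
have ht : enorm (z - x) + h <= t.
  have : h <= t - enorm (z - x) by rewrite ge_min lexx orbT.
  lra.
have := hh _ h_gt0 hh0; set y := z + _ => hy.
have yz : enorm (y - z) = h.
  rewrite /y addrC addKr enormZ_ge0 ?mulfVK//.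
    by rewrite gt_eqF// enorm_gt0 subr_eq0.
  by rewrite divr_ge0 ?enorm_ge0// ltW.
have yx : enorm (y - x) <= enorm (z - x) + h.
  by have := enorm_dist y z x; rewrite yz; lra.
have := zmax y; rewrite inE /= => /(_ (le_trans yx ht)); rewrite /f.
have : (1 - eps) * enorm (y - x) <= (1 - eps) * (enorm (z - x) + h).
  by rewrite ler_wpM2l// subr_ge0 ltW.
have : 0 < eps * h by rewrite mulr_gt0.
move: hy; lra.
Qed.

(** The limit [eps -> 0] of the preceding bound, taken at the maximizer of the distance over the
    compact ball. *)
Lemma edist_ball_attained x t : 0 < edist x A -> 0 <= t ->
  edist x A + t < tau ->
  exists2 z, enorm (z - x) <= t & edist x A + t <= edist z A.
Proof.
move=> x0 t0 xt.
have [|||z] := @EVT_max_rV R D (fun z => edist z A) [set z | enorm (z - x) <= t].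
- by exists x => /=; rewrite subrr enorm0.
- exact: compact_closed_ball.
- apply: continuous_subspaceT.
  by apply: lipschitz_continuous => u v; exact: edist_lipschitz.
rewrite inE /= => zt zmax; exists z => //.
rewrite leNgt; apply/negP => h.
have tgt0 : 0 < t.
  rewrite lt_def t0 andbT; apply/eqP => t00.
  have /eqP : enorm (z - x) = 0 by apply/eqP; rewrite eq_le enorm_ge0 -t00 zt.
  by rewrite enorm_eq0 subr_eq0 => /eqP zx; move: h; rewrite zx t00; lra.
(* [eps * t] is at most half of what is missing at [z]; the [1 / 2] keeps [eps] below 1. *)
pose eps := Num.min (1 / 2) ((edist x A + t - edist z A) / (2 * t)).
have eps0 : 0 < eps by rewrite lt_min divr_gt0//= divr_gt0 ?subr_gt0 ?mulr_gt0.
have eps1 : eps < 1.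
  by apply: le_lt_trans (_ : 1 / 2 < 1); [rewrite ge_min lexx|lra].
have [y yt hy] := edist_ball_increase x0 t0 xt eps0 eps1.
have := zmax y; rewrite inE => /(_ yt).
have : eps * t <= (edist x A + t - edist z A) / (2 * t) * t.
  by rewrite ler_wpM2r// ge_min lexx orbT.
have -> : (edist x A + t - edist z A) / (2 * t) * t = (edist x A + t - edist z A) / 2.
  by field; rewrite gt_eqF.
lra.
Qed.

(** A point [z] within [t] of [x] and at distance at least [enorm (x - p) + t] from [A], hence from
    [p], is an equality case of the triangle inequality: it is the point of the ray from [p] through
    [x] obtained by going [t] beyond [x]. *)
Lemma reach_push x p t a : nearest A x p -> 0 < enorm (x - p) -> 0 <= t ->
  enorm (x - p) + t < tau -> A a ->
  enorm (x - p) + t <= enorm (x + (t / enorm (x - p)) *: (x - p) - a).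
Proof.
move=> xp; rewrite -(nearest_edist xp) => x0 t0 xt Aa.
have [z zx hz] := edist_ball_attained x0 t0 xt.
rewrite (nearest_edist xp) in x0 hz xt *.
set d := enorm (x - p) in x0 hz xt *.
suff <- : z = x + (t / d) *: (x - p).
  by apply: le_trans hz _; exact: edist_le.
have : (d + t) ^+ 2 <= dotv (z - p) (z - p).
  rewrite -enorm_ge; last by rewrite addr_ge0// ltW.
  apply: le_trans hz _.
  by apply: edist_le; exact: xp.1.
rewrite -[z - p](subrKA x) dotv_add -!sqr_enorm -/d => h1.
have h2 : enorm (z - x) ^+ 2 <= t ^+ 2 by rewrite ler_sqr ?nnegrE ?enorm_ge0.
have h3 : d * t <= dotv (z - x) (x - p) by nra.
apply/eqP; rewrite -subr_eq0 -enorm_eq0 eq_le enorm_ge0 andbT.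
rewrite enorm_le// expr0n/=.
have -> : z - (x + (t / d) *: (x - p)) = (z - x) - (t / d) *: (x - p).
  by rewrite opprD addrA.
rewrite -scaleNr dotv_addZ -!sqr_enorm -/d.
have h4 : t / d * (d * t) <= t / d * dotv (z - x) (x - p).
  by rewrite ler_wpM2l// divr_ge0// ltW.
have h5 : t / d * (d * t) = t ^+ 2 by field; rewrite gt_eqF.
have h6 : (- (t / d)) ^+ 2 * d ^+ 2 = t ^+ 2 by field; rewrite gt_eqF.
nra.
Qed.

(* Federer, Curvature measures, Theorem 4.8 (7). *)
Lemma normal_ineq x p a : nearest A x p -> enorm (x - p) < tau -> A a ->
  2 * tau * dotv (x - p) (a - p) <= enorm (x - p) * enorm (a - p) ^+ 2.
Proof.
move=> xp xtau Aa.
have [xp0|] := eqVneq (enorm (x - p)) 0.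
  rewrite xp0 mul0r; move/eqP: xp0; rewrite enorm_eq0 => /eqP ->.
  by rewrite dotv0l mulr0.
move=> xpn0; have x0 : 0 < enorm (x - p) by rewrite lt_def xpn0 enorm_ge0.
(* Squaring [reach_push] gives the inequality with [enorm (x - p) + t] in place of [tau]; the rest
   of the proof lets this radius tend to [tau]. *)
have h t : 0 <= t -> enorm (x - p) + t < tau ->
   2 * (enorm (x - p) + t) * dotv (x - p) (a - p) <= enorm (x - p) * enorm (a - p) ^+ 2.
  move=> t0 xt; have := reach_push xp x0 t0 xt Aa.
  set d := enorm (x - p) in x0 xt *.
  rewrite enorm_ge; last by rewrite addr_ge0// ltW.
  have -> : x + (t / d) *: (x - p) - a = - (a - p) + ((d + t) / d) *: (x - p).
    by apply/rowP => i; rewrite !mxE; field; rewrite gt_eqF.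
  rewrite dotv_addZ !(dotvNl (a - p)) dotvNr (dotvC (a - p)) opprK -!sqr_enorm -/d => h1.
  have e1 : ((d + t) / d) ^+ 2 * d ^+ 2 = (d + t) ^+ 2.
    by field; rewrite gt_eqF.
  have : 2 * ((d + t) / d * dotv (x - p) (a - p)) <= enorm (a - p) ^+ 2 by lra.
  rewrite -(ler_pM2l x0).
  suff -> : d * (2 * ((d + t) / d * dotv (x - p) (a - p))) =
    2 * (d + t) * dotv (x - p) (a - p) by [].
  by field; rewrite gt_eqF.
rewrite leNgt; apply/negP => hc.
set B := _ * _ ^+ 2 in h hc; set c := dotv _ _ in h hc.
set d := enorm (x - p) in x0 xtau h hc.
have c0 : 0 < c.
  rewrite ltNge; apply/negP => c0.
  have : 0 <= B by rewrite /B mulr_ge0 ?sqr_ge0// ltW.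
  by have := h 0 (lexx _); rewrite addr0 => /(_ xtau); nra.
pose e := Num.min ((tau - d) / 2) ((2 * tau * c - B) / (4 * c)).
have e0 : 0 < e.
  by rewrite lt_min; apply/andP; split; [lra|rewrite divr_gt0 ?subr_gt0 ?mulr_gt0].
have e1 : e <= (tau - d) / 2 by rewrite ge_min lexx.
have e2 : e * (4 * c) <= 2 * tau * c - B.
  by rewrite -ler_pdivlMr ?mulr_gt0// ge_min lexx orbT.
have := h (tau - e - d); rewrite (addrC d) subrK => h1.
have : 2 * (tau - e) * c <= B by apply: h1; lra.
have : 0 < e * c by rewrite mulr_gt0.
lra.
Qed.

End positive_reach.

(** The reach is a supremum that need not be attained, hence the strict inequality. *)
Lemma reach_unique (R : realType) (D : nat) (A : set 'rV[R]_D) (tau : R) x :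
  reach A = tau%:E -> edist x A < tau -> exists! p, nearest A x p.
Proof.
rewrite /reach => At; rewrite -lte_fin -At.
by move=> /ereal_sup_gt[_ [t [_ tU] <-]]; rewrite lte_fin => /ltW; exact: tU.
Qed.

(** * Tangent spaces of sets of positive reach *)

(** Two first-order conditions saying that [T] is the tangent cone of [A] at [p]: nearby points of
    [A] deviate from [p + T] by a small fraction of their distance to [p], and every vector of [T]
    is a one-sided tangent direction. *)
Definition tangent_approx (R : realType) (D : nat) (A : set 'rV[R]_D)
    (p : 'rV[R]_D) (T : {vspace 'rV[R]_D}) : Prop :=
  (forall eps, 0 < eps -> exists2 dl, 0 < dl &
     forall m, A m -> enorm (m - p) < dl ->
     exists2 t, t \in T & enorm (m - p - t) <= eps * enorm (m - p)) /\
  (forall t eps, t \in T -> 0 < eps -> exists2 dl, 0 < dl &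
     forall s, 0 < s -> s < dl ->
     exists2 m, A m & enorm (p + s *: t - m) <= eps * s).

(* Continuous induction at the largest [c <= s] with
   [phi c <= c * (3 / tau * c + eps)]. *)
Lemma quadratic_growth (R : realType) (phi : R -> R) (tau s : R) :
  0 < tau -> (forall u v, phi v <= phi u + `|v - u|) ->
  (forall u, 0 <= u -> phi u <= u) -> (forall u, 0 <= phi u) ->
  (forall eps, 0 < eps -> exists2 dl, 0 < dl &
     forall u, 0 < u -> u < dl -> phi u <= eps * u) ->
  (forall c, 0 < c -> c < tau -> exists2 q,
     2 * tau * (c * q) <= 2 * tau * phi c ^+ 2 + 4 * phi c * c ^+ 2 &
     forall h, phi (c + h) ^+ 2 <= phi c ^+ 2 + 2 * h * q + h ^+ 2) ->
  0 <= s -> s < tau -> tau * phi s <= 3 * s ^+ 2.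
Proof.
move=> tau0 phi_lip phi_le phi_ge0 phi_o slope s0 stau.
rewrite leNgt; apply/negP => hs.
have s_gt0 : 0 < s.
  rewrite lt_def s0 andbT; apply/eqP => sE; move: hs; rewrite sE expr0n/= mulr0.
  by rewrite pmulr_rgt0// ltNge phi_le.
(* Formally, the last hypothesis reads [phi' <= phi / c + 2 * c / tau], whose solution negligible
   against [c] at 0 is [2 * c ^+ 2 / tau]. The constant 3 leaves the slack used at the end. *)
have [k [tk k0]] : exists k, tau * k = 3 /\ 0 < k.
  by exists (3 / tau); rewrite divr_gt0// mulrC divfK// gt_eqF.
have [eps eps0 sE] : exists2 eps, 0 < eps & s * (k * s + eps) < phi s.
  have hs' : 0 < phi s / s - k * s.
    rewrite subr_gt0 ltr_pdivlMr// -(ltr_pM2l tau0).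
    by move: hs; rewrite -tk; clear; lra.
  exists ((phi s / s - k * s) / 2); first by rewrite divr_gt0.
  rewrite mulrC -ltr_pdivlMr//; clear -hs'; lra.
clear hs.
pose S := [set u | [/\ 0 <= u, u <= s & phi u <= u * (k * u + eps)]].
have S0 : S 0 by split=> //; rewrite mul0r phi_le.
have supS : has_sup S by split; [exists 0|exists s => u []].
have [c [cub cs cad]] : exists c, [/\ forall u, S u -> u <= c, c <= s &
    forall e, 0 < e -> exists2 u, S u & c - e < u].
  exists (sup S); split; first by apply: sup_ubound; exact: supS.2.
    by apply: sup_le_ub => [|u []//]; exists 0.
  by move=> e e0; exact: sup_adherent.
have c_ge0 : 0 <= c by exact: cub.
have phic : phi c <= c * (k * c + eps).
  apply/ler_addgt0Pr => e e0; have [u Su cu] := cad e e0; have [u0 us pu] := Su.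
  have uc : u <= c by exact: cub.
  apply: le_trans (phi_lip u c) _; rewrite ger0_norm ?subr_ge0//.
  apply: lerD; last by clear -cu; lra.
  have ku : k * u <= k * c by rewrite ler_pM2l.
  apply: le_trans pu _; apply: ler_pM => //; last by rewrite lerD2r.
  by rewrite addr_ge0 ?(ltW eps0)// mulr_ge0// ltW.
have c0 : 0 < c.
  have [dl dl0 hdl] := phi_o eps eps0.
  have [u [u0 us udl]] : exists u, [/\ 0 < u, u <= s & u < dl].
    exists (Num.min (dl / 2) s); split.
    - by rewrite lt_min divr_gt0.
    - by rewrite ge_min lexx orbT.
    - by rewrite gt_min ltr_pdivrMr// ltr_pMr// ltr1n.
  suff Su : S u by exact: lt_le_trans u0 (cub _ Su).
  split; [exact: ltW | exact: us |].
  apply: le_trans (hdl u u0 udl) _; rewrite mulrC ler_pM2l// lerDr.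
  by rewrite mulr_ge0// ltW.
have cs' : c < s.
  by rewrite lt_neqAle cs andbT; apply: contraTneq sE => <-; rewrite -leNgt.
(* Beyond the largest [c] the bound fails, so [phi] lies above the convex curve, and in particular
   above its tangent line at [c]. *)
have above h : 0 < h -> h <= s - c -> c * (k * c + eps) + h * (2 * k * c + eps) < phi (c + h).
  move=> h0 hsc.
  apply: le_lt_trans (_ : (c + h) * (k * (c + h) + eps) < _).
    have : 0 <= k * h ^+ 2 by rewrite mulr_ge0 ?sqr_ge0// ltW.
    by clear; lra.
  rewrite ltNge; apply/negP => hh.
  have : c + h <= c.
    by apply: cub; split => //; [rewrite addr_ge0// ltW | rewrite -lerBrDl].
  by rewrite gerDl leNgt h0.
have [g gE] : exists g, g = c * (k * c + eps) by exists (c * (k * c + eps)).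
have g0 : 0 < g by rewrite gE mulr_gt0// addr_gt0// mulr_gt0.
have kc0 : 0 < 2 * k * c + eps by rewrite addr_gt0// !mulr_gt0.
have phig : phi c = g.
  apply/eqP; rewrite eq_le {1}gE phic/=; apply/ler_addgt0Pr => e e0.
  pose h := Num.min e (s - c).
  have h0 : 0 < h by rewrite lt_min e0 subr_gt0.
  have he : h <= e by rewrite ge_min lexx.
  have hsc : h <= s - c by rewrite ge_min lexx orbT.
  have := above h h0 hsc; rewrite -gE.
  have := phi_lip c (c + h); rewrite addrAC subrr add0r ger0_norm ?(ltW h0)//.
  have : 0 <= h * (2 * k * c + eps) by rewrite mulr_ge0// ltW.
  by clear -he; clearbody h; lra.
have [q hq sq] := slope c c0 (lt_trans cs' stau); rewrite phig in hq sq.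
have gkc : 0 < g * k * c by rewrite !mulr_gt0.
(* Growth above the tangent line and the bound on [q] are incompatible by a margin of
   [2 * g * k * c / 3], which must exceed the second-order term [h]. *)
have [h [h0 hsc hg]] : exists h, [/\ 0 < h, h <= s - c & h <= g * k * c / 2].
  exists (Num.min (s - c) (g * k * c / 2)).
  by rewrite lt_min subr_gt0 cs' divr_gt0// !ge_min !lexx orbT.
have a1 := above h h0 hsc; rewrite -gE in a1.
have b0 : 0 < g + h * (2 * k * c + eps) by rewrite addr_gt0// mulr_gt0.
have a2 : 0 <= (h * (2 * k * c + eps)) ^+ 2 by exact: sqr_ge0.
have a3 : (g + h * (2 * k * c + eps)) ^+ 2 < g ^+ 2 + 2 * h * q + h ^+ 2.
  apply: lt_le_trans (sq h).
  by rewrite ltr_sqr ?nnegrE ?(ltW b0) ?(ltW (lt_trans b0 a1)).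
have a4 : 2 * g * (2 * k * c + eps) < 2 * q + h.
  by rewrite -(ltr_pM2l h0); clear -a2 a3; lra.
have a5 : q <= g * (k * c + eps) + 2 * g * k * c / 3.
  rewrite -(ler_pM2l c0) -(ler_pM2l (mulr_gt0 (ltr0Sn R 1) tau0)).
  apply: le_trans hq _.
  have e1 : g ^+ 2 = c * (g * (k * c + eps)) by rewrite {1}expr2 {1}gE; ring.
  have e2 : 4 * g * c ^+ 2 = 2 * (tau * k) * (2 * g * c ^+ 2 / 3) by rewrite tk; field.
  by rewrite e2 e1; clear; lra.
by clear -a4 a5 hg gkc; lra.
Qed.

Section tangent.
Context {R : realType} {D : nat} (A : set 'rV[R]_D) (tau : R).
Hypotheses (A0 : A !=set0) (cA : compact A) (tau0 : 0 < tau).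
Hypothesis unique_nearest : forall x, edist x A < tau -> exists! p, nearest A x p.

(** First variation: if [dotv (x - p) t] were positive, a point of [A] close to [p + s *: t] would
    be nearer to [x] than [p]. The argument applies to [t] and to [- t]. *)
Lemma nearest_orthogonal x p (T : {vspace 'rV[R]_D}) t :
  nearest A x p -> tangent_approx A p T -> t \in T -> dotv (x - p) t = 0.
Proof.
move=> xp [_ Tp].
have h u : u \in T -> dotv (x - p) u <= 0.
  move=> uT; rewrite leNgt; apply/negP => c0.
  set y := x - p in c0; set c := dotv y u in c0.
  pose eps := c / (2 * (enorm y + 1)).
  have y0 := enorm_ge0 y; have u0 := enorm_ge0 u.
  have eps0 : 0 < eps by rewrite divr_gt0// mulr_gt0//; lra.
  have [dl dl0 hdl] := Tp u eps uT eps0.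
  pose b := (enorm u + eps) ^+ 2.
  have b0 : 0 < b by rewrite exprn_gt0// ltr_wpDl.
  pose s := Num.min (dl / 2) (c / (2 * b)).
  have s0 : 0 < s by rewrite lt_min !divr_gt0// mulr_gt0.
  have sdl : s < dl by apply: le_lt_trans (_ : dl / 2 < dl); [rewrite ge_min lexx|lra].
  have sb : s * (2 * b) <= c.
    have : s <= c / (2 * b) by rewrite ge_min lexx orbT.
    by rewrite ler_pdivlMr// mulr_gt0.
  have [m Am] := hdl s s0 sdl; set e := p + s *: u - m => he.
  have xm : x - m = y - (s *: u - e).
    by apply/rowP => i; rewrite !mxE; ring.
  have := xp.2 m Am; rewrite -/y enorm_ge ?enorm_ge0// xm dotv_sub -!sqr_enorm.
  rewrite dotvDr dotvNr dotvZr -/c => h1.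
  have h2 : dotv y e <= enorm y * (eps * s).
    by apply: le_trans (dotv_le _ _) _; rewrite ler_wpM2l.
  have h3 : enorm (s *: u - e) ^+ 2 <= s ^+ 2 * b.
    have h5 : enorm (s *: u - e) <= s * (enorm u + eps).
      by apply: le_trans (enormB _ _) _; rewrite enormZ_ge0 ?(ltW s0)//; lra.
    by rewrite -exprMn ler_sqr// nnegrE ?enorm_ge0// (le_trans _ h5)// enorm_ge0.
  have h4 : 2 * (enorm y * eps) <= c.
    rewrite /eps mulrCA mulrA mulrA -ler_pdivlMr ?invr_gt0 ?mulr_gt0//; last lra.
    by rewrite invrK; nra.
  have : s * (2 * c) <= s * (c + c / 2) by nra.
  by rewrite ler_pM2l//; lra.
move=> tT; apply/eqP; rewrite eq_le h//=.
by have := h (- t); rewrite dotvNr oppr_le0; apply; rewrite memvN.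
Qed.

(** [normal_ineq] needs a point whose nearest point is known, and [p] is not known to be nearest to
    [p + l *: n]. The true nearest point [m] is within [2 * eps * l] of [p], so the inequality at
    [m], divided by [l], tends to the desired one. *)
Lemma normal_unit_ineq p (T : {vspace 'rV[R]_D}) n b : A p -> A b ->
  tangent_approx A p T -> (forall t, t \in T -> dotv n t = 0) -> enorm n = 1 ->
  2 * tau * dotv n (b - p) <= enorm (b - p) ^+ 2.
Proof.
move=> Ap Ab [Tp _] nT n1.
set B := enorm (b - p).
have B0 : 0 <= B := enorm_ge0 _.
have key eps : 0 < eps -> eps < 1 / 4 ->
    2 * tau * dotv n (b - p) <= (B + 2 * eps) ^+ 2 + 2 * tau * (2 * eps + 2 * eps * (B + 2 * eps)).
  move=> eps0 eps1.
  have [dl dl0 hdl] := Tp eps eps0.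
  (* [m] is within [2 * l] of [p], hence where [T] approximates [A] if [l <= dl / 4]; [l <= tau / 2]
     keeps the point within the reach. *)
  pose l := Num.min 1 (Num.min (dl / 4) (tau / 2)).
  have l0 : 0 < l by rewrite !lt_min ltr01 !divr_gt0.
  have l1 : l <= 1 by rewrite ge_min lexx.
  have ldl : l <= dl / 4 by rewrite !ge_min lexx !orbT.
  have ltau : l <= tau / 2 by rewrite !ge_min lexx !orbT.
  have [m xm] := nearest_exists (p + l *: n) A0 cA.
  have Am : A m := xm.1.
  have xml : enorm (p + l *: n - m) <= l.
    apply: le_trans (xm.2 _ Ap) _.
    by rewrite addrAC subrr add0r enormZ_ge0 ?(ltW l0)// n1 mulr1.
  have mp : enorm (m - p) <= 2 * l.
    have := enorm_dist m (p + l *: n) p; rewrite (enorm_distC m (p + l *: n)) => h.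
    apply: le_trans h _; have : enorm (p + l *: n - p) = l.
      by rewrite addrAC subrr add0r enormZ_ge0 ?(ltW l0)// n1 mulr1.
    lra.
  have [|t tT mt] := hdl m Am; first lra.
  have nm : dotv n (m - p) <= eps * enorm (m - p).
    have -> : dotv n (m - p) = dotv n (m - p - t).
      by rewrite [RHS]dotvDr dotvNr (nT t)// subr0.
    by apply: le_trans (dotv_le _ _) _; rewrite n1 mul1r.
  (* [m - p] is nearly in [T] and so nearly orthogonal to [n]; being no farther from [p + l *: n]
     than [p] then forces it to be short. *)
  have mp2 : enorm (m - p) <= 2 * eps * l.
    have := xml; rewrite enorm_le ?(ltW l0)//.
    have -> : p + l *: n - m = - (m - p) + l *: n by apply/rowP => i; rewrite !mxE; ring.
    rewrite dotv_addZ !(dotvNl (m - p)) dotvNr opprK (dotvC (m - p)) -!sqr_enorm n1 => h1.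
    have h2 : l * dotv n (m - p) <= l * (eps * enorm (m - p)) by rewrite ler_pM2l.
    have [->|mp0] := eqVneq (enorm (m - p)) 0; first by rewrite !mulr_ge0// ltW.
    have mp1 : 0 < enorm (m - p) by rewrite lt_def mp0 enorm_ge0.
    rewrite -(ler_pM2l mp1); lra.
  have xtau : enorm (p + l *: n - m) < tau by lra.
  have := normal_ineq A0 cA unique_nearest xm xtau Ab.
  have -> : p + l *: n - m = l *: n - (m - p) by apply/rowP => i; rewrite !mxE; ring.
  rewrite dotvDl dotvZl dotvNl.
  have bm : enorm (b - m) <= B + 2 * eps.
    have := enorm_dist b p m; rewrite -/B (enorm_distC p m).
    have : 2 * eps * l <= 2 * eps * 1 by rewrite ler_wpM2l//; lra.
    lra.
  have -> : dotv n (b - m) = dotv n (b - p) - dotv n (m - p).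
    by rewrite -dotvNr -dotvDr; congr dotv; apply/rowP => i; rewrite !mxE; ring.
  have xmE : enorm (l *: n - (m - p)) <= l.
    by apply: le_trans xml; rewrite le_eqVlt; apply/orP; left; apply/eqP;
       congr enorm; apply/rowP => i; rewrite !mxE; ring.
  have s1 : enorm (l *: n - (m - p)) * enorm (b - m) ^+ 2 <= l * (B + 2 * eps) ^+ 2.
    rewrite ler_pM ?enorm_ge0 ?sqr_ge0// ler_sqr ?nnegrE ?enorm_ge0//; lra.
  have s2 : dotv (m - p) (b - m) <= (2 * eps * l) * (B + 2 * eps).
    by apply: le_trans (dotv_le _ _) _; rewrite ler_pM ?enorm_ge0.
  have s3 : dotv n (m - p) <= 2 * eps.
    apply: le_trans nm _; have : eps * enorm (m - p) <= 1 * (2 * eps * l).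
      by rewrite ler_pM ?enorm_ge0//; lra.
    have : eps * l <= eps * 1 by rewrite ler_wpM2l// ltW.
    lra.
  move=> s4.
  have t1 : 2 * tau * dotv (m - p) (b - m) <= 2 * tau * (2 * eps * l * (B + 2 * eps)).
    by rewrite ler_wpM2l//; lra.
  have t2 : 2 * tau * l * dotv n (m - p) <= 2 * tau * l * (2 * eps).
    by rewrite ler_wpM2l// !mulr_ge0//; lra.
  rewrite -(ler_pM2l l0); lra.
apply/ler_addgt0Pr => e e0.
(* Bounds the coefficient of [eps] in the error of [key] for [eps <= 1]. *)
pose K := 4 * B + 4 + 2 * tau * (6 + 2 * B).
have K0 : 0 < K.
  rewrite ltr_wpDr// ?ltr_wpDl ?mulr_ge0//; first by rewrite ltW.
  by rewrite addr_ge0 ?mulr_ge0.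
pose eps := Num.min (1 / 8) (e / K).
have eps0 : 0 < eps by rewrite lt_min !divr_gt0.
have eps1 : eps <= 1 / 8 by rewrite ge_min lexx.
have epsK : eps * K <= e.
  have : eps <= e / K by rewrite ge_min lexx orbT.
  by rewrite ler_pdivlMr.
apply: le_trans (key _ eps0 _) _; first lra.
have h1 : eps * eps <= eps * 1 by rewrite ler_pM2l//; lra.
have h2 : tau * (eps * eps) <= tau * eps by rewrite ler_pM2l//; lra.
apply: le_trans (_ : _ <= B ^+ 2 + eps * K) _; last lra.
rewrite /K; lra.
Qed.

Lemma normal_space_ineq p (T : {vspace 'rV[R]_D}) n b : A p -> A b ->
  tangent_approx A p T -> (forall t, t \in T -> dotv n t = 0) ->
  2 * tau * dotv n (b - p) <= enorm n * enorm (b - p) ^+ 2.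
Proof.
move=> Ap Ab Tp nT; have [->|n0] := eqVneq n 0.
  by rewrite dotv0l enorm0 mulr0 mul0r.
have nn : 0 < enorm n by rewrite enorm_gt0.
have := @normal_unit_ineq p T ((enorm n)^-1 *: n) b Ap Ab Tp.
rewrite dotvZl enormZ_ge0 ?invr_ge0 ?enorm_ge0// mulVf ?gt_eqF// => h.
have : 2 * tau * ((enorm n)^-1 * dotv n (b - p)) <= enorm (b - p) ^+ 2.
  by apply: h => // t tT; rewrite dotvZl nT// mulr0.
by rewrite mulrCA ler_pdivrMl.
Qed.

(* Federer, Curvature measures, Theorem 4.18. *)
Lemma tangent_dist p (T : {vspace 'rV[R]_D}) b : A p -> A b ->
  tangent_approx A p T ->
  exists2 t, t \in T & 2 * tau * enorm (b - p - t) <= enorm (b - p) ^+ 2.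
Proof.
move=> Ap Ab Tp; have [t tT tn] := orthogonal_projection T (b - p).
exists t => //; set n := b - p - t in tn *.
have [n0|n0] := eqVneq (enorm n) 0; first by rewrite n0 mulr0 sqr_ge0.
have nn : 0 < enorm n by rewrite lt_def n0 enorm_ge0.
have := normal_space_ineq Ap Ab Tp tn.
have -> : dotv n (b - p) = enorm n ^+ 2.
  have -> : b - p = n + t by rewrite subrK.
  by rewrite sqr_enorm dotvDr (tn t)// addr0.
by rewrite expr2 mulrA mulrAC [leLHS]mulrC ler_pM2l.
Qed.

Section ray.
Hypothesis tangentA : forall p, A p -> exists T, tangent_approx A p T.
Variables (p : 'rV[R]_D) (T : {vspace 'rV[R]_D}) (t : 'rV[R]_D).
Hypotheses (Ap : A p) (Tp : tangent_approx A p T) (tT : t \in T).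
Hypothesis t1 : enorm t = 1.

Let phi s := edist (p + s *: t) A.

Let phi_lip s s' : phi s' <= phi s + `|s' - s|.
Proof.
apply: le_trans (edist_lipschitz (p + s *: t) _ A0) _.
by rewrite lerD2l opprD addrACA subrr add0r -scalerBl enormZ t1 mulr1.
Qed.

Let phi_le s : 0 <= s -> phi s <= s.
Proof.
move=> s0; apply: le_trans (edist_le _ Ap) _.
by rewrite addrAC subrr add0r enormZ_ge0// t1 mulr1.
Qed.

(* [x - m] and its opposite are both normal at [m]; the latter bounds from above
   the rate of growth of the distance along the ray. *)
Let ray_slope s m : 0 < s -> s < tau -> nearest A (p + s *: t) m ->
  2 * tau * (s * dotv (p + s *: t - m) t) <=
  2 * tau * phi s ^+ 2 + 4 * phi s * s ^+ 2.
Proof.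
move=> s0 stau xm; have f0 : 0 <= phi s := edist_ge0 _ A0.
have fs := phi_le (ltW s0).
set x := p + s *: t in xm *.
have [S Sm] := tangentA xm.1.
have := @normal_space_ineq m S (- (x - m)) p xm.1 Ap Sm.
rewrite enormN -(nearest_edist xm) -/(phi s) dotvNl => h.
have {h} h : 2 * tau * - dotv (x - m) (p - m) <= phi s * enorm (p - m) ^+ 2.
  by apply: h => u uS; rewrite dotvNl (nearest_orthogonal xm Sm)// oppr0.
have -> : s * dotv (x - m) t = dotv (x - m) (x - m) - dotv (x - m) (p - m).
  rewrite -dotvNr -dotvDr -dotvZr; congr dotv.
  by apply/rowP => i; rewrite !mxE; ring.
have -> : dotv (x - m) (x - m) = phi s ^+ 2.
  by rewrite -sqr_enorm -(nearest_edist xm).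
have pm : enorm (p - m) <= 2 * s.
  apply: le_trans (enorm_dist _ x _) _.
  rewrite -(nearest_edist xm) -/(phi s) opprD addrA subrr sub0r enormN.
  by rewrite enormZ_ge0 ?(ltW s0)// t1; lra.
have : phi s * enorm (p - m) ^+ 2 <= phi s * (2 * s) ^+ 2.
  by rewrite ler_wpM2l// ler_sqr ?nnegrE ?enorm_ge0//; lra.
lra.
Qed.

(** The converse of [tangent_dist]: the tangent plane stays quadratically close to [A]. Tangency
    only says that the distance is negligible against [s] near 0; [quadratic_growth] integrates the
    slope bound from there. *)
Lemma ray_dist s : 0 <= s -> s < tau -> tau * phi s <= 3 * s ^+ 2.
Proof.
apply: quadratic_growth => //; first by move=> u; exact: edist_ge0.
- move=> eps eps0; have [dl dl0 hdl] := Tp.2 t eps tT eps0.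
  exists dl => // u u0 /(hdl u u0)[m Am hm].
  by apply: le_trans hm; exact: edist_le.
- move=> c c0 ctau; have [m xm] := nearest_exists (p + c *: t) A0 cA.
  exists (dotv (p + c *: t - m) t); first exact: ray_slope.
  move=> h; apply: le_trans (_ : enorm (p + (c + h) *: t - m) ^+ 2 <= _).
    by rewrite ler_sqr ?nnegrE ?enorm_ge0 ?edist_ge0//; apply: edist_le; exact: xm.1.
  have -> : p + (c + h) *: t - m = (p + c *: t - m) + h *: t.
    by apply/rowP => i; rewrite !mxE; ring.
  rewrite sqr_enorm dotv_addZ -!sqr_enorm t1 -(nearest_edist xm) -/(phi c).
  by rewrite expr1n mulr1.
Qed.

End ray.

(** Let [m] in [A] be nearest to [p + s *: t]. This point is [3 * s ^+ 2 / tau] from [m], while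
    [m - q] and [p - q], of lengths at most [5 * s] and [s], are within [25 / 2] and [1 / 2] times
    [s ^+ 2 / tau] of [S]. Subtracting and dividing by [s] gives [3 + 25 / 2 + 1 / 2 = 16]. *)
Lemma tangent_compare p q (T S : {vspace 'rV[R]_D}) t s :
  (forall p, A p -> exists T, tangent_approx A p T) ->
  A p -> A q -> tangent_approx A p T -> tangent_approx A q S ->
  t \in T -> enorm t = 1 -> 0 < s -> s < tau -> enorm (p - q) <= s ->
  exists2 u, u \in S & tau * enorm (t - u) <= 16 * s.
Proof.
move=> TA Ap Aq Tp Sq tT t1 s0 stau pq.
have := ray_dist TA Ap Tp tT t1 (ltW s0) stau.
have [m xm] := nearest_exists (p + s *: t) A0 cA.
rewrite (nearest_edist xm) => h1.
have [u1 u1S hu1] := tangent_dist Aq xm.1 Sq.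
have [u2 u2S hu2] := tangent_dist Aq Ap Sq.
have xs : enorm (p + s *: t - m) <= 3 * s.
  rewrite -(ler_pM2l tau0); apply: le_trans h1 _.
  have : s * s <= tau * s by rewrite ler_pM2r// ltW.
  lra.
have mq : enorm (m - q) <= 5 * s.
  apply: le_trans (enorm_dist _ (p + s *: t) _) _; rewrite enorm_distC.
  have : enorm (p + s *: t - q) <= 2 * s.
    rewrite addrAC; apply: le_trans (enormD _ _) _.
    by rewrite enormZ_ge0 ?(ltW s0)// t1; lra.
  lra.
exists (s^-1 *: (u1 - u2)); first by rewrite memvZ// memvB.
have -> : t - s^-1 *: (u1 - u2) = s^-1 *: ((p + s *: t - m) + (m - q - u1) - (p - q - u2)).
  by apply/rowP => i; rewrite !mxE; field; rewrite gt_eqF.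
rewrite enormZ_ge0 ?invr_ge0 ?(ltW s0)// mulrCA ler_pdivrMl//.
have := enormB (p + s *: t - m + (m - q - u1)) (p - q - u2).
have := enormD (p + s *: t - m) (m - q - u1).
have hm : enorm (m - q) ^+ 2 <= (5 * s) ^+ 2.
  by rewrite ler_sqr ?nnegrE ?enorm_ge0//; lra.
have hp : enorm (p - q) ^+ 2 <= s ^+ 2.
  by rewrite ler_sqr ?nnegrE ?enorm_ge0//; lra.
set e1 := enorm (p + s *: t - m) in h1 *; set e2 := enorm (m - q - u1) in hu1 *.
set e3 := enorm (p - q - u2) in hu2 *; move=> k1 k2.
have : tau * enorm (p + s *: t - m + (m - q - u1) - (p - q - u2)) <= tau * (e1 + e2 + e3).
  by rewrite ler_pM2l//; lra.
lra.
Qed.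

End tangent.

(** * Charts and tangent spaces *)

Section line_derivative.
Context {R : realType} {D : nat}.
Implicit Types (z v : 'rV[R]_D).

Lemma line_difference_quotient (W : normedModType R) (F : 'rV[R]_D -> W) z v (t : R^o) :
  (fun h : R^o => h^-1 *: (((fun s : R^o => F (z + s *: v)) \o shift t) (h *: 1) -
     F (z + t *: v))) =
  (fun h : R^o => h^-1 *: ((F \o shift (z + t *: v)) (h *: v) - F (z + t *: v))).
Proof.
apply/funext => h /=; congr (_ *: (F _ - _)).
by rewrite -[h%:A]/(h * 1) mulr1 scalerDl addrCA.
Qed.

Lemma derivable_line (W : normedModType R) (F : 'rV[R]_D -> W) z v (t : R^o) :
  derivable F (z + t *: v) v ->
  derivable (fun s : R^o => F (z + s *: v)) t 1.
Proof. by rewrite /derivable line_difference_quotient. Qed.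

Lemma derive_line (W : normedModType R) (F : 'rV[R]_D -> W) z v (t : R^o) :
  'D_1 (fun s : R^o => F (z + s *: v)) t = 'D_v F (z + t *: v).
Proof. by rewrite /derive line_difference_quotient. Qed.

Lemma line_mean_value (F : 'rV[R]_D -> R) z v (s l e : R) :
  (forall t, `|t| <= `|s| -> derivable F (z + t *: v) v /\
     `|'D_v F (z + t *: v) - l| <= e) ->
  `|F (z + s *: v) - F z - s * l| <= e * `|s|.
Proof.
move=> h; pose g (t : R) : R := F (z + t *: v).
have mvt (a b : R) : a <= b -> `|a| <= `|s| -> `|b| <= `|s| ->
    `|g b - g a - (b - a) * l| <= e * (b - a).
  move=> ab sa sb.
  have hab c : c \in `[a, b]%R -> `|c| <= `|s|.
    rewrite in_itv/= => /andP[ac cb]; move: sa sb; rewrite !ler_norml.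
    by move=> /andP[? ?] /andP[? ?]; apply/andP; split; lra.
  have [||c cab gE] := @MVT_segment R g (fun t => 'D_v F (z + t *: v)) a b ab.
  - move=> c cab.
    have /hab/h[dc _] : c \in `[a, b]%R.
      by move: cab; rewrite !in_itv/= => /andP[/ltW-> /ltW->].
    by apply: DeriveDef; [exact: derivable_line|exact: derive_line].
  - apply: derivable_within_continuous => c /hab/h[dc _].
    exact: derivable_line.
  - rewrite gE (mulrC (b - a)) -mulrBl normrM (ger0_norm (_ : 0 <= b - a)) ?subr_ge0//.
    by rewrite ler_wpM2r ?subr_ge0//; have /hab/h[] := cab.
have gs : g s = F (z + s *: v) by [].
have g0 : g 0 = F z by rewrite /g scale0r addr0.
have [s0|s0] := leP 0 s.
  have := mvt 0 s s0; rewrite normr0 lexx normr_ge0 gs g0 subr0 (ger0_norm s0).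
  exact.
have := mvt s 0 (ltW s0); rewrite normr0 lexx normr_ge0 gs g0 sub0r (ltr0_norm s0).
by rewrite -normrN => /(_ isT isT); rewrite mulNr !opprD !opprK [- _ + _]addrC.
Qed.

End line_derivative.

(** * From continuous directional derivatives to a linear approximation *)

Section frechet.
Context {R : realType} {D E : nat} (f : 'rV[R]_D -> 'rV[R]_E).
Variables (U : set 'rV[R]_D) (x : 'rV[R]_D).
Hypotheses (oU : open U) (Ux : U x).
Hypothesis df : forall v y, U y -> derivable f y v.
Hypothesis cdf : forall v y, U y -> {for y, continuous (fun y => 'D_v f y)}.

Definition jacobian_mx : 'M[R]_(D, E) :=
  \matrix_(i < D, j < E) 'D_(delta_mx 0 i) f x 0 j.

Let head_sum (h : 'rV[R]_D) k :=
  \sum_(i < D | (i < k)%N) h 0 i *: (delta_mx 0 i : 'rV[R]_D).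

Let head_sumS h (i : 'I_D) : head_sum h i.+1 = head_sum h i + h 0 i *: delta_mx 0 i.
Proof.
rewrite /head_sum (bigD1 i)//= addrC; congr (_ + _).
by apply: eq_bigl => j; rewrite ltnS ltn_neqAle andbC.
Qed.

Let enorm_head_sum h k : enorm (head_sum h k) <= D%:R * enorm h.
Proof.
apply: le_trans (enorm_sum _ _ _) _.
apply: le_trans (_ : \sum_(i < D) enorm h <= _); last first.
  by rewrite sumr_const card_ord mulr_natl.
rewrite big_mkcond; apply: ler_sum => i _; case: ifP => _; last exact: enorm_ge0.
by rewrite enormZ enorm_delta mulr1 coord_le_enorm.
Qed.

(** The coordinates of [h] are added one at a time; on each segment the mean value theorem, applied
    to every component of [f], compares the increment with the partial derivative at [x]. *)
Lemma frechet eps : 0 < eps -> exists2 dl, 0 < dl & forall h, enorm h < dl ->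
  enorm (f (x + h) - f x - h *m jacobian_mx) <= eps * enorm h.
Proof.
move=> eps0.
pose e := eps / (D.+1%:R * E.+1%:R).
have e0 : 0 < e by rewrite divr_gt0// mulr_gt0.
have [dl dl0 hdl] : exists2 dl, 0 < dl & forall y, enorm (y - x) < dl ->
    U y /\ forall i : 'I_D, enorm ('D_(delta_mx 0 i) f y - 'D_(delta_mx 0 i) f x) < e.
  have : nbhs x (U `&` [set y | forall i : 'I_D,
      enorm ('D_(delta_mx 0 i) f y - 'D_(delta_mx 0 i) f x) < e]).
    apply: (@filterI _ (nbhs x)); first exact: open_nbhs_nbhs.
    apply: (@filter_forall _ _ _ (nbhs x)) => i.
    have := @cdf (delta_mx 0 i) x Ux
      [set u | enorm (u - 'D_(delta_mx 0 i) f x) < e]; apply.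
    by apply/nbhs_enormP; exists e.
  by move=> /nbhs_enormP[dl dl0 h]; exists dl.
(* The partial sums of [h] are bounded by [D%:R * enorm h], so the whole path stays within [dl] of
   [x]. *)
exists (dl / D.+1%:R); first by rewrite divr_gt0.
move=> h; rewrite ltr_pdivlMr// => hs.
have step k : (k <= D)%N ->
    enorm (f (x + head_sum h k) - f x - head_sum h k *m jacobian_mx)
    <= k%:R * (E%:R * (e * enorm h)).
  elim: k => [_|k IH kD].
    by rewrite /head_sum big_pred0// mul0mx addr0 subrr subr0 enorm0 mul0r.
  pose i := Ordinal kD; have := head_sumS h i; rewrite [val i]/= => ->.
  set z := x + head_sum h k.
  have -> : f (x + (head_sum h k + h 0 i *: delta_mx 0 i)) - f x -
     (head_sum h k + h 0 i *: delta_mx 0 i) *m jacobian_mx =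
     (f z - f x - head_sum h k *m jacobian_mx) +
     (f (z + h 0 i *: delta_mx 0 i) - f z - h 0 i *: (delta_mx 0 i *m jacobian_mx)).
    rewrite addrA -/z mulmxDl -scalemxAl.
    by apply/rowP => j; rewrite !mxE; ring.
  apply: le_trans (enormD _ _) _; rewrite -natr1 mulrDl mul1r.
  apply: lerD; first exact/IH/ltnW.
  apply: enorm_le_coord => j.
  have -> : (f (z + h 0 i *: delta_mx 0 i) - f z -
      h 0 i *: (delta_mx 0 i *m jacobian_mx)) 0 j =
      f (z + h 0 i *: delta_mx 0 i) 0 j - f z 0 j - h 0 i * 'D_(delta_mx 0 i) f x 0 j.
    by rewrite -rowE !mxE.
  apply: le_trans (_ : e * `|h 0 i| <= _); last first.
    by rewrite ler_wpM2l ?(ltW e0)// coord_le_enorm.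
  apply: (line_mean_value (F := fun y => f y 0 j)) => t th.
  have /hdl[Uy Dy] : enorm (z + t *: delta_mx 0 i - x) < dl.
    apply: le_lt_trans hs; rewrite /z addrAC [x + _]addrC addrK.
    apply: le_trans (enormD _ _) _; rewrite enormZ enorm_delta mulr1.
    have := enorm_head_sum h k; have := coord_le_enorm h i.
    by rewrite -natr1; lra.
  have dfy := @df (delta_mx 0 i) _ Uy.
  split; first exact: ((derivable_mxP _ _ _).1 dfy 0 j).
  apply: le_trans (ltW (Dy i)).
  apply: le_trans (coord_le_enorm _ j); rewrite !mxE [in leRHS]derive_mx//.
  by rewrite !mxE.
have := step D (leqnn D).
have -> : head_sum h D = h.
  rewrite [RHS]row_sum_delta; apply: eq_bigl => i; exact: ltn_ord.
move/le_trans; apply.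
rewrite !mulrA ler_wpM2r ?enorm_ge0// ler_pdivrMr ?mulr_gt0//.
rewrite mulrC ler_wpM2l ?(ltW eps0)//.
by rewrite ler_pM// ler_nat.
Qed.

Lemma derive_jacobian v : 'D_v f x = v *m jacobian_mx.
Proof.
apply/cvg_lim => //; apply/cvgrPdist_le => e e0.
have v1 : 0 < enorm v + 1 by rewrite ltr_wpDl ?enorm_ge0.
have [dl dl0 hdl] := frechet (divr_gt0 e0 v1).
near=> h.
have h0 : h != 0 by near: h; exact: nbhs_dnbhs_neq.
have hdl' : `|h| < dl / (enorm v + 1).
  by near: h; apply: dnbhs0_lt; rewrite divr_gt0.
have hv : enorm (h *: v) < dl.
  move: hdl'; rewrite ltr_pdivlMr// enormZ; apply: le_lt_trans.
  by rewrite ler_wpM2l// lerDl.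
have := hdl _ hv; rewrite distrC /= (addrC _ x) => H.
apply: le_trans (norm_le_enorm _) _.
have -> : h^-1 *: (f (x + h *: v) - f x) - v *m jacobian_mx =
    h^-1 *: (f (x + h *: v) - f x - (h *: v) *m jacobian_mx).
  by rewrite -scalemxAl [in RHS]scalerBr scalerA mulVf// scale1r.
rewrite enormZ normfV ler_pdivrMl ?normr_gt0//.
apply: le_trans H _; rewrite enormZ mulrCA ler_wpM2l//.
rewrite mulrAC ler_pdivrMr// ler_wpM2l ?(ltW e0)//; lra.
Unshelve. all: by end_near. Qed.

Lemma locally_lipschitz : exists c dl, [/\ 0 < c, 0 < dl &
  forall y, enorm (y - x) < dl -> enorm (f y - f x) <= c * enorm (y - x)].
Proof.
have [dl dl0 hdl] := frechet ltr01.
pose c := \sum_(i < D) enorm (row i jacobian_mx).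
have c0 : 0 <= c by apply: sumr_ge0 => i _; exact: enorm_ge0.
exists (c + 1), dl; split => // [|y yx]; first by rewrite ltr_wpDl.
have := hdl _ yx; rewrite (addrC x) subrK mul1r => h.
have := enormD (f y - f x - (y - x) *m jacobian_mx) ((y - x) *m jacobian_mx).
rewrite subrK => /le_trans; apply.
suff : enorm ((y - x) *m jacobian_mx) <= c * enorm (y - x) by lra.
rewrite mulmx_sum_row; apply: le_trans (enorm_sum _ _ _) _.
rewrite /c mulr_suml; apply: ler_sum => i _.
by rewrite enormZ mulrC ler_wpM2l ?enorm_ge0// coord_le_enorm.
Qed.

End frechet.

(** * The tangent plane of a submanifold *)

Section chart.
Context {R : realType} {D : nat}.
Implicit Types (A : set 'rV[R]_D) (T : {vspace 'rV[R]_D}).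

Lemma Ck_derivable E k (U : set 'rV[R]_D) (f : 'rV[R]_D -> 'rV[R]_E) :
  (0 < k)%N -> Ck k U f -> forall v y, U y -> derivable f y v.
Proof. by case: k => // k _ [_ h] v y Uy; have [+ _] := h v; apply. Qed.

Lemma Ck_continuous_derive E k (U : set 'rV[R]_D) (f : 'rV[R]_D -> 'rV[R]_E) :
  (0 < k)%N -> Ck k U f ->
  forall v y, U y -> {for y, continuous (fun y => 'D_v f y)}.
Proof.
case: k => [//|k] _ [_ h] v y Uy; case: (h v) => _.
by case: k {h} => [|k] [hc _]; exact: hc.
Qed.

Lemma is_derive_eps E (gamma : R^o -> 'rV[R]_E) w eps :
  is_derive (0 : R^o) 1 gamma w -> 0 < eps ->
  exists2 dl, 0 < dl & forall s, 0 < s -> s < dl ->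
    enorm (gamma s - gamma 0 - s *: w) <= eps * s.
Proof.
move=> [dg gw] eps0.
have e0 : 0 < eps / E.+1%:R by rewrite divr_gt0.
have : (fun h : R^o => h^-1 *: ((gamma \o shift 0) (h *: 1) - gamma 0)) @ 0^' --> w.
  by rewrite -gw; exact: dg.
move=> /cvgrPdist_le/(_ _ e0)[/= dl dl0 hdl].
exists dl => // s s0 sdl.
have := hdl s; rewrite /ball_/= sub0r normrN gtr0_norm// => /(_ sdl (lt0r_neq0 s0)).
rewrite addr0 -[s%:A]/(s * 1) mulr1 => h.
have -> : gamma s - gamma 0 - s *: w = (- s) *: (w - s^-1 *: (gamma s - gamma 0)).
  by apply/rowP => i; rewrite !mxE; field; rewrite gt_eqF.
rewrite enormZ normrN gtr0_norm// mulrC ler_pM2r//.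
apply: le_trans (enorm_le_norm _) _.
apply: le_trans (_ : E%:R * (eps / E.+1%:R) <= _); first by rewrite ler_wpM2l.
by rewrite mulrA ler_pdivrMr// mulrC ler_pM2l// ler_nat.
Qed.

(** [gamma s - p] differs from [s *: w] and from [T] by terms negligible against [s]; pairing it
    with the component [n] of [w] normal to [T] forces [n = 0]. *)
Lemma tangent_space_sub A p T w :
  (forall eps, 0 < eps -> exists2 dl, 0 < dl &
     forall m, A m -> enorm (m - p) < dl ->
     exists2 t, t \in T & enorm (m - p - t) <= eps * enorm (m - p)) ->
  tangent_space A p w -> w \in T.
Proof.
move=> Tp [gamma [g0 gA gw]].
have [y yT yn] := orthogonal_projection T w.
set n := w - y in yn.
suff n0 : n = 0 by move/eqP: n0; rewrite subr_eq0 => /eqP ->.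
apply/eqP; rewrite -enorm_eq0 eq_le enorm_ge0 andbT.
rewrite leNgt; apply/negP => n0.
have w0 := enorm_ge0 w.
pose eps := Num.min 1 (enorm n / (2 * (3 + enorm w))).
have eps0 : 0 < eps by rewrite lt_min ltr01 divr_gt0// mulr_gt0//; lra.
have eps1 : eps <= 1 by rewrite ge_min lexx.
have epsn : eps * (2 * (3 + enorm w)) <= enorm n.
  have : eps <= enorm n / (2 * (3 + enorm w)) by rewrite ge_min lexx orbT.
  by rewrite ler_pdivlMr//; lra.
have [dl1 dl10 h1] := is_derive_eps gw eps0.
have [dl2 dl20 h2] := Tp eps eps0.
move: gA => /nbhs_ballP[dl3 /= dl30 h3].
have w1 : 0 < enorm w + 1 by lra.
pose s := Num.min (dl1 / 2) (Num.min (dl3 / 2) (dl2 / (2 * (enorm w + 1)))).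
have s0 : 0 < s by rewrite !lt_min !divr_gt0// mulr_gt0.
have s1 : s <= dl1 / 2 by rewrite ge_min lexx.
have s3 : s <= dl3 / 2 by rewrite !ge_min lexx !orbT.
have s2 : s * (2 * (enorm w + 1)) <= dl2.
  have : s <= dl2 / (2 * (enorm w + 1)) by rewrite !ge_min lexx !orbT.
  by rewrite ler_pdivlMr ?mulr_gt0.
clearbody s eps.
have [|As _] := h3 s.
  by rewrite -ball_normE /ball_/= sub0r normrN gtr0_norm//; lra.
have s1' : s < dl1 by lra.
have := h1 s s0 s1'; rewrite g0; set e := gamma s - p - s *: w => he.
have gE : gamma s - p = e + s *: w by rewrite /e subrK.
have es : eps * s <= 1 * s by rewrite ler_pM2r.
have gs : enorm (gamma s - p) <= s * (enorm w + 1).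
  by rewrite gE; apply: le_trans (enormD _ _) _; rewrite enormZ_ge0 ?(ltW s0)//; lra.
have [|t tT ht] := h2 _ As; first lra.
have k1 : dotv n (gamma s - p) <= enorm n * (eps * (s * (enorm w + 1))).
  have -> : dotv n (gamma s - p) = dotv n (gamma s - p - t).
    by rewrite [RHS]dotvDr dotvNr (yn t)// subr0.
  apply: le_trans (dotv_le _ _) _; rewrite ler_pM2l//.
  by apply: le_trans ht _; rewrite ler_pM2l.
have k2 : dotv n (gamma s - p) = dotv n e + s * enorm n ^+ 2.
  rewrite gE dotvDr dotvZr; congr (_ + _ * _).
  by rewrite sqr_enorm -[w in LHS](subrK y) dotvDr (yn y yT) addr0.
have k3 := dotv_ge n e.
have k4 : enorm n * enorm e <= enorm n * (eps * s) by rewrite ler_pM2l.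
have : s * (enorm n * enorm n) <= s * (enorm n * (eps * (enorm w + 2))) by lra.
rewrite ler_pM2l// ler_pM2l//.
have : 0 < eps * (enorm w + 1) by rewrite mulr_gt0.
lra.
Qed.

(** Standard basis vector, indexed by [nat] to suit [orthonormal]; it is zero for [i >= D]. *)
Definition slice_vec (i : nat) : 'rV[R]_D := \row_j (j == i :> nat)%:R.

Lemma slice_orthonormal d : (d <= D)%N -> orthonormal d slice_vec.
Proof.
move=> dD i j id jd; have iD := leq_trans id dD.
rewrite /dotv (bigD1 (Ordinal iD))//= !mxE eqxx mul1r big1 ?addr0// => k.
by rewrite -val_eqE /= => /negPf ki; rewrite !mxE ki mul0r.
Qed.

Lemma slice_space d : (d <= D)%N -> exists S : {vspace 'rV[R]_D},
  \dim S = d /\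
  forall v, v \in S <-> forall i : 'I_D, (d <= i)%N -> v 0 i = 0.
Proof.
move=> dD; pose es := [tuple slice_vec i | i < d].
have vE (v : 'rV[R]_D) : (forall i : 'I_D, (d <= i)%N -> v 0 i = 0) -> v \in <<es>>%VS.
  move=> v0; have -> : v = \sum_(i < d) v 0 (widen_ord dD i) *: slice_vec i.
    apply/rowP => j; rewrite summxE.
    have [jd|dj] := ltnP j d.
      rewrite (bigD1 (Ordinal jd))//= !mxE eqxx mulr1 big1 ?addr0.
        by congr (v 0 _); apply/val_inj.
      move=> i; rewrite -val_eqE /= => /negPf ij.
      by rewrite !mxE eq_sym ij mulr0.
    rewrite v0// big1// => i _; rewrite !mxE.
    by rewrite gtn_eqF ?mulr0// (leq_trans (ltn_ord i)).
  apply: memv_suml => i _; apply: memvZ; apply: memv_span.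
  by apply/mapP; exists i; rewrite ?mem_ord_enum ?mem_enum.
exists <<es>>%VS; split.
  apply/eqP; rewrite eqn_leq; apply/andP; split.
    by apply: leq_trans (dim_span _) _; rewrite size_tuple.
  apply: (orthonormal_dim (slice_orthonormal dD)) => i id.
  apply: vE => j dj; rewrite mxE.
  by rewrite gtn_eqF// (leq_trans id).
move=> v; split=> [/coord_span-> i di|]; last exact: vE.
rewrite summxE big1// => j _; rewrite mxE -tnth_nth tnth_mktuple mxE.
by rewrite gtn_eqF ?mulr0// (leq_trans (ltn_ord j)).
Qed.

(** [T] is the image, under the derivative of the inverse chart [psi] at [phi p], of the slice of
    vectors whose coordinates from [d] on vanish. The lemma links the metric notion of tangent plane
    to velocities of curves. *)
Lemma submanifold_tangent A k d p : (0 < k)%N -> is_submanifold k d A -> A p ->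
  exists T, [/\ \dim T = d, tangent_approx A p T & tangent_space A p = [set` T]].
Proof.
move=> k0 [dD charts] Ap.
have [U [V [phi [psi [Up [[oU oV] phiV psiU Cphi Cpsi] slice]]]]] := charts p Ap.
have [Vy0 psip] := phiV p Up.
set y0 := phi p in Vy0 psip.
have dphi := Ck_derivable k0 Cphi; have dpsi := Ck_derivable k0 Cpsi.
have cphi := Ck_continuous_derive k0 Cphi.
have cpsi := Ck_continuous_derive k0 Cpsi.
have [c [dl1 [c0 dl10 phil]]] := locally_lipschitz oU Up dphi cphi.
have frpsi := frechet oV Vy0 dpsi cpsi.
have dpsiE v := derive_jacobian oV Vy0 dpsi cpsi v.
set M := jacobian_mx psi y0 in frpsi dpsiE.
have [S [dimS Sv]] := slice_space dD.
have y0S (i : 'I_D) : (d <= i)%N -> y0 0 i = 0 by move/(slice p Up).1: Ap => /(_ i).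
pose L : 'End('rV[R]_D) := linfun (mulmxr M).
have LE v : L v = v *m M by rewrite lfunE.
have [dlU dlU0 hU] := (open_enormP U).1 oU p Up.
have [dlV dlV0 hV] := (open_enormP V).1 oV y0 Vy0.
have psiA v s : v \in S -> V (y0 + s *: v) -> A (psi (y0 + s *: v)).
  move=> /Sv v0 /psiU[Upsi phiE]; apply/(slice _ Upsi) => i di.
  by rewrite phiE !mxE (y0S i di) (v0 i di) mulr0 addr0.
(* If [v *m M = 0], then [psi (y0 + s *: v)] is much closer to [p] than [s], whereas [phi],
   Lipschitz at [p], must recover the displacement [s *: v] from it. *)
have injL v : v \in S -> v *m M = 0 -> v = 0.
  move=> vS vM; apply/eqP/negPn/negP => v0.
  have nv : 0 < enorm v by rewrite enorm_gt0.
  have e0 : 0 < Num.min 1 (1 / (2 * c)) by rewrite lt_min ltr01 divr_gt0// mulr_gt0.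
  have [dl dl0 hdl] := frpsi _ e0.
  set e := Num.min _ _ in e0 hdl.
  have e1 : e <= 1 by rewrite ge_min lexx.
  have ec : e * (2 * c) <= 1.
    have : e <= 1 / (2 * c) by rewrite ge_min lexx orbT.
    by rewrite ler_pdivlMr// mulr_gt0.
  have [b [b0 bdl bdlV bdl1]] : exists b, [/\ 0 < b, b < dl, b < dlV & b < dl1].
    pose mn := Num.min dl (Num.min dlV dl1).
    have mn0 : 0 < mn by rewrite !lt_min dl0 dlV0.
    have mn1 : mn <= dl by rewrite ge_min lexx.
    have mn2 : mn <= dlV by rewrite !ge_min lexx !orbT.
    have mn3 : mn <= dl1 by rewrite !ge_min lexx !orbT.
    by exists (mn / 2); clear -mn0 mn1 mn2 mn3; split; lra.
  pose s := b / enorm v.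
  have sv : enorm (s *: v) = b.
    by rewrite enormZ_ge0 ?divfK ?gt_eqF// divr_ge0// ltW.
  have Vs : V (y0 + s *: v) by apply: hV; rewrite addrC addKr sv.
  have [Us phis] := psiU _ Vs.
  have := hdl (s *: v); rewrite sv -scalemxAl vM scaler0 subr0 psip => /(_ bdl) h1.
  have h2 : e * b <= 1 * b by rewrite ler_pM2r.
  have := phil (psi (y0 + s *: v)); rewrite phis -/y0 addrAC subrr add0r sv => h3.
  have h4 : b <= c * enorm (psi (y0 + s *: v) - p) by apply: h3; lra.
  have h5 : c * enorm (psi (y0 + s *: v) - p) <= c * (e * b) by rewrite ler_pM2l.
  have h6 : e * (2 * c) * b <= 1 * b by rewrite ler_pM2r.
  by clear -b0 h4 h5 h6; lra.
have tan1 eps : 0 < eps -> exists2 dl, 0 < dl &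
     forall m, A m -> enorm (m - p) < dl ->
     exists2 t, t \in (L @: S)%VS & enorm (m - p - t) <= eps * enorm (m - p).
  move=> eps0; have [dl dl0 hdl] := frpsi _ (divr_gt0 eps0 c0).
  exists (Num.min dlU (Num.min dl1 (dl / c))).
    by rewrite !lt_min dlU0 dl10 divr_gt0.
  move=> m Am; rewrite !lt_min => /and3P[mU m1]; rewrite ltr_pdivlMr// => mc.
  have Um := hU m mU.
  have lip := phil m m1; rewrite -/y0 in lip.
  have yS : phi m - y0 \in S.
    apply/Sv => i di; rewrite !mxE (y0S i di) subr0.
    exact: (slice m Um).1.
  exists ((phi m - y0) *m M); first by rewrite -LE memv_img.
  have := hdl (phi m - y0); rewrite [y0 + _]addrC subrK (phiV m Um).2 psip => h.
  apply: le_trans (h _) _; first by apply: le_lt_trans lip _; rewrite mulrC.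
  rewrite mulrAC ler_pdivrMr// -mulrA ler_pM2l// mulrC.
  exact: lip.
exists (L @: S)%VS; split.
- rewrite -dimS; apply: limg_dim_eq; apply/eqP; rewrite -subv0.
  apply/subvP => v; rewrite memv_cap memv_ker LE memv0 => /andP[vS /eqP vM].
  by rewrite (injL v vS vM).
- split; first exact: tan1.
  move=> t eps /memv_imgP[v vS ->] eps0.
  have v1 : 0 < enorm v + 1 by rewrite ltr_wpDl ?enorm_ge0.
  have [dl dl0 hdl] := frpsi _ (divr_gt0 eps0 v1).
  exists (Num.min dl dlV / (enorm v + 1)); first by rewrite divr_gt0// lt_min dl0.
  move=> s s0; rewrite ltr_pdivlMr// lt_min => /andP[sdl sdlV].
  have sv : enorm (s *: v) <= s * (enorm v + 1).
    by rewrite enormZ_ge0 ?(ltW s0)// ler_pM2l//; lra.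
  have Vs : V (y0 + s *: v) by apply: hV; rewrite addrC addKr; lra.
  exists (psi (y0 + s *: v)); first exact: psiA.
  have := hdl (s *: v); rewrite psip LE -scalemxAl => h.
  rewrite enorm_distC opprD addrA; apply: le_trans (h _) _; first lra.
  rewrite mulrAC ler_pdivrMr// -mulrA ler_pM2l//.
- apply/seteqP; split=> [w|t] /=; first exact: tangent_space_sub.
  move=> /memv_imgP[v vS ->].
  have dgamma (s : R^o) : V (y0 + s *: v) ->
      derivable (fun s : R^o => psi (y0 + s *: v)) s 1.
    by move=> Vs; apply: derivable_line; exact: dpsi.
  (* Straight lines of the slice, read through [psi], realize every vector of [T] as a velocity. *)
  exists (fun s : R^o => psi (y0 + s *: v)); split.
  + by rewrite scale0r addr0.
  + have v1 : 0 < enorm v + 1 by rewrite ltr_wpDl ?enorm_ge0.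
    apply/nbhs_ballP; exists (dlV / (enorm v + 1)) => /=; first by rewrite divr_gt0.
    move=> s; rewrite -ball_normE /ball_/= sub0r normrN ltr_pdivlMr// => sV.
    have Vs : V (y0 + s *: v).
      apply: hV; rewrite addrC addKr enormZ; apply: le_lt_trans sV.
      by rewrite ler_wpM2l//; lra.
    by split; [exact: psiA | exact: dgamma].
  + apply: DeriveDef; first by apply: dgamma; rewrite scale0r addr0.
    by rewrite derive_line scale0r addr0 dpsiE LE.
Qed.

End chart.

(** * Principal angles *)

Section cosine.
Context {R : realType}.

Lemma sin_ge_half : exists2 a : R, 0 < a <= 1 &
  forall x : R, 0 <= x -> x <= a -> x / 2 <= sin x.
Proof.
have : nbhs (cos (0 : R)) [set y | 1 / 2 < y].
  by rewrite cos0; apply: lt_nbhsr; lra.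
move=> /(@continuous_cos R 0)/nbhs_ballP[e /= e0 he].
exists (Num.min 1 (e / 2)).
  by rewrite lt_min ge_min lexx ltr01 divr_gt0.
move=> x x0; rewrite le_min => /andP[_ xe].
have [c] := @MVT_segment R sin cos 0 x x0 (fun y _ => is_derive_sin y)
  (continuous_subspaceT (@continuous_sin R)).
rewrite in_itv/= sin0 !subr0 => /andP[c0 cx] ->.
have hc : 1 / 2 < cos c.
  by apply: he; rewrite -ball_normE /ball_/= sub0r normrN ger0_norm//; lra.
by rewrite mulrC; apply: ler_wpM2r => //; lra.
Qed.

(** [cos (4 * k) = 1 - 2 * sin (2 * k) ^+ 2], and [sin (2 * k) >= k] for small [k], so
    [cos (4 * k) < 1 - k ^+ 2 <= c]. *)
Lemma acos_le_sqrt : exists2 a : R, 0 < a &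
  forall k c : R, 0 < k -> k <= a -> 1 - k ^+ 2 <= c -> c <= 1 -> acos c <= 4 * k.
Proof.
have [a /andP[a0 a1] ha] := sin_ge_half.
exists (a / 4); first by rewrite divr_gt0.
move=> k c k0 ka kc c1; have kk : k * k <= 1 * 1 by apply: ler_pM; lra.
have c11 : -1 <= c <= 1 by rewrite c1 andbT; lra.
rewrite leNgt; apply/negP => kacos.
have pi2 := @pi_ge2 R.
have : cos (acos c) < cos (4 * k).
  by rewrite ltr_cos// in_itv/= ?acos_ge0 ?acos_lepi//; apply/andP; split; lra.
rewrite acosK ?in_itv//.
have -> : 4 * k = (2 * k) *+ 2 by rewrite -mulr_natr; ring.
rewrite cos_mulr2n cos2sin2.
have hs : k <= sin (2 * k).
  by have := ha (2 * k); rewrite mulrC mulfK//; apply; lra.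
have : k ^+ 2 <= sin (2 * k) ^+ 2 by rewrite ler_sqr ?nnegrE; lra.
by have := sqr_ge0 k; lra.
Qed.

End cosine.

(** * Bounding all principal angles by the distance of unit vectors to a subspace *)

Section principal.
Context {R : realType} {D : nat}.
Implicit Types (H T : {vspace 'rV[R]_D}).

(** First variation on the sphere: as [z] is orthogonal to [u], normalizing [u + s *: z] costs only
    a multiple of [s ^+ 2], while the inner product changes by [s * dotv z w], with [s] of either
    sign. *)
Lemma maximizer_orthogonal (u w z : 'rV[R]_D) :
  enorm u = 1 -> enorm w = 1 -> dotv u z = 0 ->
  (forall s, dotv ((enorm (u + s *: z))^-1 *: (u + s *: z)) w <= dotv u w) ->
  dotv z w = 0.
Proof.
move=> u1 w1 uz hmax.
have N2 s : enorm (u + s *: z) ^+ 2 = 1 + s ^+ 2 * enorm z ^+ 2.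
  by rewrite sqr_enorm dotv_addZ uz -!sqr_enorm u1; ring.
have key s : s * dotv z w <= s ^+ 2 * enorm z ^+ 2.
  set N := enorm (u + s *: z) in N2 *.
  have b0 : 0 <= s ^+ 2 * enorm z ^+ 2 by rewrite mulr_ge0// sqr_ge0.
  have N1 : 1 <= N.
    by rewrite -(@ler_sqr R) ?nnegrE ?enorm_ge0// N2; lra.
  have N0 : 0 < N by lra.
  have NN : N <= 1 + s ^+ 2 * enorm z ^+ 2.
    by rewrite -N2 expr2 ler_peMl// ltW.
  have := hmax s; rewrite -/N dotvZl dotvDl dotvZl ler_pdivrMl// => h.
  have uw : dotv u w <= 1 by have := dotv_le u w; rewrite u1 w1 mulr1.
  have [c0|c0] := leP 0 (dotv u w).
    have : (N - 1) * dotv u w <= (N - 1) * 1 by rewrite ler_wpM2l ?subr_ge0.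
    lra.
  have : 0 <= (N - 1) * (- dotv u w) by rewrite mulr_ge0 ?subr_ge0// oppr_ge0 ltW.
  lra.
have z1 : 0 < enorm z ^+ 2 + 1 by rewrite ltr_wpDl ?sqr_ge0.
(* With this [s], [key] reads [2 * s ^+ 2 * (enorm z ^+ 2 + 1) <= s ^+ 2 * enorm z ^+ 2], whence
   [s = 0]. *)
pose s := dotv z w / (2 * (enorm z ^+ 2 + 1)).
have := key s; set b := dotv z w in s *.
have bs : b = s * (2 * (enorm z ^+ 2 + 1)).
  by rewrite /s divfK// gt_eqF// mulr_gt0.
rewrite {1}bs => h.
have s2 : s ^+ 2 * (enorm z ^+ 2 + 2) <= 0 by lra.
have : s ^+ 2 <= 0 by move: s2; rewrite pmulr_lle0//; lra.
rewrite le_eqVlt ltNge sqr_ge0 orbF sqrf_eq0 => /eqP s0.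
by rewrite bs s0 mul0r.
Qed.

Section vectors.
Variables (d : nat) (H T : {vspace 'rV[R]_D}) (u w : 'I_d -> 'rV[R]_D).
Hypothesis pv : principal_vectors [set` H] [set` T] u w.

Let normalized_mem (V : {vspace 'rV[R]_D}) (a : 'I_d -> 'rV[R]_D) (i : 'I_d) z s :
  a i \in V -> enorm (a i) = 1 -> z \in V ->
  (forall k : 'I_d, (k < i)%N -> dotv (a i) (a k) = 0) ->
  (forall k : 'I_d, (k <= i)%N -> dotv z (a k) = 0) ->
  let x := (enorm (a i + s *: z))^-1 *: (a i + s *: z) in
  [/\ x \in V, enorm x = 1 & forall k : 'I_d, (k < i)%N -> dotv x (a k) = 0].
Proof.
move=> aV a1 zV aa za; split.
- by rewrite memvZ// memvD// memvZ.
- have n0 : enorm (a i + s *: z) != 0.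
    rewrite -sqrf_eq0 sqr_enorm dotv_addZ (dotvC (a i)) za// -sqr_enorm a1.
    by rewrite mulr0 addr0 expr1n gt_eqF// ltr_wpDr// mulr_ge0 ?sqr_ge0 ?dotvv_ge0.
  by rewrite enormZ_ge0 ?invr_ge0 ?enorm_ge0// mulVf.
- by move=> k ki; rewrite dotvZl dotvDl dotvZl aa// za ?(ltnW ki)// mulr0 addr0 mulr0.
Qed.

Lemma principal_orthogonal_left (i : 'I_d) z : z \in T ->
  (forall k : 'I_d, (k <= i)%N -> dotv z (w k) = 0) -> dotv z (u i) = 0.
Proof.
move=> zT zw; have [[uH u1 uu] [wT w1 ww] hmax] := pv i.
apply: (maximizer_orthogonal w1 u1); first by rewrite dotvC zw.
move=> s; have [xT x1 xw] := normalized_mem s wT w1 zT ww zw.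
by rewrite dotvC (dotvC (w i)); exact: hmax.
Qed.

(** Take a unit [y] in [T] orthogonal to the earlier [w i], and its projection [x] to [H]. By
    [principal_orthogonal_left], [x] is orthogonal to the earlier [u i], so [x / enorm x] and [y]
    compete with [u j] and [w j]; their inner product is [enorm x >= enorm x ^+ 2 = 1 - enorm (y -
    x) ^+ 2]. *)
Lemma principal_cos_ge (k : R) (j : 'I_d) : (d <= \dim T)%N -> 0 <= k -> k < 1 ->
  (forall t, t \in T -> enorm t = 1 -> exists2 h, h \in H & enorm (t - h) <= k) ->
  1 - k ^+ 2 <= dotv (u j) (w j) <= 1.
Proof.
move=> dT k0 k1 near_H; have [[uH u1 uu] [wT w1 ww] hmax] := pv j.
apply/andP; split; last by have := dotv_le (u j) (w j); rewrite u1 w1 mulr1.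
pose e i := if insub i is Some i' then w i' else 0.
have eE (i : 'I_d) : e i = w i by rewrite /e valK.
have eE' i (id : (i < d)%N) : e i = w (Ordinal id) by rewrite -eE.
have oe : orthonormal j e.
  move=> a b aj bj.
  have ad := ltn_trans aj (ltn_ord j); have bd := ltn_trans bj (ltn_ord j).
  rewrite (eE' a ad) (eE' b bd).
  have [_ [_ wa1 wwa] _] := pv (Ordinal ad).
  have [_ [_ _ wwb] _] := pv (Ordinal bd).
  case: (ltngtP a b) => [ab|ba|ab].
  - by rewrite dotvC; apply: wwb.
  - by apply: wwa.
  - have -> : Ordinal bd = Ordinal ad by apply/val_inj; rewrite /= ab.
    by rewrite -sqr_enorm wa1 expr1n.
have [||y [yT y1 ye]] := orthonormal_extend oe (V := T).
- exact: leq_trans (ltn_ord j) dT.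
- move=> i ij; rewrite (eE' i (ltn_trans ij (ltn_ord j))).
  by have [_ [+ _ _] _] := pv (Ordinal (ltn_trans ij (ltn_ord j))).
have yw (i : 'I_d) : (i < j)%N -> dotv y (w i) = 0 by move=> ij; rewrite -eE ye.
have [x xH xn] := orthogonal_projection H y.
have xu (i : 'I_d) : (i < j)%N -> dotv x (u i) = 0.
  move=> ij; have [[uiH _ _] _ _] := pv i.
  have : dotv (y - x) (u i) = 0 by exact: xn.
  rewrite dotvDl dotvNl (principal_orthogonal_left yT) => [/eqP|l li].
    by rewrite sub0r oppr_eq0 => /eqP.
  by apply: yw; exact: leq_ltn_trans li ij.
have yxx : dotv (y - x) x = 0 by exact: xn.
have xx : dotv x y = enorm x ^+ 2.
  by rewrite sqr_enorm dotvC -[y in LHS](subrK x) dotvDl yxx add0r.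
have x2 : enorm x ^+ 2 = 1 - enorm (y - x) ^+ 2.
  rewrite [in RHS]sqr_enorm dotv_sub (dotvC y) xx -!sqr_enorm y1; ring.
have [h hH yh] := near_H y yT y1.
have yxk : enorm (y - x) <= k.
  apply: le_trans yh; rewrite enorm_ge ?enorm_ge0//.
  have -> : y - h = (y - x) + (x - h) by rewrite subrKA.
  by rewrite dotv_add (xn (x - h)) ?memvB// mulr0 addr0 sqr_enorm lerDl dotvv_ge0.
have yxk2 : enorm (y - x) ^+ 2 <= k ^+ 2 by rewrite ler_sqr ?nnegrE ?enorm_ge0.
have kk : k ^+ 2 < 1 by rewrite expr_lt1.
have x_gt0 : 0 < enorm x.
  rewrite lt_def enorm_ge0 andbT; apply/eqP => x0.
  by move: x2; rewrite x0 expr0n/=; lra.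
have x_le1 : enorm x <= 1.
  by rewrite -(@expr_le1 R 2)// ?enorm_ge0// x2; have := sqr_ge0 (enorm (y - x)); lra.
apply: le_trans (_ : dotv ((enorm x)^-1 *: x) y <= _).
  rewrite dotvZl xx expr2 mulKf ?gt_eqF//.
  have : enorm x * enorm x <= enorm x * 1 by rewrite ler_pM2l.
  by rewrite mulr1 -expr2 x2; lra.
apply: hmax; split => //=.
- by rewrite memvZ.
- by rewrite enormZ_ge0 ?invr_ge0 ?enorm_ge0// mulVf// gt_eqF.
- by move=> i ij; rewrite dotvZl xu// mulr0.
Qed.

End vectors.

Lemma angle_max_le (d : nat) H T (a : R) : 0 <= a ->
  (forall u w : 'I_d -> 'rV[R]_D, principal_vectors [set` H] [set` T] u w ->
     forall j, acos (dotv (u j) (w j)) <= a) ->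
  angle_max d [set` H] [set` T] <= a.
Proof.
move=> a0 h; rewrite /angle_max; set S := [set _ | _].
have [S0|S0] := pselect (S !=set0).
  by apply: sup_le_ub => // _ [u [w [j [pv ->]]]]; exact: h.
(* The set of angles is empty when [d = 0]; its supremum is then 0 by convention, which [0 <= a]
   covers. *)
have -> : S = set0 by apply/seteqP; split=> // x Sx; apply: S0; exists x.
by rewrite sup0.
Qed.

End principal.

(** * Deviation of counts of independent events *)

Section counting.
Context {R : realType} (disp : measure_display) (T : measurableType disp).
Variables (P : probability T R) (n : nat) (B : 'I_n -> set T) (p : R).
Hypothesis mB : forall i, measurable (B i).
Hypothesis PB : forall i, P (B i) = p%:E.
Hypothesis PBB : forall i j, i != j -> P (B i `&` B j) = (p ^+ 2)%:E.

Let S (w : T) : R := \sum_(i < n) \1_(B i) w.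

Let mS : measurable_fun setT S.
Proof. by apply: measurable_sum => i; exact: measurable_indic. Qed.

Let S0 w : 0 <= S w.
Proof. by apply: sumr_ge0 => i _; rewrite indicE ler0n. Qed.

Let int_indic A r : measurable A -> P A = r%:E ->
  (\int[P]_w (\1_A w)%:E = r%:E)%E.
Proof. by move=> mA PA; rewrite integral_indic// setIT; exact: PA. Qed.

Let int_cst r : (\int[P]_w r%:E = r%:E)%E.
Proof.
transitivity (r%:E * P setT)%E; first exact: integral_cst.
by rewrite probability_setT mule1.
Qed.

Let intS : (\int[P]_w (S w)%:E = (n%:R * p)%:E)%E.
Proof.
under eq_integral do rewrite /S -sumEFin.
rewrite ge0_integral_sum//=.
- under eq_bigr => i _ do rewrite (int_indic (mB i) (PB i)).
  by rewrite sumEFin sumr_const card_ord mulr_natl.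
- by move=> i; apply/measurable_EFinP; exact: measurable_indic.
Qed.

Let intS2 : (\int[P]_w (S w ^+ 2)%:E =
  (n%:R * p + n%:R * (n%:R - 1) * p ^+ 2)%:E)%E.
Proof.
have -> : (fun w => (S w ^+ 2)%:E) =
    (fun w => \sum_(i < n) \sum_(j < n) (\1_(B i `&` B j) w)%:E)%E.
  apply/funext => w; under eq_bigr do rewrite sumEFin.
  rewrite sumEFin expr2 /S mulr_suml; congr EFin; apply: eq_bigr => i _.
  by rewrite mulr_sumr; apply: eq_bigr => j _; rewrite indicI.
rewrite ge0_integral_sum//=; last 2 first.
- move=> i; apply: emeasurable_sum => j; apply/measurable_EFinP.
  by apply: measurable_indic; exact: measurableI.
- by move=> i w _; apply: sume_ge0 => j _; rewrite lee_fin indicE ler0n.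
have h (i : 'I_n) : (\int[P]_w (\sum_(j < n) (\1_(B i `&` B j) w)%:E) =
    (p + (n%:R - 1) * p ^+ 2)%:E)%E.
  rewrite ge0_integral_sum//=; last first.
    move=> j; apply/measurable_EFinP.
    by apply: measurable_indic; exact: measurableI.
  rewrite (bigD1 i)//= setIid (int_indic (mB i) (PB i)).
  under eq_bigr => j ji.
    rewrite (int_indic (measurableI _ _ (mB i) (mB j)) (PBB _)); last by rewrite eq_sym.
    over.
  rewrite sumEFin -EFinD; congr (_ + _)%:E.
  rewrite sumr_const -[X in _ *+ X]/(#|[pred j | j != i]|).
  rewrite cardC1 card_ord -[LHS]mulr_natl; congr (_ * _).
  by rewrite -subn1 natrB// (leq_ltn_trans (leq0n i)).
under eq_bigr => i _ do rewrite h.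
rewrite sumEFin sumr_const card_ord -mulr_natl; congr EFin; ring.
Qed.

Lemma count_deviation_measurable a :
  measurable [set w | a <= `|S w - n%:R * p|].
Proof.
rewrite -[X in measurable X]setTI.
apply: (measurable_fun_le (f := cst a) (g := fun w => `|S w - n%:R * p|)) => //.
apply: measurableT_comp => //; exact: measurable_funB.
Qed.

(** Chebyshev's inequality, with the variance [n%:R * p * (1 - p)] bounded by [n%:R * p]; pairwise
    independence suffices for the variance. *)
Lemma count_deviation a : 0 < a -> (P [set w | (a <= `|S w - n%:R * p|)%R] <=
  (n%:R * p / a ^+ 2)%:E)%E.
Proof.
move=> a0; have p0 : 0 <= n%:R * p.
  rewrite -lee_fin -intS; apply: integral_ge0 => w _.
  by rewrite lee_fin.
pose g w := (S w - n%:R * p) ^+ 2.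
have mg : measurable_fun setT g.
  by apply: measurable_funX; exact: measurable_funB.
have intg : (\int[P]_w (g w)%:E = (n%:R * p - n%:R * p ^+ 2)%:E)%E.
  (* The square is expanded with the cross term moved to the left, so that every integrand is
     nonnegative and no integrability is to be checked. *)
  have : (\int[P]_w ((g w)%:E + (2 * n%:R * p)%:E * (S w)%:E) =
          \int[P]_w ((S w ^+ 2)%:E + ((n%:R * p) ^+ 2)%:E))%E.
    apply: eq_integral => w _; rewrite -EFinM -!EFinD /g; congr EFin; ring.
  rewrite ge0_integralD//; last 4 first.
  - by move=> w _; rewrite lee_fin sqr_ge0.
  - exact/measurable_EFinP.
  - by move=> w _; rewrite -EFinM lee_fin mulr_ge0// -mulrA mulr_ge0.
  - by apply/measurable_EFinP; exact: measurable_funM.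
  rewrite ge0_integralD//; last 3 first.
  - by move=> w _; rewrite lee_fin sqr_ge0.
  - by apply/measurable_EFinP; exact: measurable_funX.
  - by move=> w _; rewrite lee_fin sqr_ge0.
  rewrite ge0_integralZl//; last 3 first.
  - exact/measurable_EFinP.
  - by move=> w _; rewrite lee_fin.
  - by rewrite lee_fin -mulrA mulr_ge0.
  rewrite intS intS2 int_cst -EFinM -EFinD.
  case: (\int[P]_w (g w)%:E)%E => [G|//|//]; rewrite -EFinD => -[h]; congr EFin.
  lra.
have a2 : 0 < a ^+ 2 by rewrite exprn_gt0.
have mA := count_deviation_measurable a.
rewrite EFinM muleC -lee_pdivrMl; last by rewrite invr_gt0.
rewrite invrK.
apply: le_trans (_ : (\int[P]_w (g w)%:E <= _)%E); last first.
  rewrite intg lee_fin.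
  have : 0 <= n%:R * p ^+ 2 by rewrite mulr_ge0 ?sqr_ge0.
  lra.
have [r PA] : exists r, P [set w | (a <= `|S w - n%:R * p|)%R] = r%:E.
  by exists (fine (P [set w | (a <= `|S w - n%:R * p|)%R])); rewrite fineK// fin_num_measure.
rewrite PA -(int_indic mA PA) -ge0_integralZl//; last 2 first.
- by apply/measurable_EFinP; exact: measurable_indic.
- by rewrite lee_fin sqr_ge0.
apply: ge0_le_integral => //.
- by move=> w _; rewrite -EFinM lee_fin mulr_ge0 ?sqr_ge0// indicE.
- by apply/measurable_EFinP; apply: measurable_funM => //; exact: measurable_indic.
- exact/measurable_EFinP.
move=> w _; rewrite -EFinM lee_fin indicE; case: (boolP (w \in _)) => [|_].
  rewrite inE/= mulr1 /g -(real_normK (num_real (S w - n%:R * p))) => h.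
  by rewrite ler_sqr ?nnegrE// ltW.
by rewrite mulr0 sqr_ge0.
Qed.

End counting.

(** * Lebesgue measure of cubes *)

Section lebesgue.
Context {R : realType}.

Lemma lebesgue_rV_ge0 D (A : set 'rV[R]_D) : (0 <= lebesgue_rV A)%E.
Proof.
elim: D A => [|D IH] A /=; first by rewrite lee_fin indicE ler0n.
by apply: integral_ge0 => x _; exact: IH.
Qed.

(* [lebesgue_rV] is monotone on arbitrary sets because the integral of a
   nonnegative function is a supremum over simple functions below it, whether
   or not the function is measurable. *)
Lemma le_lebesgue_rV D (A B : set 'rV[R]_D) : A `<=` B ->
  (lebesgue_rV A <= lebesgue_rV B)%E.
Proof.
elim: D A B => [|D IH] A B AB /=.
  rewrite lee_fin !indicE ler_nat; case: (boolP (_ \in A)) => //.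
  by rewrite inE => /AB; rewrite -inE => ->.
have h (x : R) : (lebesgue_rV [set v : 'rV[R]_D | A (row_mx x%:M v)] <=
    lebesgue_rV [set v : 'rV[R]_D | B (row_mx x%:M v)])%E.
  by apply: IH => v; exact: AB.
rewrite !ge0_integralTE; try by move=> x; exact: lebesgue_rV_ge0.
apply: le_ereal_sup => _ /= [f fA <-]; exists f => // x.
exact: le_trans (fA x) (h x).
Qed.

Definition cube D (c : 'rV[R]_D) (a : R) : set 'rV[R]_D :=
  [set v | forall i, `|v 0 i - c 0 i| < a].

Lemma lebesgue_rV0 D : lebesgue_rV (set0 : set 'rV[R]_D) = 0%E.
Proof.
elim: D => [|D IH] /=; first by rewrite indic0.
rewrite -[RHS](@integral0 _ _ _ (@lebesgue_measure R) setT).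
by apply: eq_integral => x _; rewrite -[RHS]IH.
Qed.

Lemma lebesgue_cube D (c : 'rV[R]_D) a : 0 < a ->
  lebesgue_rV (cube c a) = ((2 * a) ^+ D)%:E.
Proof.
move=> a0; elim: D c => [|D IH] c /=.
  by rewrite indicE mem_set// => -[].
pose I := `]c 0 0 - a, c 0 0 + a[%classic : set R.
have -> : (fun x : R => lebesgue_rV [set v : 'rV[R]_D | cube c a (row_mx x%:M v)]) =
    ((cst ((2 * a) ^+ D)%:E) \_ I)%E.
  apply/funext => x; rewrite patchE; case: ifPn => [|].
    rewrite inE /I/= in_itv/= => /andP[x1 x2].
    rewrite -(IH (rsubmx (c : 'rV[R]_(1 + D)))); congr lebesgue_rV.
    apply/seteqP; split => v /= cv i.
      by have := cv (rshift 1 i); rewrite (row_mxEr (x%:M : 'M[R]_1)) mxE.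
    case: (split_ordP (i : 'I_(1 + D))) => j ->.
      rewrite (row_mxEl (x%:M : 'M[R]_1)) ord1 mxE eqxx mulr1n.
      have -> : lshift D 0 = 0 :> 'I_(1 + D) by apply/val_inj.
      by rewrite ltr_norml; apply/andP; split; lra.
    by rewrite (row_mxEr (x%:M : 'M[R]_1)); have := cv j; rewrite mxE.
  move=> xI; transitivity (lebesgue_rV (set0 : set 'rV[R]_D)); last exact: lebesgue_rV0.
  congr lebesgue_rV.
  apply/seteqP; split => v //= cv.
  have := cv (lshift D 0 : 'I_(1 + D)); rewrite (row_mxEl (x%:M : 'M[R]_1)) mxE eqxx mulr1n.
  have -> : lshift D 0 = 0 :> 'I_(1 + D) by apply/val_inj.
  rewrite ltr_norml => /andP[h1 h2]; case/negP : xI.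
  by rewrite inE /I/= in_itv/=; apply/andP; split; lra.
have muI : lebesgue_measure I = (2 * a)%:E.
  rewrite lebesgue_measure_itv/= lte_fin ifT; last lra.
  by rewrite -EFinD; congr EFin; ring.
rewrite -integral_mkcond integral_cst; last exact: measurable_itv.
by rewrite [X in (_ * X)%E]muI -EFinM exprSr.
Qed.

Lemma open_cube D (c : 'rV[R]_D) a : open (cube c a).
Proof.
apply/open_enormP => x xc.
have [D0|D0] := posnP D.
  by exists 1 => // y _ i; have := ltn_ord i; rewrite [X in (_ < X)%N]D0.
pose m := \big[Num.max/0]_(i < D) `|x 0 i - c 0 i|.
have ma : m < a.
  apply: bigmax_lt => [|i _]; last exact: xc.
  exact: le_lt_trans (normr_ge0 _) (xc (Ordinal D0)).
exists (a - m) => [|y yx i]; first by rewrite subr_gt0.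
have h1 : `|x 0 i - c 0 i| <= m.
  exact: (le_bigmax _ (fun i => `|x 0 i - c 0 i|)).
have h2 := coord_le_enorm (y - x) i; rewrite !mxE in h2.
by have := ler_distD (x 0 i) (y 0 i) (c 0 i); lra.
Qed.

Lemma cube_enorm D (c x : 'rV[R]_D) a : cube c a x -> enorm (x - c) <= D%:R * a.
Proof. by move=> xc; apply: enorm_le_coord => i; rewrite !mxE ltW. Qed.

Lemma enorm_cube D (c x : 'rV[R]_D) a : enorm (x - c) < a -> cube c a x.
Proof.
by move=> xc i; have := coord_le_enorm (x - c) i; rewrite !mxE => /le_lt_trans; apply.
Qed.

Lemma open_borel D (Q : set 'rV[R]_D) : open Q -> measurable (Q : set (borel_rV R D)).
Proof. by move=> oQ; exact: sub_gen_smallest. Qed.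

End lebesgue.

(** * Probability of finite unions *)

Section finite_union.
Context {R : realType} (disp : measure_display) (T : measurableType disp).
Variable P : probability T R.

Lemma bigsetU_measurable (I : finType) (F : I -> set T) s :
  (forall i, measurable (F i)) -> measurable (\big[setU/set0]_(i <- s) F i).
Proof.
by move=> mF; elim/big_ind: _ => // A B mA mB; exact: measurableU.
Qed.

Lemma probability_bigsetU_le (I : finType) (F : I -> set T) (c : I -> R) s :
  (forall i, measurable (F i)) -> (forall i, (P (F i) <= (c i)%:E)%E) ->
  (P (\big[setU/set0]_(i <- s) F i) <= (\sum_(i <- s) c i)%:E)%E.
Proof.
move=> mF Fc; elim: s => [|i s IH]; first by rewrite !big_nil measure0.
rewrite !big_cons EFinD.
apply: le_trans (measureU2 _ _ _) _ => //; first exact: bigsetU_measurable.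
exact: leeD (Fc i) IH.
Qed.

Lemma probability_bigsetU_disjoint (I : finType) (F : I -> set T) (c : R) s :
  (forall i, measurable (F i)) -> (forall i, P (F i) = c%:E) ->
  (forall i j, i != j -> F i `&` F j = set0) -> uniq s ->
  P (\big[setU/set0]_(i <- s) F i) = ((size s)%:R * c)%:E.
Proof.
move=> mF Fc dF; elim: s => [|i s IH] /=; first by rewrite big_nil measure0 mul0r.
move=> /andP[is_ us].
rewrite big_cons -natr1 mulrDl mul1r addrC EFinD -(Fc i) -(IH us).
apply: measureU => //; first exact: bigsetU_measurable.
rewrite big_distrr/= big_seq big1// => j js.
by apply: dF; apply: contraNneq is_ => ->.
Qed.

End finite_union.

(** * Uniform samples *)

Definition unif_prob (R : realType) (D : nat) (B Q : set 'rV[R]_D) : R :=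
  fine (lebesgue_rV (Q `&` B)) / fine (lebesgue_rV B).

Section uniform_variable.
Context {R : realType} {D : nat} (B : set 'rV[R]_D).
Context (disp : measure_display) (T : measurableType disp) (P : probability T R).
Variable X : {RV P >-> borel_rV R D}.
Hypothesis PX : forall Q : set (borel_rV R D), measurable Q ->
  P (X @^-1` Q) = (unif_prob B Q)%:E.

Lemma measurable_RV (Q : set (borel_rV R D)) : measurable Q ->
  measurable (X @^-1` Q).
Proof. by move=> mQ; rewrite -[X @^-1` Q]setTI; exact: measurable_funPT. Qed.

(* As [unif_prob B setT = 1], the measure of [B] is neither 0 nor +oo. *)
Lemma lebesgue_support_gt0 : 0 < fine (lebesgue_rV B).
Proof.
have : P (X @^-1` setT) = (unif_prob B setT)%:E by apply: PX; exact: measurableT.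
rewrite preimage_setT probability_setT /unif_prob setTI => -[B1].
rewrite lt_def fine_ge0 ?lebesgue_rV_ge0// andbT.
apply/eqP => B0; move: B1; rewrite B0 mul0r => /eqP.
by rewrite oner_eq0.
Qed.

Lemma unif_prob_support : unif_prob B B = 1.
Proof. by rewrite /unif_prob setIid divff// gt_eqF// lebesgue_support_gt0. Qed.

Lemma unif_prob_setI Q : unif_prob B (Q `&` B) = unif_prob B Q.
Proof. by rewrite /unif_prob -setIA setIid. Qed.

Lemma unif_prob_cube_le c a : 0 < a ->
  unif_prob B (cube c a) <= (2 * a) ^+ D / fine (lebesgue_rV B).
Proof.
move=> a0; rewrite ler_wpM2r ?invr_ge0 ?(ltW lebesgue_support_gt0)//.
have h : (lebesgue_rV (cube c a `&` B) <= ((2 * a) ^+ D)%:E)%E.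
  by rewrite -(lebesgue_cube c a0); apply: le_lebesgue_rV => x [].
have := lebesgue_rV_ge0 (cube c a `&` B); move: h.
by case: (lebesgue_rV _).
Qed.

Lemma unif_prob_cube c a : 0 < a -> cube c a `<=` B ->
  unif_prob B (cube c a) = (2 * a) ^+ D / fine (lebesgue_rV B).
Proof.
move=> a0 cB; rewrite /unif_prob; congr (_ / _).
have -> : cube c a `&` B = cube c a by apply/setIidPl.
by rewrite lebesgue_cube.
Qed.

(** Subadditivity is borrowed from [P]: through [X], [unif_prob] on Borel sets is the law of a
    random variable, so of [lebesgue_rV] itself only monotonicity and the value on cubes are used.
    The packing bound below proceeds likewise. *)
Lemma unif_prob_cover (Q : set 'rV[R]_D) (I : finType) (c : I -> 'rV[R]_D) a :
  open Q -> open B -> 0 < a ->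
  (forall x, Q x -> B x -> exists i, cube (c i) a x) ->
  unif_prob B Q <= #|I|%:R * ((2 * a) ^+ D / fine (lebesgue_rV B)).
Proof.
move=> oQ oB a0 cov; rewrite -unif_prob_setI.
have mQB : measurable (Q `&` B : set (borel_rV R D)).
  by apply: open_borel; exact: openI.
rewrite -lee_fin -PX//.
have mC i : measurable (X @^-1` (cube (c i) a : set (borel_rV R D))).
  by apply: measurable_RV; apply: open_borel; exact: open_cube.
apply: le_trans (_ : (P (\big[setU/set0]_(i <- index_enum I)
    X @^-1` (cube (c i) a : set (borel_rV R D))) <= _)%E).
  apply: le_measure; rewrite ?inE//.
  - exact: measurable_RV.
  - exact: bigsetU_measurable.
  - move=> w [Qw Bw]; have [i ci] := cov _ Qw Bw.
    by rewrite -bigcup_seq; exists i => //=; rewrite mem_index_enum.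
apply: le_trans (probability_bigsetU_le
  (c := fun=> (2 * a) ^+ D / fine (lebesgue_rV B)) _ _ _) _ => //.
  move=> i; rewrite PX ?lee_fin; last by apply: open_borel; exact: open_cube.
  exact: unif_prob_cube_le.
rewrite lee_fin sumr_const [leRHS]mulr_natl le_eqVlt; apply/orP; left; apply/eqP.
congr (_ *+ _); exact: eq_card.
Qed.

Lemma unif_prob_packing (Q : set 'rV[R]_D) (I : finType) (c : I -> 'rV[R]_D) a :
  open Q -> 0 < a ->
  (forall i, cube (c i) a `<=` B) -> (forall i, cube (c i) a `<=` Q) ->
  (forall i j x, cube (c i) a x -> cube (c j) a x -> i = j) ->
  #|I|%:R * ((2 * a) ^+ D / fine (lebesgue_rV B)) <= unif_prob B Q.
Proof.
move=> oQ a0 cB cQ cI.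
rewrite -lee_fin -PX; last exact: open_borel.
have mC i : measurable (X @^-1` (cube (c i) a : set (borel_rV R D))).
  by apply: measurable_RV; apply: open_borel; exact: open_cube.
have PC i : P (X @^-1` (cube (c i) a : set (borel_rV R D))) =
    ((2 * a) ^+ D / fine (lebesgue_rV B))%:E.
  by rewrite PX ?unif_prob_cube//; apply: open_borel; exact: open_cube.
have dC i j : i != j -> X @^-1` (cube (c i) a) `&` X @^-1` (cube (c j) a) = set0.
  move=> ij; apply/seteqP; split => // w [wi wj].
  by move: ij; rewrite (cI _ _ _ wi wj) eqxx.
have := probability_bigsetU_disjoint mC PC dC (index_enum_uniq I).
rewrite (_ : size (index_enum I) = #|I|); last by rewrite cardT enumT.
move=> <-; apply: le_measure; rewrite ?inE//.
- exact: bigsetU_measurable.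
- by apply: measurable_RV; exact: open_borel.
- by move=> w; rewrite -bigcup_seq => -[i _]; exact: cQ.
Qed.

End uniform_variable.

Section sampling.
Context {R : realType} {D : nat} (B : set 'rV[R]_D) (oB : open B).
Variables (J : finType) (Q : J -> set 'rV[R]_D).
Hypothesis oQ : forall j, open (Q j).

(** A union bound over [J] of Chebyshev's inequality with deviation half the mean, together with the
    null events that a sample misses [B]. [N] precedes the probability space; positivity comes after
    it, since it is only derived once a uniform variable is given. *)
Lemma iid_counts (delta : R) : 0 < delta -> exists N : nat, forall n : nat, (N < n)%N ->
  forall (disp : measure_display) (T : measurableType disp)
    (P : probability T R) (X : 'I_n -> {RV P >-> borel_rV R D}),
  iid_uniform B X -> (forall j, 0 < unif_prob B (Q j)) ->
  exists E : set T, [/\ measurable E, ((1 - delta)%:E <= P E)%E &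
    forall w, E w -> (forall i, B (X i w)) /\
      forall j, n%:R * unif_prob B (Q j) / 2 <= \sum_(i < n) \1_(Q j) (X i w)
        <= 2 * (n%:R * unif_prob B (Q j))].
Proof.
(* With deviation [n%:R * p / 2], the bound [n%:R * p / a ^+ 2] becomes [4 / p / n%:R]; the sum
   [S / n%:R] is below [delta] for [n > S / delta]. *)
move=> delta0; pose S := \sum_(j : J) 4 / unif_prob B (Q j).
exists (Num.truncn (S / delta)) => n nN disp T P X [indep unif] pos.
have n0 : 0 < n%:R :> R by rewrite ltr0n (leq_ltn_trans _ nN).
have PX i (K : set (borel_rV R D)) : measurable K ->
    P (X i @^-1` K) = (unif_prob B K)%:E by exact: unif.
have mX i (K : set 'rV[R]_D) : open K -> measurable (X i @^-1` (K : set (borel_rV R D))).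
  by move=> oK; apply: measurable_RV; exact: open_borel.
have mB : measurable (B : set (borel_rV R D)) by exact: open_borel.
pose F j (i : 'I_n) : set T := X i @^-1` (Q j : set (borel_rV R D)).
have mF j i : measurable (F j i) by exact: mX.
have PF j i : P (F j i) = (unif_prob B (Q j))%:E by apply: PX; exact: open_borel.
have PFF j i i' : i != i' -> P (F j i `&` F j i') = (unif_prob B (Q j) ^+ 2)%:E.
  move=> ii'.
  have := indep [set i; i']%SET (fun=> Q j : set (borel_rV R D)) (fun=> open_borel (@oQ j)).
  rewrite big_setU1/=; last by rewrite inE.
  rewrite big_set1 !PX; try exact: open_borel.
  rewrite -EFinM -expr2 => <-; congr (P _); apply/seteqP; split => w /=.
    by move=> [w1 w2] k; rewrite !inE => /orP[/eqP->|/eqP->].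
  by move=> h; split; apply: h; rewrite !inE eqxx ?orbT.
pose a j := n%:R * unif_prob B (Q j) / 2.
have a0 j : 0 < a j by rewrite divr_gt0// mulr_gt0.
pose dev j := [set w | a j <= `|\sum_(i < n) \1_(F j i) w - n%:R * unif_prob B (Q j)|].
have mdev j : measurable (dev j).
  exact: (count_deviation_measurable _ (mF j) (a j)).
have Pdev j : (P (dev j) <= (4 / unif_prob B (Q j) / n%:R)%:E)%E.
  apply: le_trans (count_deviation (mF j) (PF j) (PFF j) (a0 j)) _.
  rewrite lee_fin /a le_eqVlt; apply/orP; left; apply/eqP; field.
  by rewrite !gt_eqF ?pos.
pose out i := ~` (X i @^-1` (B : set (borel_rV R D))).
have mout i : measurable (out i) by apply: measurableC; exact: mX.
have Pout i : (P (out i) <= 0%:E)%E.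
  rewrite probability_setC ?PX//; last exact: mX.
  by rewrite (unif_prob_support (PX i)) subee.
pose bad := (\big[setU/set0]_(j <- index_enum J) dev j) `|`
  (\big[setU/set0]_(i <- index_enum 'I_n) out i).
have mbad1 : measurable (\big[setU/set0]_(j <- index_enum J) dev j).
  exact: bigsetU_measurable.
have mbad2 : measurable (\big[setU/set0]_(i <- index_enum 'I_n) out i).
  exact: bigsetU_measurable.
have mbad : measurable bad by exact: measurableU.
exists (~` bad); split.
- exact: measurableC.
- rewrite probability_setC// EFinB leeB//.
  apply: le_trans (measureU2 _ _ _) _ => //.
  have h1 := probability_bigsetU_le (index_enum J) mdev Pdev.
  have h2 := probability_bigsetU_le (c := fun=> 0) (index_enum 'I_n) mout Pout.
  apply: le_trans (leeD h1 h2) _.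
  rewrite -EFinD [X in (_ + X)%:E]big1// addr0 -mulr_suml -/S lee_fin ler_pdivrMr//.
  rewrite mulrC -ler_pdivrMr//; apply: ltW; apply: lt_le_trans (truncnS_gt _) _.
  by rewrite ler_nat.
- move=> w; rewrite /bad setCU => -[w1 w2]; split.
    move=> i; apply: contrapT => wi; apply: w2; rewrite -bigcup_seq.
    by exists i => //=; rewrite mem_index_enum.
  move=> j.
  have : ~ dev j w.
    move=> wj; apply: w1; rewrite -bigcup_seq.
    by exists j => //=; rewrite mem_index_enum.
  move=> /negP; rewrite -ltNge /a ltr_norml.
  have -> : \sum_(i < n) \1_(F j i) w = \sum_(i < n) \1_(Q j) (X i w) :> R.
    by apply: eq_bigr => i _; rewrite !indicE; congr ((_ : bool)%:R);
       apply/idP/idP; rewrite !inE.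
  by move=> /andP[h1 h2]; apply/andP; split; lra.
Qed.

End sampling.

(** * The tube near a tangent plane *)

Section tubes.
Context {R : realType} {D : nat}.

Definition eball (c : 'rV[R]_D) (a : R) : set 'rV[R]_D :=
  [set x | enorm (x - c) < a].

Lemma open_eball c a : open (eball c a).
Proof.
apply/open_enormP => x xc; exists (a - enorm (x - c)); first by rewrite subr_gt0.
by move=> y yx; have := enorm_dist y x c; rewrite /eball/=; lra.
Qed.

Lemma open_tube (A : set 'rV[R]_D) s : A !=set0 -> open (tube A s).
Proof.
move=> A0; apply/open_enormP => x; rewrite /tube/= => xs.
exists (s - edist x A); first by rewrite subr_gt0.
by move=> y yx; have := edist_lipschitz x y A0; lra.
Qed.

End tubes.

(** * The tube against the tangent plane at the nearest point of [r] *)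

Section frame.
Context {R : realType} {D : nat} (A : set 'rV[R]_D) (tau sigma rho : R).
Hypotheses (A0 : A !=set0) (cA : compact A).
Hypothesis unique_nearest : forall x, edist x A < tau -> exists! p, nearest A x p.
Hypothesis tangentA : forall p, A p -> exists T, tangent_approx A p T.
Variables (r p0 : 'rV[R]_D) (T : {vspace 'rV[R]_D}) (d : nat) (e : nat -> 'rV[R]_D).
Hypothesis rp0 : nearest A r p0.
Hypothesis Tp0 : tangent_approx A p0 T.
Hypothesis oe : orthonormal d e.
Hypothesis eT : forall i, (i < d)%N -> e i \in T.
Hypothesis Te : forall v, v \in T -> v = \sum_(i < d) dotv v (e i) *: e i.
Hypotheses (tau0 : 0 < tau) (sigma0 : 0 < sigma).
Hypothesis rsigma : enorm (r - p0) < sigma.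
Hypotheses (rho0 : 0 < rho) (rho2 : rho ^+ 2 = sigma * tau).
Hypothesis rho_ge : 2 * sigma <= rho.

(** A point [m] of [A] within [sigma] of [x] is within [2 * rho] of [p0], hence within
    [(2 * rho) ^+ 2 / (2 * tau) = 2 * sigma] of the plane. *)
Lemma tube_near_plane x : tube A sigma x -> enorm (x - r) < rho ->
  exists2 t, t \in T & enorm (x - p0 - t) <= 3 * sigma /\ enorm t <= 3 * rho.
Proof.
have [rs rg] := (rsigma, rho_ge); have [s0 t0 r0] := And3 sigma0 tau0 rho0.
move=> /(edist_lt A0)[m Am xm] xr.
have mp0 : enorm (m - p0) <= 2 * rho.
  have := enorm_dist m x p0; have := enorm_dist x r p0.
  by rewrite (enorm_distC m x); lra.
have [t tT ht] := tangent_dist A0 cA tau0 unique_nearest rp0.1 Am Tp0.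
have h : enorm (m - p0) ^+ 2 <= 4 * (sigma * tau).
  rewrite -rho2; have : enorm (m - p0) ^+ 2 <= (2 * rho) ^+ 2.
    by rewrite ler_sqr ?nnegrE ?enorm_ge0//; lra.
  lra.
have mt : enorm (m - p0 - t) <= 2 * sigma.
  by rewrite -(ler_pM2l tau0); lra.
exists t => //; split.
  have -> : x - p0 - t = (x - m) + (m - p0 - t).
    by apply/rowP => i; rewrite !mxE; ring.
  by have := enormD (x - m) (m - p0 - t); lra.
have -> : t = (m - p0) - (m - p0 - t) by apply/rowP => i; rewrite !mxE; ring.
by have := enormB (m - p0) (m - p0 - t); lra.
Qed.

(** By [ray_dist], [p0 + t] is within [3 * (rho / 4) ^+ 2 / tau = 3 * sigma / 16] of [A], which
    leaves room for a ball of radius [sigma / 2]. *)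
Lemma plane_in_tube t x : t \in T -> enorm t <= rho / 4 ->
  enorm (x - (p0 + t)) < sigma / 2 -> tube A sigma x.
Proof.
have [rs rg] := (rsigma, rho_ge); have [s0 t0 r0] := And3 sigma0 tau0 rho0.
move=> tT trho xt.
have pt : edist (p0 + t) A <= sigma / 4.
  have [->|tn0] := eqVneq t 0.
    rewrite addr0; apply: le_trans (edist_le _ rp0.1) _.
    by rewrite subrr enorm0; lra.
  have nt : 0 < enorm t by rewrite enorm_gt0.
  have t1T : (enorm t)^-1 *: t \in T by rewrite memvZ.
  have t11 : enorm ((enorm t)^-1 *: t) = 1.
    by rewrite enormZ_ge0 ?invr_ge0 ?enorm_ge0// mulVf// gt_eqF.
  have ttau : enorm t < tau.
    have : rho * rho < rho * tau.
      rewrite -expr2 rho2 ltr_pM2r//; lra.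
    by rewrite ltr_pM2l//; lra.
  have := ray_dist A0 cA tau0 unique_nearest tangentA rp0.1 Tp0 t1T t11 (ltW nt) ttau.
  rewrite scalerA mulfV ?gt_eqF// scale1r => h.
  have h2 : enorm t ^+ 2 <= (rho / 4) ^+ 2.
    by rewrite ler_sqr ?nnegrE ?enorm_ge0//; lra.
  have h3 : (rho / 4) ^+ 2 = sigma * tau / 16 by rewrite expr_div_n rho2; field.
  have st : 0 < sigma * tau by rewrite mulr_gt0.
  by rewrite -(ler_pM2l t0); lra.
rewrite /tube/=; have := edist_lipschitz (p0 + t) x A0; lra.
Qed.

Section volume.
Context (disp : measure_display) (Om : measurableType disp) (P : probability Om R).
Variable X : {RV P >-> borel_rV R D}.
Hypothesis PX : forall Q : set (borel_rV R D), measurable Q ->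
  P (X @^-1` Q) = (unif_prob (tube A sigma) Q)%:E.

Let V := fine (lebesgue_rV (tube A sigma)).
Let V0 : 0 < V. Proof. exact: lebesgue_support_gt0 PX. Qed.

(** A grid of mesh [sigma] on [p0 + T] covers the tube in the ball: rounding costs at most
    [d%:R * sigma], leaving the plane at most [3 * sigma]. With [L <= 3 * rho / sigma + 1] there are
    [2 * L + 1 <= 9 * (rho / sigma)] nodes per direction. *)
Lemma unif_prob_ball_le : unif_prob (tube A sigma) (eball r rho) <=
  (9 * (rho / sigma)) ^+ d * ((2 * ((4 + d%:R) * sigma)) ^+ D / V).
Proof.
have [rs rg] := (rsigma, rho_ge); have [s0 t0 r0] := And3 sigma0 tau0 rho0.
pose mu := rho / sigma; have mu2 : 2 <= mu by rewrite ler_pdivlMr.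
pose L := (Num.truncn (3 * mu)).+1.
have L1 : 3 * mu < L%:R by exact: truncnS_gt.
have L2 : L%:R <= 3 * mu + 1.
  by rewrite /L -natr1 lerD2r truncn_le; lra.
clearbody L.
have L2E : (2 * L).+1%:R = 2 * L%:R + 1 :> R by rewrite -natrM natr1.
pose c (k : {ffun 'I_d -> 'I_(2 * L).+1}) :=
  p0 + \sum_(i < d) (((k i)%:R - L%:R) * sigma) *: e i.
have a0 : 0 < (4 + d%:R) * sigma by rewrite mulr_gt0// ltr_pwDl.
have cov x : eball r rho x -> tube A sigma x ->
    exists k, cube (c k) ((4 + d%:R) * sigma) x.
  move=> xr xt; have [t tT [xpt tr]] := tube_near_plane xt xr.
  pose y i := dotv t (e i) / sigma + L%:R.
  have te i : (i < d)%N -> `|dotv t (e i)| <= 3 * rho.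
    move=> id; have e1 : enorm (e i) = 1.
      by rewrite /enorm oe// eqxx sqrtr1.
    rewrite ler_norml; apply/andP; split.
      by have := dotv_ge t (e i); rewrite e1; lra.
    by have := dotv_le t (e i); rewrite e1; lra.
  have yb i : (i < d)%N -> 0 <= y i < (2 * L).+1%:R.
    move=> /te; rewrite ler_norml => /andP[h1 h2].
    have E : 3 * mu = 3 * rho / sigma by rewrite /mu mulrA.
    rewrite /y; apply/andP; split.
      have : - (3 * rho) / sigma <= dotv t (e i) / sigma by rewrite ler_pM2r ?invr_gt0.
      rewrite mulNr -E; lra.
    have : dotv t (e i) / sigma <= (3 * rho) / sigma by rewrite ler_pM2r ?invr_gt0.
    rewrite -E L2E; lra.
  have ylt (i : 'I_d) : (Num.truncn (y i) < (2 * L).+1)%N.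
    have /andP[y0 y1] := yb i (ltn_ord i).
    by rewrite -(ltr_nat R); apply: le_lt_trans y1; rewrite truncn_le.
  exists [ffun i => Ordinal (ylt i)]; apply: enorm_cube.
  set k := [ffun _ => _].
  have -> : x - c k = (x - p0 - t) + \sum_(i < d) (dotv t (e i) - ((k i)%:R - L%:R) * sigma) *: e i.
    transitivity (x - p0 - t + (\sum_(i < d) dotv t (e i) *: e i -
        \sum_(i < d) ((k i)%:R - L%:R) * sigma *: e i)).
      by rewrite -(Te tT) addrA subrK /c opprD addrA.
    by rewrite -sumrB; congr (_ + _); apply: eq_bigr => i _; rewrite scalerBl.
  apply: le_lt_trans (enormD _ _) _.
  have : enorm (\sum_(i < d) (dotv t (e i) - ((k i)%:R - L%:R) * sigma) *: e i) <= d%:R * sigma.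
    apply: le_trans (enorm_sum _ _ _) _.
    apply: le_trans (_ : \sum_(i < d) sigma <= _); last first.
      by rewrite sumr_const card_ord -[in leLHS]mulr_natl.
    apply: ler_sum => i _; rewrite enormZ /enorm oe// eqxx sqrtr1 mulr1.
    have /andP[y0 y1] := yb i (ltn_ord i).
    have := truncnS_gt (y i); rewrite -natr1 => h1.
    have h2 : (Num.truncn (y i))%:R <= y i by rewrite truncn_le.
    rewrite ffunE /=.
    have -> : dotv t (e i) - ((Num.truncn (y i))%:R - L%:R) * sigma =
      (y i - (Num.truncn (y i))%:R) * sigma.
      by rewrite /y; field; rewrite gt_eqF.
    rewrite ger0_norm; last by rewrite mulr_ge0 ?subr_ge0// ltW.
    by rewrite ler_piMl ?(ltW sigma0)//; lra.
  lra.
have h := unif_prob_cover PX (@open_eball _ _ r rho) (@open_tube _ _ A sigma A0) a0 cov.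
apply: le_trans h _.
rewrite card_ffun !card_ord -/V ler_wpM2r//.
  by rewrite divr_ge0 ?(ltW V0)// exprn_ge0// mulr_ge0// ltW.
rewrite natrX lerXn2r ?nnegrE//; first by rewrite mulr_ge0// -/mu; lra.
by rewrite L2E -/mu; lra.
Qed.

(** Cubes of side [sigma / D.+1%:R] are placed at grid nodes of mesh [sigma] on the plane. Each lies
    in a Euclidean ball of radius [sigma / 2], so they are disjoint and in the tube. Taking [K]
    nodes per direction, the integer part of [a / (2 * d.+1%:R * sigma)], keeps all nodes within
    [a / 2] of [c]; rounding down loses at most a factor 2. *)
Lemma unif_prob_ball_ge c a : c - p0 \in T -> enorm (c - p0) <= rho / 6 ->
  a <= rho / 12 -> 2 * d.+1%:R * sigma <= a ->
  (a / (4 * d.+1%:R * sigma)) ^+ d * ((sigma / D.+1%:R) ^+ D / V) <=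
  unif_prob (tube A sigma) (eball c a).
Proof.
have [rs rg] := (rsigma, rho_ge); have [s0 t0 r0] := And3 sigma0 tau0 rho0.
move=> cT cp arho sa.
have d1 : 0 < d.+1%:R :> R by [].
have d1' : 1 <= d.+1%:R :> R by rewrite ler1n.
have ds0 : 0 < d.+1%:R * sigma by rewrite mulr_gt0.
have ds1 : sigma <= d.+1%:R * sigma by rewrite ler_peMl// ltW.
pose y := a / (2 * d.+1%:R * sigma).
have ds2 : 0 < 2 * d.+1%:R * sigma by rewrite -mulrA mulr_gt0.
have y1 : 1 <= y by rewrite ler_pdivlMr// mul1r.
pose K := Num.truncn y.
have K1 : K%:R <= y by rewrite truncn_le; lra.
have K2 : y / 2 <= K%:R.
  have := truncnS_gt y; rewrite -/K -natr1 => h.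
  have : (0 < K)%N by rewrite truncn_gt0.
  by rewrite -(ler_nat R) => ?; lra.
have yE : a = y * (2 * d.+1%:R * sigma) by rewrite /y divfK// gt_eqF.
pose b := sigma / (2 * D.+1%:R).
have b0 : 0 < b by rewrite divr_gt0// mulr_gt0.
have bE : D.+1%:R * (2 * b) = sigma.
  have : D.+1%:R != 0 :> R by rewrite pnatr_eq0.
  by rewrite /b; move: (D.+1%:R) => z z0; field.
have b2 : 2 * b = sigma / D.+1%:R by rewrite -bE mulrAC divff ?mul1r.
have Db : D%:R * b < sigma / 2 by move: bE; rewrite -natr1; lra.
clearbody b.
pose sum (k : {ffun 'I_d -> 'I_K}) := \sum_(i < d) ((k i)%:R * sigma) *: e i.
have e1 (i : 'I_d) : enorm (e i) = 1 by rewrite /enorm oe// eqxx sqrtr1.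
have sumT k : sum k \in T by apply: memv_suml => i _; rewrite memvZ// eT.
have sum_le k : enorm (sum k) <= a / 2.
  apply: le_trans (enorm_sum _ _ _) _.
  apply: le_trans (_ : \sum_(i < d) (y * sigma) <= _).
    apply: ler_sum => i _; rewrite enormZ e1 mulr1 ger0_norm ?mulr_ge0 ?(ltW s0)//.
    by rewrite ler_pM2r//; apply: le_trans K1; rewrite ler_nat ltnW.
  rewrite sumr_const card_ord -[leLHS]mulr_natl.
  have : d%:R * (y * sigma) <= d.+1%:R * (y * sigma).
    by rewrite ler_wpM2r ?ler_nat// mulr_ge0 ?(ltW s0)//; lra.
  by rewrite yE; lra.
have cubeE k x : cube (c + sum k) b x -> enorm (x - (c + sum k)) < sigma / 2.
  by move=> /cube_enorm h; apply: le_lt_trans h Db.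
have -> : sigma / D.+1%:R = 2 * b by [].
have -> : a / (4 * d.+1%:R * sigma) = y / 2.
  have : d.+1%:R != 0 :> R by rewrite pnatr_eq0.
  rewrite /y; move: (d.+1%:R) => z z0; field.
  by rewrite z0 gt_eqF.
apply: le_trans (unif_prob_packing PX (c := fun k => c + sum k) (@open_eball _ _ c a) b0 _ _ _).
- rewrite card_ffun !card_ord -/V natrX ler_wpM2r//.
    by rewrite divr_ge0 ?(ltW V0)// exprn_ge0// mulr_ge0// ltW.
  by rewrite lerXn2r ?nnegrE//; lra.
- move=> k x /cubeE xk; apply: (@plane_in_tube (c - p0 + sum k)).
  + by rewrite memvD.
  + by have := enormD (c - p0) (sum k); have := sum_le k; lra.
  + by rewrite addrA [p0 + _]addrC subrK.
- move=> k x /cubeE xk; rewrite /eball/=.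
  have := enorm_dist x (c + sum k) c; rewrite (addrAC c) subrr add0r => h.
  by have := sum_le k; lra.
(* Nodes whose cubes share a point are less than [sigma] apart, so their integer coordinates differ
   by less than 1. *)
- move=> k k' x /cubeE xk /cubeE xk'.
  have kk' : enorm (sum k - sum k') < sigma.
    have -> : sum k - sum k' = c + sum k - (c + sum k').
      by rewrite opprD addrACA subrr add0r.
    have := enorm_dist (c + sum k) x (c + sum k').
    rewrite (enorm_distC _ x); lra.
  apply/ffunP => i; apply/val_inj => /=.
  have : `|dotv (sum k - sum k') (e i)| < sigma.
    apply: le_lt_trans kk'; rewrite ler_norml.
    have := dotv_le (sum k - sum k') (e i); have := dotv_ge (sum k - sum k') (e i).
    by rewrite e1 mulr1 => -> ->.
  rewrite dotvDl dotvNl !(dotv_ortho_sum _ i oe) -mulrBl normrM (gtr0_norm s0).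
  rewrite -[X in _ < X]mul1r ltr_pM2r// ltr_norml => /andP[h1 h2].
  apply/eqP; rewrite eqn_leq; apply/andP; split.
    by rewrite -ltnS -(ltr_nat R) -natr1; lra.
  by rewrite -ltnS -(ltr_nat R) -natr1; lra.
Qed.

End volume.

End frame.

(** * The minimizer of Step 1 *)

Section contraction.
Context {R : realType} {D : nat}.

(* Replacing [e i] by [g i] in the expansion of [t] leaves a remainder in [T] at
   most half as long as [t]; iterating, the errors sum to a geometric series. *)
Lemma subspace_contraction (T H : {vspace 'rV[R]_D}) (d : nat) (e g : nat -> 'rV[R]_D) (c b : R) :
  orthonormal d e -> (forall i, (i < d)%N -> e i \in T) ->
  (forall v, v \in T -> v = \sum_(i < d) dotv v (e i) *: e i) ->
  (forall i, (i < d)%N -> g i \in T) ->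
  (forall i, (i < d)%N -> enorm (g i - e i) <= c) -> d%:R * c <= 1 / 2 ->
  0 < b -> (forall i, (i < d)%N -> exists2 h, h \in H & enorm (g i - h) <= b) ->
  forall t, t \in T -> exists2 h, h \in H & enorm (t - h) <= (2 * d%:R + 1) * b * enorm t.
Proof.
move=> oe eT Te gT gc dc b0 gH.
have {gH} /choice[h hP] : forall i : 'I_d, exists h : 'rV[R]_D, h \in H /\ enorm (g i - h) <= b.
  by move=> i; have [h hH gh] := gH i (ltn_ord i); exists h.
have d0 : 0 <= d%:R :> R by [].
have te t (i : 'I_d) : `|dotv t (e i)| <= enorm t.
  have e1 : enorm (e i) = 1 by rewrite /enorm oe// eqxx sqrtr1.
  rewrite ler_norml; have := dotv_le t (e i); have := dotv_ge t (e i).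
  by rewrite e1 mulr1 => -> ->.
have sum_le t (u : 'I_d -> 'rV[R]_D) k : (forall i, enorm (u i) <= k) ->
    enorm (\sum_(i < d) dotv t (e i) *: u i) <= d%:R * k * enorm t.
  move=> uk; apply: le_trans (enorm_sum _ _ _) _.
  apply: le_trans (_ : \sum_(i < d) k * enorm t <= _); last first.
    by rewrite sumr_const card_ord -[leLHS]mulr_natl mulrA.
  by apply: ler_sum => i _; rewrite enormZ mulrC ler_pM ?enorm_ge0.
have claim m t : t \in T -> exists2 y, y \in H &
    enorm (t - y) <= (2 * d%:R * b + (1 / 2) ^+ m) * enorm t.
  elim: m t => [|m IH] t tT.
    exists 0; first exact: mem0v.
    by rewrite subr0 expr0 ler_peMl ?enorm_ge0// lerDr !mulr_ge0// ltW.
  pose t' := \sum_(i < d) dotv t (e i) *: (e i - g i).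
  have t'T : t' \in T.
    by apply: memv_suml => i _; rewrite memvZ// memvB ?eT ?gT.
  have [y yH ty] := IH t' t'T.
  have t'le : enorm t' <= 1 / 2 * enorm t.
    apply: le_trans (sum_le t (fun i => e i - g i) c _) _.
      by move=> i; rewrite enorm_distC gc.
    by rewrite ler_wpM2r ?enorm_ge0.
  exists (\sum_(i < d) dotv t (e i) *: h i + y).
    by rewrite memvD//; apply: memv_suml => i _; rewrite memvZ//; have [] := hP i.
  have -> : t - (\sum_(i < d) dotv t (e i) *: h i + y) =
      \sum_(i < d) dotv t (e i) *: (g i - h i) + (t' - y).
    rewrite opprD !addrA; congr (_ - _).
    rewrite [X in X - _ = _](Te t tT) -sumrB -big_split; apply: eq_bigr => i _ /=.
    by rewrite -scalerBr -scalerDr; congr (_ *: _); rewrite [RHS]addrC subrKA.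
  have h1 := sum_le t (fun i => g i - h i) b (fun i => (hP i).2).
  have h2 : (2 * d%:R * b + (1 / 2) ^+ m) * enorm t' <=
      (2 * d%:R * b + (1 / 2) ^+ m) * (1 / 2 * enorm t).
    by rewrite ler_wpM2l// addr_ge0 ?exprn_ge0 ?mulr_ge0 ?divr_ge0// ltW.
  apply: le_trans (enormD _ _) _; rewrite exprS; lra.
move=> t tT.
(* Enough iterations for the remainder [(1 / 2) ^+ m] to be at most [b]; it is the [+ 1] in
   [2 * d%:R + 1]. *)
pose m := (Num.truncn b^-1).+1.
have bm : (1 / 2) ^+ m <= b.
  rewrite expr_div_n expr1n ler_pdivrMr ?exprn_gt0// mulrC -ler_pdivrMr//.
  rewrite mul1r; apply: ltW; apply: lt_trans (truncnS_gt _) _.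
  by rewrite -natrX ltr_nat ltn_expl.
have [y yH ty] := claim m t tT; exists y => //; apply: le_trans ty _.
by rewrite ler_wpM2r ?enorm_ge0//; lra.
Qed.

End contraction.

Section step1.
Context {R : realType} {D : nat} (A : set 'rV[R]_D) (tau sigma : R).
Hypotheses (A0 : A !=set0) (cA : compact A).
Hypothesis unique_nearest : forall x, edist x A < tau -> exists! p, nearest A x p.
Hypotheses (tau0 : 0 < tau) (sigma0 : 0 < sigma).
Let rho := Num.sqrt (sigma * tau).

(** The competitor [(p0, T)], feasible because [r - p0] is normal at [p0], bounds the sum of squared
    distances to [q + H] by [9 * sigma ^+ 2 * N]. If all samples of the cell, a fraction at least
    [c], were farther than [4 / c * sigma], the sum would be at least [16 * sigma ^+ 2 * N / c]. *)
Lemma step1_near (r p0 : 'rV[R]_D) (T : {vspace 'rV[R]_D}) (d : nat)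
    (n : nat) (x : 'I_n -> 'rV[R]_D) q H (c : R) (cell : set 'rV[R]_D) :
  nearest A r p0 -> enorm (r - p0) < sigma -> tangent_approx A p0 T -> \dim T = d ->
  2 * sigma <= rho ->
  (forall i, tube A sigma (x i)) -> 0 < c -> c <= 1 ->
  step1_output d sigma tau x r q H ->
  cell `<=` eball r rho ->
  0 < \sum_(i < n) \1_(eball r rho) (x i) :> R ->
  c * \sum_(i < n) \1_(eball r rho) (x i) <= \sum_(i < n) \1_cell (x i) ->
  exists y h t, [/\ cell y, h \in H, t \in T, enorm (y - q - h) <= (4 / c + 1) * sigma
     & enorm (y - p0 - t) <= 3 * sigma].
Proof.
move=> rp0 rsigma Tp0 dimT rho_ge xt c0 c1 [feas qmin] cellr N0 Ncell.
set N := \sum_(i < n) _ in N0 Ncell.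
have s0 := sigma0.
have rho0 : 0 < rho by lra.
have rho2 : rho ^+ 2 = sigma * tau by rewrite sqr_sqrtr// mulr_ge0 ?ltW.
have flat i : enorm (x i - r) < rho -> exists2 t, t \in T & enorm (x i - p0 - t) <= 3 * sigma.
  move=> xr; have [t tT [xt' _]] := tube_near_plane A0 cA unique_nearest rp0 Tp0 tau0 sigma0
    rsigma rho0 rho2 rho_ge (xt i) xr.
  by exists t.
have NE : N = #|[pred i | enorm (x i - r) < rho]|%:R.
  rewrite -sum1_card natr_sum big_mkcond; apply: eq_bigr => i _.
  by rewrite indicE; case: ifPn => h; [rewrite mem_set|rewrite memNset//; apply/negP].
have V0 (V : {vspace 'rV[R]_D}) : ([set` V] : set 'rV[R]_D) !=set0.
  by exists 0; rewrite /= mem0v.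
have feas0 : step1_feasible d sigma r p0 T.
  split=> //; first by move=> h hT; exact: nearest_orthogonal rp0 Tp0 hT.
  by lra.
have J0 : J1 sigma tau x r p0 T <= 9 * sigma ^+ 2.
  rewrite /J1 -/rho -NE ler_pdivrMl//.
  apply: le_trans (_ : \sum_(i < n | enorm (x i - r) < rho) 9 * sigma ^+ 2 <= _).
    apply: ler_sum => i /flat[t tT xit].
    have : edist (x i - p0) [set` T] <= 3 * sigma by apply: le_trans xit; exact: edist_le.
    have := edist_ge0 (x i - p0) (V0 T); nra.
  rewrite sumr_const -[leLHS]mulr_natl NE ler_wpM2r//.
  by rewrite mulr_ge0 ?sqr_ge0.
have sumH : \sum_(i < n | enorm (x i - r) < rho) edist (x i - q) [set` H] ^+ 2 <=
    9 * sigma ^+ 2 * N.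
  have := le_trans (qmin _ _ feas0) J0.
  by rewrite /J1 -/rho -NE ler_pdivrMl// mulrC.
have [i ci ei] : exists2 i, cell (x i) & edist (x i - q) [set` H] <= 4 / c * sigma.
  apply: contrapT => nex.
  have far i : cell (x i) -> 4 / c * sigma < edist (x i - q) [set` H].
    by move=> ci; rewrite ltNge; apply/negP => ei; apply: nex; exists i.
  have k0 : 0 < 4 / c * sigma by rewrite mulr_gt0// divr_gt0.
  have : (4 / c * sigma) ^+ 2 * \sum_(i < n) \1_cell (x i) <= 9 * sigma ^+ 2 * N.
    apply: le_trans sumH; rewrite mulr_sumr [leRHS]big_mkcond; apply: ler_sum => i _.
    rewrite indicE; case: (pselect (cell (x i))) => [ci|nci].
      rewrite mem_set// mulr1 ifT; last exact: cellr.
      by rewrite ler_sqr ?nnegrE ?(ltW k0)// ?edist_ge0// ltW// far.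
    rewrite memNset// mulr0; case: ifP => // _; exact: sqr_ge0.
  have h1 : (4 / c * sigma) ^+ 2 * (c * N) <= (4 / c * sigma) ^+ 2 * \sum_(i < n) \1_cell (x i).
    by rewrite ler_wpM2l// sqr_ge0.
  have h2 : (4 / c * sigma) ^+ 2 * (c * N) = 16 * sigma ^+ 2 * N / c by field; rewrite gt_eqF.
  have h3 : 0 < sigma ^+ 2 * N by rewrite mulr_gt0// exprn_gt0.
  have h4 : 16 * sigma ^+ 2 * N <= 16 * sigma ^+ 2 * N / c.
    rewrite ler_pdivlMr// ler_piMr//; lra.
  lra.
(* [edist] is an infimum; the extra [sigma] provides an actual vector of [H]. *)
have ei' : edist (x i - q) [set` H] < (4 / c + 1) * sigma by lra.
have [h hH xh] := edist_lt (V0 H) ei'.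
have [t tT xit] := flat i (cellr _ ci).
by exists (x i), h, t; split => //; exact: ltW.
Qed.

(** The offsets [q] and [p0] cancel in differences with the sample of the central cell. The radius
    [a = s / (8 * d.+1%:R)] and the bound [144 * d.+1%:R ^+ 2 * sigma <= rho] make [2 * a / s] and
    [6 * sigma / s] each at most [1 / (4 * d.+1%:R)], as [subspace_contraction] requires. *)
Lemma step1_subspace (r p0 : 'rV[R]_D) (T : {vspace 'rV[R]_D}) (d : nat)
    (e : nat -> 'rV[R]_D) (n : nat) (x : 'I_n -> 'rV[R]_D) q H (c : R) :
  let s := rho / 6 in let a := rho / (48 * d.+1%:R) in
  let center j := p0 + s *: (if (j < d)%N then e j else 0) in
  nearest A r p0 -> enorm (r - p0) < sigma -> tangent_approx A p0 T -> \dim T = d ->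
  orthonormal d e -> (forall i, (i < d)%N -> e i \in T) ->
  (forall v, v \in T -> v = \sum_(i < d) dotv v (e i) *: e i) ->
  144 * d.+1%:R ^+ 2 * sigma <= rho ->
  (forall i, tube A sigma (x i)) -> 0 < c -> c <= 1 ->
  step1_output d sigma tau x r q H ->
  0 < \sum_(i < n) \1_(eball r rho) (x i) :> R ->
  (forall j : 'I_d.+1, c * \sum_(i < n) \1_(eball r rho) (x i)
     <= \sum_(i < n) \1_(eball (center j) a) (x i)) ->
  forall t, t \in T -> exists2 h, h \in H &
    enorm (t - h) <= (2 * d%:R + 1) * (6 * (8 / c + 8) / (rho / sigma)) * enorm t.
Proof.
move=> s a center rp0 rsigma Tp0 dimT oe eT Te rho_ge xt c0 c1 out N0 Ncell.
have s0 := sigma0.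
have S1 : 1 <= d.+1%:R :> R by rewrite ler1n.
have S2 : d.+1%:R <= d.+1%:R ^+ 2 :> R by rewrite expr2 ler_peMl.
have S3 : d.+1%:R * sigma <= d.+1%:R ^+ 2 * sigma by rewrite ler_pM2r.
have S4 : sigma <= d.+1%:R * sigma by rewrite ler_peMl// ltW.
have rho0 : 0 < rho by lra.
have s_gt0 : 0 < s by rewrite /s divr_gt0.
have a0 : 0 < a by rewrite /a divr_gt0// mulr_gt0.
have aE : a * (8 * d.+1%:R) = s.
  have : d.+1%:R != 0 :> R by rewrite pnatr_eq0.
  by rewrite /a /s; move: (d.+1%:R) => z z0; field.
have aS : a <= a * d.+1%:R by rewrite ler_peMr// ltW.
have rhos : rho = 6 * s by rewrite /s; field.
have rho_ge2 : 2 * sigma <= rho by lra.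
have center_le j : enorm (center j - p0) <= s.
  rewrite /center addrAC subrr add0r enormZ_ge0 ?(ltW s_gt0)//.
  case: ifP => [jd|_]; last by rewrite enorm0 mulr0 ltW.
  by rewrite /enorm oe// eqxx sqrtr1 mulr1.
have cellr j : eball (center j) a `<=` eball r rho.
  move=> y; rewrite /eball/= => yc; have := center_le j.
  have := enorm_dist y (center j) r; have := enorm_dist (center j) p0 r.
  rewrite (enorm_distC p0 r); lra.
pose C2 := 4 / c + 1.
have /choice[f fP] : forall j : 'I_d.+1, exists f : 'rV[R]_D * 'rV[R]_D * 'rV[R]_D,
   [/\ eball (center j) a f.1.1, f.1.2 \in H, f.2 \in T,
       enorm (f.1.1 - q - f.1.2) <= C2 * sigma & enorm (f.1.1 - p0 - f.2) <= 3 * sigma].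
  move=> j.
  have [y [h [t hyp]]] := step1_near rp0 rsigma Tp0 dimT rho_ge2 xt c0 c1 out
    (@cellr j) N0 (Ncell j).
  by exists (y, h, t).
(* The index [d] falls in the [else] branch of [center]: this is the cell at [p0]. *)
pose l : 'I_d.+1 := ord_max.
have lE : center l = p0 by rewrite /center /l /= ltnn scaler0 addr0.
(* Rescaled difference of the components in [T] of two samples, close to [e i]; the corresponding
   difference in [H] is close to it as well. *)
pose g (i : nat) := s^-1 *: ((f (inord i)).2 - (f l).2).
have C2s : 0 < C2 * sigma by rewrite mulr_gt0// addr_gt0// divr_gt0.
have sigmas : 24 * (d.+1%:R * sigma) <= s by lra.
have nats : d%:R = d.+1%:R - 1 :> R by rewrite -natr1 addrK.
have key i : (i < d)%N -> let j : 'I_d.+1 := inord i in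
    enorm ((f j).2 - (f l).2 - s *: e i) <= 2 * a + 6 * sigma /\
    enorm (((f j).2 - (f l).2) - ((f j).1.2 - (f l).1.2)) <= 2 * (C2 + 3) * sigma.
  move=> id j; have jE : (j : nat) = i by rewrite inordK// ltnW.
  have [y1 h1 t1 yh1 yt1] := fP j; have [y2 h2 t2 yh2 yt2] := fP l.
  move: y1 y2; rewrite /eball/= lE {1}/center jE id => y1 y2.
  set ya := (f j).1.1 in y1 yh1 yt1; set yb := (f l).1.1 in y2 yh2 yt2.
  split.
    have -> : (f j).2 - (f l).2 - s *: e i =
       (ya - (p0 + s *: e i) - (ya - p0 - (f j).2)) - (yb - p0 - (yb - p0 - (f l).2)).
      by apply/rowP => k; rewrite !mxE; ring.
    apply: le_trans (enormB _ _) _.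
    have := enormB (ya - (p0 + s *: e i)) (ya - p0 - (f j).2).
    have := enormB (yb - p0) (yb - p0 - (f l).2).
    by clear -y1 y2 yt1 yt2; lra.
  have -> : (f j).2 - (f l).2 - ((f j).1.2 - (f l).1.2) =
     (ya - q - (f j).1.2 - (ya - p0 - (f j).2)) - (yb - q - (f l).1.2 - (yb - p0 - (f l).2)).
    by apply/rowP => k; rewrite !mxE; ring.
  apply: le_trans (enormB _ _) _.
  have := enormB (ya - q - (f j).1.2) (ya - p0 - (f j).2).
  have := enormB (yb - q - (f l).1.2) (yb - p0 - (f l).2).
  by clear -yh1 yh2 yt1 yt2; lra.
have bE : 6 * (8 / c + 8) / (rho / sigma) = 2 * (C2 + 3) * sigma / s.
  rewrite /C2 rhos; field.
  by rewrite !gt_eqF.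
rewrite bE.
apply: (subspace_contraction (e := e) (g := g) (c := (2 * a + 6 * sigma) / s)) => //.
- by move=> i id; rewrite memvZ// memvB//; [have [] := fP (inord i)|have [] := fP l].
- move=> i id; have [h _] := key i id.
  have -> : g i - e i = s^-1 *: ((f (inord i)).2 - (f l).2 - s *: e i).
    by rewrite [RHS]scalerBr scalerA mulVf ?gt_eqF// scale1r.
  by rewrite enormZ_ge0 ?invr_ge0 ?(ltW s_gt0)// mulrC ler_pM2r ?invr_gt0.
- rewrite mulrA ler_pdivrMr// nats.
  have h1 : 0 <= (d.+1%:R - 1) * sigma by rewrite mulr_ge0 ?subr_ge0// ltW.
  lra.
- rewrite divr_gt0// mulr_gt0// mulr_gt0// addr_gt0//.
  by rewrite /C2 addr_gt0// divr_gt0.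
- move=> i id; have [_ h] := key i id.
  exists (s^-1 *: ((f (inord i)).1.2 - (f l).1.2)).
    by rewrite memvZ// memvB//; [have [] := fP (inord i)|have [] := fP l].
  rewrite -scalerBr enormZ_ge0 ?invr_ge0 ?(ltW s_gt0)// mulrC ler_pM2r ?invr_gt0//.
Qed.

End step1.

(** * Volume fractions and the main theorem *)

Section cells.
Context {R : realType} {D : nat} (A : set 'rV[R]_D) (tau sigma : R).
Hypotheses (A0 : A !=set0) (cA : compact A).
Hypothesis unique_nearest : forall x, edist x A < tau -> exists! p, nearest A x p.
Hypothesis tangentA : forall p, A p -> exists T, tangent_approx A p T.
Variables (r p0 : 'rV[R]_D) (T : {vspace 'rV[R]_D}) (d : nat) (e : nat -> 'rV[R]_D).
Hypothesis rp0 : nearest A r p0.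
Hypothesis Tp0 : tangent_approx A p0 T.
Hypothesis oe : orthonormal d e.
Hypothesis eT : forall i, (i < d)%N -> e i \in T.
Hypothesis Te : forall v, v \in T -> v = \sum_(i < d) dotv v (e i) *: e i.
Hypotheses (tau0 : 0 < tau) (sigma0 : 0 < sigma).
Hypothesis rsigma : enorm (r - p0) < sigma.

Let rho := Num.sqrt (sigma * tau).
Hypothesis rho_ge : 144 * d.+1%:R ^+ 2 * sigma <= rho.

(* The quotient of the bounds of [unif_prob_ball_ge] and [unif_prob_ball_le]. *)
Definition cell_fraction : R :=
  (1 / (9 * (192 * d.+1%:R ^+ 2))) ^+ d * (1 / (2 * (4 + d%:R) * D.+1%:R)) ^+ D.

Lemma cell_fraction_gt0 : 0 < cell_fraction.
Proof.
by rewrite mulr_gt0// exprn_gt0// divr_gt0// !mulr_gt0// ?exprn_gt0// ltr_pwDl.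
Qed.

Lemma cell_fraction_le1 : cell_fraction <= 1.
Proof.
have S1 : 1 <= d.+1%:R :> R by rewrite ler1n.
have S2 : 1 <= d.+1%:R ^+ 2 :> R by rewrite exprn_ege1.
have D1 : 1 <= D.+1%:R :> R by rewrite ler1n.
have d0 : 0 <= d%:R :> R by [].
have le1 (z : R) n : 1 <= z -> 0 <= (1 / z) ^+ n <= 1.
  move=> z1; have z0 : 0 < z by lra.
  rewrite exprn_ge0 ?divr_ge0 ?(ltW z0)//= exprn_ile1 ?divr_ge0 ?(ltW z0)//.
  by rewrite ler_pdivrMr// mul1r.
have c1 : 1 <= 9 * (192 * d.+1%:R ^+ 2) :> R by lra.
have /andP[a0 a1] := le1 _ d c1.
have b1 : 1 <= 2 * (4 + d%:R) * D.+1%:R :> R.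
  have : (2 * (4 + d%:R)) * 1 <= (2 * (4 + d%:R)) * D.+1%:R :> R by rewrite ler_pM2l//; lra.
  lra.
have /andP[b0 b2] := le1 (2 * (4 + d%:R) * D.+1%:R) D b1.
by rewrite /cell_fraction -[leRHS]mul1r ler_pM.
Qed.

(** In the quotient of the two counting bounds the tube volume, [sigma] and [rho] all cancel, so the
    fraction is the same for every manifold and every [r]. The lower bound on [rho] ensures [2 *
    d.+1%:R * sigma <= rho / (48 * d.+1%:R)], so that grid cubes fit in the cell. *)
Lemma unif_prob_cell (disp : measure_display) (Om : measurableType disp)
    (P : probability Om R) (X : {RV P >-> borel_rV R D}) c :
  (forall Q : set (borel_rV R D), measurable Q ->
    P (X @^-1` Q) = (unif_prob (tube A sigma) Q)%:E) ->
  c - p0 \in T -> enorm (c - p0) <= rho / 6 ->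
  [/\ 0 < unif_prob (tube A sigma) (eball c (rho / (48 * d.+1%:R))),
      0 < unif_prob (tube A sigma) (eball r rho) &
      cell_fraction * unif_prob (tube A sigma) (eball r rho) <=
      unif_prob (tube A sigma) (eball c (rho / (48 * d.+1%:R)))].
Proof.
move=> PX cT cp; set a := rho / _.
have [s0 rg rs] := And3 sigma0 rho_ge rsigma.
have S1 : 1 <= d.+1%:R :> R by rewrite ler1n.
have S2 : d.+1%:R <= d.+1%:R ^+ 2 :> R by rewrite expr2 ler_peMl.
have S3 : d.+1%:R * sigma <= d.+1%:R ^+ 2 * sigma by rewrite ler_pM2r.
have S4 : sigma <= d.+1%:R * sigma by rewrite ler_peMl// ltW.
have rho0 : 0 < rho by lra.
have rho2 : rho ^+ 2 = sigma * tau by rewrite sqr_sqrtr// mulr_ge0 ?ltW.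
have rho_ge2 : 2 * sigma <= rho by lra.
have a0 : 0 < a by rewrite /a divr_gt0// mulr_gt0.
have aE : a * (48 * d.+1%:R) = rho by rewrite /a divfK// gt_eqF// mulr_gt0.
have aS : a <= a * d.+1%:R by rewrite ler_peMr// ltW.
have a12 : a <= rho / 12 by lra.
have aS2 : 2 * d.+1%:R * sigma <= a.
  have : (2 * d.+1%:R * sigma) * (48 * d.+1%:R) <= rho.
    apply: le_trans rg; have : 0 <= d.+1%:R ^+ 2 * sigma by lra.
    lra.
  by rewrite -aE ler_pM2r// mulr_gt0.
have V0 := lebesgue_support_gt0 PX.
have ball_le := unif_prob_ball_le A0 cA unique_nearest rp0 Tp0 oe Te tau0 sigma0 rs
  rho0 rho2 rho_ge2 PX.
have ball_ge := unif_prob_ball_ge A0 cA unique_nearest tangentA rp0 Tp0 oe eT tau0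
  sigma0 rs rho0 rho2 rho_ge2 PX cT cp a12 aS2.
have cell0 : 0 < unif_prob (tube A sigma) (eball c a).
  apply: lt_le_trans ball_ge.
  by rewrite mulr_gt0 ?divr_gt0 ?exprn_gt0 ?divr_gt0 ?mulr_gt0.
split => //.
- apply: lt_le_trans cell0 _.
  have mb c' b : measurable (eball c' b : set (borel_rV R D)).
    by apply: open_borel; exact: open_eball.
  rewrite -lee_fin -!PX//.
  apply: le_measure; rewrite ?inE; try by apply: measurable_RV; exact: mb.
  move=> w; rewrite /eball/= => yc.
  have := enorm_dist (X w) c r; have := enorm_dist c p0 r.
  by rewrite (enorm_distC p0 r); lra.
- apply: le_trans ball_ge.
  have cf := ltW cell_fraction_gt0.
  apply: le_trans (ler_wpM2l cf ball_le) _.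
  have regroup (x y u v w : R) : x ^+ d * y ^+ D * (u ^+ d * (v ^+ D / w)) =
      (x * u) ^+ d * ((y * v) ^+ D / w).
    by rewrite !exprMn mulrACA !mulrA.
  rewrite /cell_fraction regroup le_eqVlt; apply/orP; left; apply/eqP.
  have Sn0 : d.+1%:R != 0 :> R by rewrite pnatr_eq0.
  have Dn0 : D.+1%:R != 0 :> R by rewrite pnatr_eq0.
  have d4 : 4 + d%:R != 0 :> R by rewrite gt_eqF// ltr_pwDl.
  have sn0 : sigma != 0 by rewrite gt_eqF.
  congr (_ ^+ _ * (_ ^+ _ / _)).
    by rewrite /a; move: (d.+1%:R) Sn0 => z z0; field; rewrite z0 sn0.
  by move: (D.+1%:R) Dn0 (4 + d%:R) d4 => z z0 y y0; field; rewrite z0 y0.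
Qed.

End cells.

Theorem theorem3p2 (R : realType) (k d D : nat) (k_gt0 : (0 < k)%N) :
  exists M0 C_M : R, 0 < M0 /\ 0 < C_M /\
  forall (Mfd : set 'rV[R]_D) (tau sigma : R) (r : 'rV[R]_D),
    Mfd !=set0 -> compact Mfd -> is_submanifold k d Mfd ->
    reach Mfd = tau%:E ->
    0 < sigma -> M0 <= tau / sigma ->
    tube Mfd sigma r ->
    (forall delta : R, 0 < delta ->
       exists N_delta : nat, forall n : nat, (N_delta < n)%N ->
       forall (disp : measure_display) (T : measurableType disp)
         (P : probability T R) (X : 'I_n -> {RV P >-> borel_rV R D}),
         iid_uniform (tube Mfd sigma) X ->
         exists E : set T,
           [/\ measurable E, ((1 - delta)%:E <= P E)%E &
             forall w : T, E w ->
             forall (q p : 'rV[R]_D) (H : {vspace 'rV[R]_D}),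
               step1_output d sigma tau (fun i => X i w) r q H ->
               nearest Mfd q p ->
               angle_max d [set` H] (tangent_space Mfd p)
                 <= Num.sqrt (C_M / (tau / sigma))])
    /\
    (forall (n : nat) (disp : measure_display) (T : measurableType disp)
       (P : probability T R) (X : 'I_n -> {RV P >-> borel_rV R D}),
       iid_uniform (tube Mfd sigma) X ->
       forall (w : T) (q p : 'rV[R]_D) (H : {vspace 'rV[R]_D}),
         step1_output d sigma tau (fun i => X i w) r q H ->
         nearest Mfd q p ->
         enorm (p - q) <= 3 * sigma).
Proof.
have [a0 a0_gt0 acosP] := @acos_le_sqrt R.
(* The count of the ball may be twice, and that of a cell half, its expectation: hence the factor
   4. *)
pose c : R := @cell_fraction R D d / 4.
have cf0 := @cell_fraction_gt0 R D d; have cf1 := @cell_fraction_le1 R D d.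
have c0 : 0 < c by rewrite divr_gt0.
have c1 : c <= 1 by rewrite /c; lra.
have S1 : 1 <= d.+1%:R ^+ 2 :> R by rewrite exprn_ege1// ler1n.
have d0 : 0 <= d%:R :> R by [].
pose C4 : R := (2 * d%:R + 1) * (6 * (8 / c + 8)).
have C40 : 0 < C4.
  by rewrite mulr_gt0// ?mulr_gt0// ?addr_gt0 ?divr_gt0//; lra.
(* The 16 comes from [tangent_compare]; [C4] is doubled because the vector it is applied to has norm
   at most 2. *)
pose K : R := 16 + 2 * C4.
have K0 : 0 < K by rewrite /K; lra.
(* Threshold for [mu = rho / sigma], the square root of [tau / sigma]. The terms secure, in turn,
   the geometry of the cells, [K / mu <= a0] for [acos], and [K / mu < 1]. *)
pose mu0 : R := 144 * d.+1%:R ^+ 2 + K / a0 + K.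
have Ka0 : 0 < K / a0 by rewrite divr_gt0.
have mu0_gt0 : 0 < mu0 by rewrite /mu0; lra.
exists (mu0 ^+ 2), ((4 * K) ^+ 2); rewrite !exprn_gt0 ?mulr_gt0//; do 2 split => //.
move=> A tau sigma r A0 cA sub_A reachA sigma0 M_ge tube_r.
pose rho := Num.sqrt (sigma * tau); pose mu := rho / sigma.
have M0 : 0 < tau / sigma by apply: lt_le_trans M_ge; rewrite exprn_gt0.
have tau0 : 0 < tau by move: M0; rewrite pmulr_lgt0// invr_gt0.
have rho2 : rho ^+ 2 = sigma * tau by rewrite sqr_sqrtr// mulr_ge0 ?ltW.
have mu2 : mu ^+ 2 = tau / sigma.
  by rewrite /mu expr_div_n rho2; field; rewrite gt_eqF.
have mu_ge0 : 0 <= mu by rewrite divr_ge0 ?sqrtr_ge0// ltW.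
have mu_ge : mu0 <= mu.
  by rewrite -(@ler_sqr R) ?nnegrE ?(ltW mu0_gt0)// mu2.
have [mu144 muK muKa] : [/\ 144 * d.+1%:R ^+ 2 <= mu, K < mu & K / a0 <= mu].
  by move: mu_ge; rewrite /mu0; clear -Ka0 K0 S1; split; lra.
have mu16 : 16 <= mu by move: muK; rewrite /K; clear -C40; lra.
have mu_gt0 : 0 < mu by exact: lt_trans muK.
have rhoE : rho = mu * sigma by rewrite /mu divfK// gt_eqF.
have rho0 : 0 < rho by rewrite rhoE mulr_gt0.
have uniq x : edist x A < tau -> exists! p, nearest A x p by exact: reach_unique.
have tangentA p : A p -> exists T, tangent_approx A p T.
  by move=> /(submanifold_tangent k_gt0 sub_A)[T [_ ? _]]; exists T.
have [p0 rp0] := nearest_exists r A0 cA.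
have rsigma : enorm (r - p0) < sigma by rewrite -(nearest_edist rp0).
(* Feasibility puts [q] within [2 * sigma] of [r], itself within [sigma] of the manifold; no
   probability is involved. *)
have near3 q p H n (x : 'I_n -> 'rV[R]_D) : step1_output d sigma tau x r q H ->
    nearest A q p -> enorm (p - q) <= 3 * sigma.
  move=> [[_ _ rq] _] qp; rewrite enorm_distC -(nearest_edist qp).
  have := edist_lipschitz r q A0; rewrite (nearest_edist rp0) (enorm_distC q r); lra.
split; last first.
  by move=> n disp T P X _ w q p H out qp; exact: near3 out qp.
have [T [dimT Tp0 _]] := submanifold_tangent k_gt0 sub_A rp0.1.
have [e [oe eT Te]] := orthonormal_basis T.
rewrite dimT in oe eT Te.
have rho_ge : 144 * d.+1%:R ^+ 2 * sigma <= rho by rewrite rhoE ler_pM2r.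
pose center (j : nat) := p0 + (rho / 6) *: (if (j < d)%N then e j else 0).
(* [None] stands for the ball of radius [rho], [Some j] for the cells inside it, so that one event
   controls all counts. *)
pose Q (j : option 'I_d.+1) := if j is Some j' then
  eball (center j') (rho / (48 * d.+1%:R)) else eball r rho.
have oQ j : open (Q j) by case: j => [j|]; exact: open_eball.
move=> delta delta0.
have [N hN] := iid_counts (@open_tube _ _ A sigma A0) oQ delta0.
exists N => n nN disp Om P X unifX.
have PX : forall i (K : set (borel_rV R D)), measurable K ->
    P (X i @^-1` K) = (unif_prob (tube A sigma) K)%:E by exact: unifX.2.
have n_gt0 : (0 < n)%N := leq_ltn_trans (leq0n _) nN.
have centerT j : center j - p0 \in T.
  rewrite /center addrAC subrr add0r memvZ//; case: ifP => [/eT//|_].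
  exact: mem0v.
have center_le j : enorm (center j - p0) <= rho / 6.
  rewrite /center addrAC subrr add0r enormZ_ge0 ?divr_ge0 ?(ltW rho0)//.
  case: ifP => [jd|_]; last by rewrite enorm0 mulr0 divr_ge0// ltW.
  by rewrite /enorm oe// eqxx sqrtr1 mulr1.
(* Any one sample serves to compare the volumes; [n > N] guarantees that there is one. *)
have cell j := unif_prob_cell A0 cA uniq tangentA rp0 Tp0 oe eT Te tau0 sigma0
  rsigma rho_ge (PX (Ordinal n_gt0)) (centerT j) (center_le j).
have [|E [mE PE hE]] := hN n nN disp Om P X unifX.
  by case=> [j|]; [have [] := cell j | have [_] := cell 0%N].
(* [E] concerns counts only and is fixed before [q] and [H], so the bound holds for all minimizers
   at once. *)
exists E; split => // w Ew q p H out qp.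
have [Xtube counts] := hE w Ew.
have nR : 0 < n%:R :> R by rewrite ltr0n.
have pR : 0 < unif_prob (tube A sigma) (eball r rho) by have [_] := cell 0%N.
have Tnear := @step1_subspace R D A tau sigma A0 cA uniq tau0 sigma0 r p0 T d e n
  (fun i => X i w) q H c rp0 rsigma Tp0 dimT oe eT Te rho_ge Xtube c0 c1 out.
have {}Tnear t : t \in T -> exists2 h, h \in H & enorm (t - h) <= C4 / mu * enorm t.
  rewrite /C4 -[_ * (6 * _) / mu]mulrA; apply: Tnear.
    have /andP[h _] := counts None; apply: lt_le_trans h.
    by rewrite divr_gt0// mulr_gt0.
  move=> j; have /andP[_ h1] := counts None; have /andP[h2 _] := counts (Some j).
  have [_ _ h3] := cell j.
  have h4 : n%:R * (@cell_fraction R D d * unif_prob (tube A sigma) (eball r rho)) <=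
      n%:R * unif_prob (tube A sigma) (eball (center j) (rho / (48 * d.+1%:R))).
    by rewrite ler_pM2l.
  apply: le_trans h2; apply: le_trans (ler_wpM2l (ltW c0) h1) _.
  by rewrite /c /=; clear -h4; lra.
have [Tp [dimTp Tpp ->]] := submanifold_tangent k_gt0 sub_A qp.1.
pose kappa := K / mu.
have kappa0 : 0 < kappa by rewrite divr_gt0.
have kappa1 : kappa < 1 by rewrite ltr_pdivrMr// mul1r.
have kappaa : kappa <= a0.
  by rewrite ler_pdivrMr// -ler_pdivrMl// mulrC.
have -> : Num.sqrt ((4 * K) ^+ 2 / (tau / sigma)) = 4 * kappa.
  rewrite -mu2 -expr_div_n sqrtr_sqr ger0_norm ?mulrA//.
  by rewrite divr_ge0// ?mulr_ge0// ltW.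
have TpH t : t \in Tp -> enorm t = 1 -> exists2 h, h \in H & enorm (t - h) <= kappa.
  move=> tTp t1.
  have rhotau : rho < tau.
    have : rho * rho < rho * tau.
      by rewrite -expr2 rho2 ltr_pM2r// rhoE ltr_pMl// (lt_le_trans _ mu16)// ltr1n.
    by rewrite ltr_pM2l.
  have pp0 : enorm (p - p0) <= rho.
    have := near3 q p H n _ out qp; have [[_ _ rq] _] := out.
    have := enorm_dist p q p0; have := enorm_dist q r p0; rewrite (enorm_distC q r).
    have : 6 * sigma <= rho by rewrite rhoE ler_pM2r// (le_trans _ mu16)// ler_nat.
    by clear -rq rsigma; lra.
  have [u uT tu] := tangent_compare A0 cA tau0 uniq tangentA qp.1 rp0.1 Tpp Tp0 tTp t1
    rho0 rhotau pp0.
  have [h hH uh] := Tnear u uT.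
  (* [tangent_compare] at scale [rho] gives [16 * rho / tau], which is [16 / mu]. *)
  have tu' : enorm (t - u) <= 16 / mu.
    rewrite -(ler_pM2l tau0); apply: le_trans tu _.
    have -> : tau = mu ^+ 2 * sigma by rewrite mu2 divfK// gt_eqF.
    have -> : mu ^+ 2 * sigma * (16 / mu) = 16 * (mu * sigma) by field; rewrite gt_eqF.
    by rewrite rhoE.
  have u2 : enorm u <= 2.
    have := enorm_dist u t 0; rewrite !subr0 t1 (enorm_distC u t).
    have : 16 / mu <= 1 by rewrite ler_pdivrMr// mul1r.
    by clear -tu'; lra.
  exists h => //; apply: le_trans (enorm_dist _ u _) _.
  have : C4 / mu * enorm u <= C4 / mu * 2 by rewrite ler_pM2l// divr_gt0.
  by rewrite /kappa /K mulrDl; clear -tu' uh; lra.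
apply: angle_max_le => [|u w' pv j]; first by rewrite mulr_ge0// ltW.
have /andP[h1 h2] : 1 - kappa ^+ 2 <= dotv (u j) (w' j) <= 1.
  by apply: (principal_cos_ge pv); rewrite ?dimTp// ltW.
exact: acosP.
Qed.
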